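(* Let $\beta=1$ and let $k=k(n)$ be integers with $1\le k\le n$ and $k=o(n^{1/4})$ as $n\to\infty$. Then there exist constants $c_1,c_2>0$, not depending on $n$, such that the mixing time of the randomized systematic scan dynamics for the Ising model on $K_n$ satisfies $$c_1\frac{n^{3/2}}{k}\le t_{\mathrm{mix}}(1/4)\le c_2\frac{n^{3/2}}{k}.$$
   Context: Let $V=\{1,\dots,n\}$, $\Omega=\{-1,+1\}^V$, and let $\beta>0$. The mean-field Ising model (complete graph $K_n$, no external field) is the Gibbs measure $\pi(\sigma)\propto\exp\big(\frac{\beta}{n}\sum_{1\le v<w\le n}\sigma(v)\sigma(w)\big)$ on $\Omega$. The magnetization is $S(\sigma)=\frac1n\sum_{v}\sigma(v)$, and $p_+(x)=\frac{1+\tanh(\beta x)}{2}$. A single-site update of $\sigma$ at $v$ replaces $\sigma(v)$ by $+1$ with probability $p_+(S(\sigma)-\sigma(v)/n)$ and by $-1$ otherwise. The randomized systematic scan dynamics with parameter $k$ is the Markov chain $(X_t)_{t\ge0}$ on $\Omega$ in which, at each time step, $k$ distinct vertices are chosen uniformly at random from $V$ together with a uniformly random ordering $v_1,\dots,v_k$ of them, and single-site updates are performed successively at $v_1,\dots,v_k$ (each with respect to the current configuration), producing $X_{t+1}$. Its stationary distribution is $\pi$. Let $P$ be its transition matrix, $d(t)=\max_{\sigma\in\Omega}\|P^t(\sigma,\cdot)-\pi\|_{TV}$ and $t_{\mathrm{mix}}(\epsilon)=\min\{t: d(t)\le\epsilon\}$. *)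

(* Defs.v *)
From HB Require Import structures.
From mathcomp Require Export all_boot all_order all_algebra.
From mathcomp Require Export all_classical all_reals all_analysis.

Set Implicit Arguments.
Unset Strict Implicit.
Unset Printing Implicit Defensive.

Import Order.TTheory GRing.Theory Num.Theory.
Import numFieldNormedType.Exports.

Local Open Scope ring_scope.

Section FiniteMarkovChain.
Variables (R : realType) (T : finType).

(* Matrices indexed by T are functions T -> T -> R; K x y is the probability
   of moving from x to y. *)
Definition kid (x y : T) : R := (x == y)%:R.

(* A step of K followed by a step of L. *)
Definition kcomp (K L : T -> T -> R) (x y : T) : R := \sum_z K x z * L z y.

Definition kpow (K : T -> T -> R) (t : nat) : T -> T -> R :=
  iter t (kcomp K) kid.

Definition total_variation (mu nu : T -> R) : R :=
  \big[Num.max/0]_(A : {set T}) `|\sum_(x in A) mu x - \sum_(x in A) nu x|.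

Definition mixing_dist (K : T -> T -> R) (mu : T -> R) (t : nat) : R :=
  \big[Num.max/0]_x total_variation (kpow K t x) mu.

(* The infimum is a minimum unless the set is empty, in which case it
   is +oo. *)
Definition mixing_time (K : T -> T -> R) (mu : T -> R) (eps : R) : \bar R :=
  ereal_inf [set t%:R%:E | t in [set t : nat | mixing_dist K mu t <= eps]].

End FiniteMarkovChain.

Section MeanFieldIsing.
Variables (R : realType) (n : nat).

(* The value true stands for the spin +1, and false for -1. *)
Definition config : finType := {ffun 'I_n -> bool}.

Definition spin (sigma : config) (v : 'I_n) : R := if sigma v then 1 else -1.

Definition gibbs_weight (beta : R) (sigma : config) : R :=
  expR (beta / n%:R *
        \sum_(v < n) \sum_(w < n | (v < w)%N) spin sigma v * spin sigma w).

Definition gibbs (beta : R) (sigma : config) : R :=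
  gibbs_weight beta sigma / \sum_(tau : config) gibbs_weight beta tau.

Definition magnetization (sigma : config) : R :=
  n%:R^-1 * \sum_(v < n) spin sigma v.

Definition tanh (x : R) : R := (expR x - expR (- x)) / (expR x + expR (- x)).

Definition p_plus (beta x : R) : R := (1 + tanh (beta * x)) / 2.

Definition set_spin (sigma : config) (v : 'I_n) (b : bool) : config :=
  [ffun w => if w == v then b else sigma w].

Definition site_update (beta : R) (v : 'I_n) (sigma tau : config) : R :=
  let p := p_plus beta (magnetization sigma - spin sigma v / n%:R) in
  p * (tau == set_spin sigma v true)%:R
  + (1 - p) * (tau == set_spin sigma v false)%:R.

(* The head of the sequence is updated first. *)
Definition scan_update (beta : R) (s : seq 'I_n) : config -> config -> R :=
  foldr (fun v K => kcomp (site_update beta v) K) (@kid R config) s.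

(* Choosing k distinct vertices and an ordering of them, both uniformly, is
   choosing a uniform duplicate-free k-tuple of vertices. *)
Definition randomized_systematic_scan (beta : R) (k : nat)
    (sigma tau : config) : R :=
  (#|[set s : k.-tuple 'I_n | uniq s]|%:R)^-1 *
  \sum_(s : k.-tuple 'I_n | uniq s) scan_update beta s sigma tau.

End MeanFieldIsing.

(* Main.v *)
Require Import Defs.
From mathcomp Require Import perm ring lra zify.
Import Order.TTheory GRing.Theory Num.Theory.
Import numFieldNormedType.Exports.
Local Open Scope ring_scope.
Set Implicit Arguments.
Unset Strict Implicit.
Unset Printing Implicit Defensive.

(** Time runs through functions rather than laws: a scan acts on functions as
    the average [rscan k] of products of the one-site conditional expectations
    [heat v], and the mixing distance is controlled by the oscillation of the
    iterates of [rscan k]. Each [heat v] is an orthogonal projection in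
    [L^2(pi)], and reversing a uniform ordering gives a uniform ordering, so
    [rscan k] is self-adjoint ([rscan_selfadjoint]). Write [M] for the total
    spin, which at [beta = 1] fluctuates on the scale [n^(3/4)].

    Lower bound. A one-site update changes [M] by at most [2], so the Dirichlet
    form of [M] for a whole scan is [O(k)] ([rscan_dirichlet_le]), whereas the
    variance of [M] is at least of order [n^(3/2)] ([nsq_total_spin_ge]). A mean
    zero function with such a ratio decays at rate [O(k / n^(3/2))] per scan,
    and a chain mixed at time [t] halves all oscillations every [t] scans
    ([relaxation_lower_bound]).

    Upper bound. Let [f] take values in [[0, 1]]; after [O(n^(3/2) / k)] scans
    the iterate of [f] is nearly constant, by the following approximations,
    assembled in [rscan_nearly_constant].
    - A function that changes sign when two sites are exchanged shrinks by a
      factor [1 - pmin k / n] in a scan, because the last update of one of the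
      two sites makes them agree, and the function vanish, with probability at
      least [pmin]. Hence the iterates approach symmetric functions, that is,
      functions of [M] ([symm_close]).
    - By self-adjointness the scan following [t] scans dissipates at most
      [1 / (t + 1)] of the square norm ([dirichlet_decay]). Some stage [j < k]
      inside that scan dissipates at most a [k]-th of this
      ([scan_nsq_pigeonhole]), so the function [G] reached after [j] sites has
      one-site energy [O(1 / (k t)) + O(k^2 / n^2)] ([grad_energy_rscan]). The
      second term comes from the sites already visited, and it must be small
      against [n^(-3/2)]: this is where [k = o(n^(1/4))] enters.
    - In a window of width of order [n^(3/4)] every value of [M] has probability
      at least of order [n^(-3/4)]: at the critical temperature the terms linear
      in [M / n] cancel in the logarithm of the ratio of consecutive
      probabilities ([occ_step], [occ_ge]). By Cauchy-Schwarz a symmetric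
      function of energy [e] then oscillates by [O(n^(3/4) e^(1/2))] in the
      window ([window_osc]), so [G] is nearly constant there.
    - The other [k - j] sites of the scan may be replaced by independent uniform
      sites at a cost [k^2 / n] ([rscan_glauber]), after which it only matters
      that the chain is likely to be in the window.
    - It is, from any start: the expectation [y] of [M^2] has drift at most
      [- c k y^2 / n^3 + C k], since [x tanh x <= x^2 - x^4 / 8] and the
      quadratic terms of order one cancel at [beta = 1]; thus [y] is
      [O(n^(3/2))] after [O(n^(3/2) / k)] scans ([burn_in]).

    These estimates hold for large [n]; each of the finitely many remaining
    chains mixes in finite time ([mixing_finite]). *)

(** * Exponential and hyperbolic tangent *)

Section Exponential.
Variable R : realType.
Implicit Types x u : R.

Lemma nondecreasing_of_derive (f f' : R -> R) (b : R) :
  (forall x, is_derive x 1 f (f' x)) -> (forall x, 0 < x < b -> 0 <= f' x) ->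
  forall x, 0 <= x <= b -> f 0 <= f x.
Proof.
move=> df f'0 x /andP[x0 xb].
apply: (@ger0_derive1_ndecr _ f 0 b) => //.
- by move=> y; rewrite in_itv /= => yb; rewrite derive1E derive_val; exact: f'0.
- apply: continuous_subspaceT => y; apply: differentiable_continuous.
  exact/derivable1_diffP.
Qed.

Lemma expR_sub_ge x : 0 <= x -> 2 * x <= expR x - expR (- x).
Proof.
move=> x0; pose f (y : R) := expR y - expR (- y) - 2 * y.
suff : f 0 <= f x by rewrite /f oppr0 => ?; lra.
apply: (@nondecreasing_of_derive f (fun y => expR y + expR (- y) - 2) x);
  last by rewrite x0 /=.
  move=> y; rewrite /f; apply: is_derive_eq.
  by rewrite /GRing.scale /=; ring.
move=> y _; have := expR_gt0 y; rewrite expRN; set e := expR y => e0.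
have -> : e + e^-1 - 2 = (e - 1) ^+ 2 / e by field; rewrite gt_eqF.
by rewrite divr_ge0 ?sqr_ge0 // ltW.
Qed.

Lemma expR_le5 x : x <= 1 -> expR x <= 7 / 2.
Proof.
move=> x1; apply: (@le_trans _ _ (expR 1)); first by rewrite ler_expR.
have h : 3 / 4 <= expR (- (1 / 4)) :> R by have := expR_ge1Dx (- (1/4) : R); lra.
have : expR (- (1/4)) ^+ 4 = (expR 1)^-1 :> R.
  by rewrite -expRM_natl -expRN; congr expR; field.
have : (3/4) ^+ 4 <= expR (- (1/4)) ^+ 4 :> R by rewrite lerXn2r ?nnegrE ?expR_ge0 //; lra.
move=> h1 h2; have e0 : 0 < expR 1 :> R by exact: expR_gt0.
move: h1; rewrite h2 -[leRHS]div1r ler_pdivlMr //; lra.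
Qed.

(** The quartic term is what remains of the drift of the squared total spin at
    the critical temperature; after clearing denominators the claim is compared
    at [0] and differentiated once. *)
Lemma tanh_taylor x : `|x| <= 1 -> x * tanh x <= x ^+ 2 - x ^+ 4 / 8.
Proof.
wlog x0 : x / 0 <= x.
  move=> h xn; have [x0|/ltW x0] := leP 0 x; first exact: h.
  have := h (- x); rewrite normrN oppr_ge0 => /(_ x0 xn).
  rewrite /tanh opprK => le; apply: le_trans (le_trans le _).
    by rewrite le_eqVlt; apply/orP; left; apply/eqP; rewrite [expR (- x) + expR x]addrC; ring.
  by rewrite le_eqVlt; apply/orP; left; apply/eqP; ring.
rewrite ger0_norm // => x1.
pose f (y : R) := (y - y ^+ 3 / 8) * (expR y + expR (- y)) - (expR y - expR (- y)).
have : f 0 <= f x.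
  apply: (@nondecreasing_of_derive f (fun y => (y - y ^+ 3 / 8) * (expR y - expR (- y)) -
    3 / 8 * y ^+ 2 * (expR y + expR (- y))) 1); last by rewrite x0 x1.
    move=> y; rewrite /f; apply: is_derive_eq.
    by rewrite /GRing.scale /=; field.
  move=> y /andP[y0 y1].
  have h1 := expR_sub_ge (ltW y0).
  have h2 := expR_le5 (ltW y1).
  have h3 : expR (- y) <= 1 by rewrite -[leRHS]expR0 ler_expR; lra.
  have h4 : 0 <= y ^+ 2 by exact: sqr_ge0.
  have h5 : 7/8 * y <= y - y ^+ 3 / 8.
    have : y ^+ 2 <= 1 by rewrite exprn_ile1 // ltW.
    by rewrite (_ : y ^+ 3 = y * y ^+ 2); [nra | ring].
  have : (7/8 * y) * (2 * y) <= (y - y ^+ 3 / 8) * (expR y - expR (- y)).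
    by apply: ler_pM => //; lra.
  have : 3 / 8 * y ^+ 2 * (expR y + expR (- y)) <= 3 / 8 * y ^+ 2 * (9 / 2).
    by apply: ler_wpM2l; lra.
  rewrite (_ : 7 / 8 * y * (2 * y) = 7 / 4 * y ^+ 2); last by field.
  by move=> ? ?; lra.
rewrite /f oppr0 => le.
have D : 0 < expR x + expR (- x) by rewrite addr_gt0 ?expR_gt0.
rewrite /tanh (_ : x ^+ 2 - x ^+ 4 / 8 = x * (x - x ^+ 3 / 8)); last by field.
by apply: ler_wpM2l => //; rewrite ler_pdivrMr //; lra.
Qed.

(** With [expR2_ratio_ge], this compares [(1 + u) / (1 - u)] with [expR (2 * u)]
    up to a factor of third order in [u], which is the critical cancellation in
    the ratio of consecutive occupation probabilities. *)
Lemma expR2_ratio_le u : 0 <= u < 1 -> (1 - u) * expR (2 * u) <= 1 + u.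
Proof.
move=> /andP[u0 u1]; pose f (y : R) := (1 + y) - (1 - y) * expR (2 * y).
suff : f 0 <= f u by rewrite /f mulr0 expR0 => ?; lra.
apply: (@nondecreasing_of_derive f (fun y => 1 - (1 - 2 * y) * expR (2 * y)) u);
  last by rewrite u0 /=.
  move=> y; rewrite /f; apply: is_derive_eq.
  by rewrite /GRing.scale /=; ring.
move=> y _; have := expR_ge1Dx (- (2 * y)); rewrite expRN.
have e0 : 0 < expR (2 * y) by exact: expR_gt0.
rewrite -[leRHS]div1r ler_pdivlMr // => ?; lra.
Qed.

Lemma expR_ge_quad x : 0 <= x -> 1 + x + x ^+ 2 / 2 <= expR x.
Proof.
move=> x0; pose f (y : R) := expR y - (1 + y + y ^+ 2 / 2).
suff : f 0 <= f x by rewrite /f expR0 => ?; lra.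
apply: (@nondecreasing_of_derive f (fun y => expR y - (1 + y)) x); last by rewrite x0 /=.
  move=> y; rewrite /f; apply: is_derive_eq.
  by rewrite /GRing.scale /=; field.
by move=> y _; rewrite subr_ge0; exact: expR_ge1Dx.
Qed.

Lemma expR2_ratio_ge u : 0 <= u <= 1 / 2 ->
  1 + u <= (1 - u) * expR (2 * u + 2 * u ^+ 3).
Proof.
move=> /andP[u0 u1]; have u3 : 0 <= u ^+ 3 by rewrite exprn_ge0.
have h : 0 <= 2 * u + 2 * u ^+ 3 by lra.
have := expR_ge_quad h => le.
have h1 : 0 <= 1 - u by lra.
apply: le_trans (ler_wpM2l h1 le); rewrite -subr_ge0.
have -> : (1 - u) * (1 + (2 * u + 2 * u ^+ 3) + (2 * u + 2 * u ^+ 3) ^+ 2 / 2) - (1 + u) =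
  u ^+ 4 * (2 - 4 * u) + u ^+ 6 * (2 - 2 * u) by field.
by rewrite addr_ge0 // mulr_ge0 ?exprn_ge0 //; lra.
Qed.

End Exponential.
(** * Elementary real inequalities *)

Section Reals.
Variable R : realType.

Lemma bernoulli_ge (x : R) m : 0 <= x -> 1 + m%:R * x <= (1 + x) ^+ m.
Proof.
move=> x0; elim: m => [|m IH]; first by rewrite mul0r addr0.
rewrite exprS; have h : 0 <= 1 + x by lra.
apply: le_trans (ler_wpM2l h IH); rewrite -natr1.
have : 0 <= m%:R * x ^+ 2 :> R by rewrite mulr_ge0 ?sqr_ge0.
by rewrite -subr_ge0; congr (0 <= _); ring.
Qed.

Lemma bernoulli_le (x : R) m : x <= 1 -> 1 - m%:R * x <= (1 - x) ^+ m.
Proof.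
move=> x1; elim: m => [|m IH]; first by rewrite mul0r subr0.
rewrite exprS; have h : 0 <= 1 - x by lra.
apply: le_trans (ler_wpM2l h IH); rewrite -natr1.
have : 0 <= m%:R * x ^+ 2 :> R by rewrite mulr_ge0 ?sqr_ge0.
by rewrite -subr_ge0; congr (0 <= _); ring.
Qed.

Lemma exp_one_sub_le (x : R) m : 0 <= x <= 1 -> m%:R * x <= 1 ->
  (1 - x) ^+ m <= 1 - m%:R * x / 2.
Proof.
move=> /andP[x0 x1] mx; have mx0 : 0 <= m%:R * x by rewrite mulr_ge0.
have h := bernoulli_ge m x0.
have p : (1 - x) ^+ m * (1 + x) ^+ m <= 1.
  rewrite -exprMn (_ : (1 - x) * (1 + x) = 1 - x ^+ 2); last by ring.
  by rewrite exprn_ile1 //; nra.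
have q : 0 <= (1 - x) ^+ m by rewrite exprn_ge0 //; lra.
nra.
Qed.

(** Comparison with the equation [y' = - a / 2 * y ^ 2], whose solutions are at
    most [2 / (a * t)]: above [b] the term [d] takes at most half of the
    decrease, and a step from below [b] rises above it by at most [d]. *)
Lemma quadratic_decay (y : nat -> R) (a d b : R) :
  0 < a -> 0 <= d -> 0 <= b -> 2 * d <= a * b ^+ 2 ->
  (forall t, 0 <= y t) -> (forall t, y t.+1 <= y t - a * y t ^+ 2 + d) ->
  forall t, y t <= b + d \/ a * t%:R * y t <= 2.
Proof.
move=> a0 d0 b0 db y0 rec; elim=> [|t IH]; first by right; rewrite mulr0 mul0r.
have := rec t; set z := y t; set z' := y t.+1 => rz.
have z0 : 0 <= z := y0 t.
have [zb|/ltW zb] := leP z b.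
  left; have : 0 <= a * z ^+ 2 by rewrite mulr_ge0 ?sqr_ge0 ?ltW.
  by move=> ?; lra.
have h : 2 * d <= a * z ^+ 2.
  by apply: le_trans db _; rewrite ler_wpM2l ?(ltW a0) // lerXn2r ?nnegrE.
case: IH; rewrite -/z => IH; first by left; lra.
right.
have : z' <= z - a * z ^+ 2 / 2 by lra.
pose w := a * z; have w0 : 0 <= w by rewrite mulr_ge0 // ltW.
have tw : t%:R * w <= 2 by move: IH; rewrite /w; congr (_ <= _); ring.
move=> h1; have : a * z' <= w - w ^+ 2 / 2.
  rewrite (_ : w - w ^+ 2 / 2 = a * (z - a * z ^+ 2 / 2)); last by rewrite /w; field.
  by rewrite ler_pM2l.
move=> h2; rewrite mulrAC -natr1.
have t0 : 0 <= t%:R :> R by [].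
apply: (@le_trans _ _ ((w - w ^+ 2 / 2) * (t%:R + 1))).
  by rewrite ler_wpM2r // addr_ge0.
rewrite -subr_ge0.
have -> : 2 - (w - w ^+ 2 / 2) * (t%:R + 1) =
  (2 - t%:R * w) * (1 - w / 2) + w ^+ 2 / 2 by field.
have w2 := sqr_ge0 w; case: (posnP t) => [t00|tp].
  by rewrite t00 mul0r subr0; have := sqr_ge0 (w - 1); lra.
have : 1 <= t%:R :> R by rewrite ler1n.
move=> t1; have w2' : w <= 2 by nra.
by apply: addr_ge0; [apply: mulr_ge0; lra | lra].
Qed.

Lemma bounded_exp_le1 (y c : R) : (forall m, y ^+ m <= c) -> y <= 1.
Proof.
move=> h; rewrite leNgt; apply/negP => y1.
have c0 : 0 <= c by apply: le_trans (h 0%N).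
have d0 : 0 < y - 1 by lra.
pose m := (Num.truncn (c / (y - 1))).+1.
have mP : c / (y - 1) < m%:R by apply: truncnS_gt.
move: mP; rewrite ltr_pdivrMr // => mP.
have := bernoulli_ge m (ltW d0); rewrite (_ : 1 + (y - 1) = y) => [b|]; last by ring.
by have := h m => ?; lra.
Qed.

End Reals.

(** * Averaging operators *)

Section Averages.
Variable R : realType.

Definition mean (I : finType) (S : {set I}) (F : I -> R) : R :=
  #|S|%:R^-1 * \sum_(i in S) F i.

Section Mean.
Variables (I : finType) (S : {set I}).

Lemma eq_mean F G : {in S, F =1 G} -> mean S F = mean S G.
Proof. by move=> FG; congr (_ * _); apply: eq_bigr. Qed.

Lemma mean_lin a F G :
  mean S (fun i => a * F i + G i) = a * mean S F + mean S G.
Proof. by rewrite /mean big_split -mulr_sumr /=; ring. Qed.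

Lemma meanB F G : mean S (fun i => F i - G i) = mean S F - mean S G.
Proof. by rewrite /mean big_split /= sumrN; ring. Qed.

Lemma ler_mean F G : {in S, forall i, F i <= G i} -> mean S F <= mean S G.
Proof. by move=> FG; rewrite ler_wpM2l ?invr_ge0 ?ler0n ?ler_sum. Qed.

Lemma ler_norm_mean F : `|mean S F| <= mean S (fun i => `|F i|).
Proof.
rewrite normrM ger0_norm ?invr_ge0 ?ler0n // ler_wpM2l ?invr_ge0 ?ler0n //.
exact: ler_norm_sum.
Qed.

Hypothesis S_gt0 : (0 < #|S|)%N.

Lemma mean_cst c : mean S (fun=> c) = c.
Proof.
rewrite /mean sumr_const -[c *+ _]mulr_natl mulrA mulVf ?mul1r //.
by rewrite pnatr_eq0 -lt0n.
Qed.

(** Expand the nonnegative mean of [(F i - mean S F) ^+ 2]. *)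
Lemma mean_sqr_le F : mean S F ^+ 2 <= mean S (fun i => F i ^+ 2).
Proof.
set m := mean S F.
have : 0 <= mean S (fun i => (F i - m) ^+ 2).
  rewrite mulr_ge0 ?invr_ge0 ?ler0n // sumr_ge0 // => i _; exact: sqr_ge0.
suff -> : mean S (fun i => (F i - m) ^+ 2) =
  mean S (fun i => F i ^+ 2) - m ^+ 2 by rewrite subr_ge0.
have -> : mean S (fun i => (F i - m) ^+ 2) =
  mean S (fun i => - (2 * m) * F i + (1 * F i ^+ 2 + m ^+ 2)).
  by apply: eq_mean => i _; ring.
by rewrite mean_lin mean_lin mean_cst -/m; ring.
Qed.

End Mean.

(** A Markov kernel seen through its action on functions, so that updates, scans,
    their mixtures and the expectation under a law are instances of one notion. *)
Record averaging (X : finType) (T : (X -> R) -> X -> R) : Prop := Averaging {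
  avg_lin : forall a (f g : X -> R) x,
    T (fun y => a * f y + g y) x = a * T f x + T g x;
  avg_ge0 : forall f : X -> R, (forall x, 0 <= f x) -> forall x, 0 <= T f x;
  avg_one : forall x, T (fun=> 1) x = 1 }.

Section Averaging.
Variables (X : finType) (T : (X -> R) -> X -> R).
Hypothesis avT : averaging T.

Lemma avg_zero x : T (fun=> 0) x = 0.
Proof.
have := avg_lin avT (-1) (fun=> 0) (fun=> 0) x.
have -> : (fun _ : X => -1 * 0 + 0) = (fun=> 0 : R) by apply/funext => y; ring.
by move=> e; lra.
Qed.

Lemma avgZ a f x : T (fun y => a * f y) x = a * T f x.
Proof.
have := avg_lin avT a f (fun=> 0) x; rewrite avg_zero addr0 => <-.
by congr (T _ x); apply/funext => y; rewrite addr0.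
Qed.

Lemma avgD f g x : T (fun y => f y + g y) x = T f x + T g x.
Proof.
rewrite -[T f x]mul1r -(avg_lin avT); congr (T _ x).
by apply/funext => y; rewrite mul1r.
Qed.

Lemma avgB f g x : T (fun y => f y - g y) x = T f x - T g x.
Proof.
have -> : (fun y => f y - g y) = (fun y => -1 * g y + f y).
  by apply/funext => y; ring.
by rewrite (avg_lin avT); ring.
Qed.

Lemma avg_cst c x : T (fun=> c) x = c.
Proof.
by rewrite -[RHS]mulr1 -(avg_one avT x) -avgZ mulr1.
Qed.

Lemma avg_le f g : (forall x, f x <= g x) -> forall x, T f x <= T g x.
Proof.
move=> fg x; rewrite -subr_ge0 -avgB.
by apply: (avg_ge0 avT) => y; rewrite subr_ge0.
Qed.

Lemma avg_range f a b : (forall x, a <= f x <= b) -> forall x, a <= T f x <= b.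
Proof.
move=> h x; apply/andP; split.
  by rewrite -(avg_cst a x); apply: avg_le => y; have /andP[] := h y.
by rewrite -(avg_cst b x); apply: avg_le => y; have /andP[] := h y.
Qed.

Lemma avg_norm_le f c : (forall x, `|f x| <= c) -> forall x, `|T f x| <= c.
Proof.
move=> h x; rewrite ler_norml; apply: avg_range => y; by rewrite -ler_norml.
Qed.

Lemma avg_dist_le f g c :
  (forall x, `|f x - g x| <= c) -> forall x, `|T f x - T g x| <= c.
Proof. by move=> h x; rewrite -avgB; exact: avg_norm_le. Qed.

Lemma avg_norm f x : `|T f x| <= T (fun y => `|f y|) x.
Proof.
rewrite ler_norml -mulN1r -avgZ; apply/andP; split; apply: avg_le => y.
  by rewrite mulN1r lerNl -normrN ler_norm.
exact: ler_norm.
Qed.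

Lemma avg_mean (I : finType) (S : {set I}) (F : I -> X -> R) x :
  T (fun y => mean S (fun i => F i y)) x = mean S (fun i => T (F i) x).
Proof.
rewrite /mean avgZ; congr (_ * _).
rewrite (_ : (fun y => _) = (fun y => \sum_(i <- enum S) F i y)); last first.
  by apply/funext => y; rewrite big_enum.
rewrite -big_enum; elim: (enum S) => [|i r IH].
  by rewrite big_nil -[RHS](avg_zero x); congr (T _ x); apply/funext => y; rewrite big_nil.
rewrite [RHS]big_cons -IH /= -avgD; congr (T _ x); apply/funext => y.
by rewrite big_cons.
Qed.

(** Expand the nonnegative average of [(f - T f x) ^+ 2] at [x]. *)
Lemma avg_sqr_le f x : T f x ^+ 2 <= T (fun y => f y ^+ 2) x.
Proof.
set m := T f x.
have : 0 <= T (fun y => (f y - m) ^+ 2) x.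
  by apply: (avg_ge0 avT) => y; exact: sqr_ge0.
have -> : (fun y => (f y - m) ^+ 2) =
  (fun y => - (2 * m) * f y + (f y ^+ 2 + m ^+ 2)).
  by apply/funext => y; ring.
rewrite (avg_lin avT) avgD avg_cst -/m => h; rewrite -subr_ge0.
by apply: le_trans h _; rewrite le_eqVlt; apply/orP; left; apply/eqP; ring.
Qed.

End Averaging.

Lemma averaging_comp (X : finType) (S T : (X -> R) -> X -> R) :
  averaging S -> averaging T -> averaging (fun f => S (T f)).
Proof.
move=> aS aT; split=> [a f g x|f f0 x|x].
- rewrite -(avg_lin aS); congr (S _ x).
  by apply/funext => y; rewrite (avg_lin aT).
- by apply: (avg_ge0 aS); exact: (avg_ge0 aT).
- by rewrite -[RHS](avg_one aS x); congr (S _ x); apply/funext/(avg_one aT).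
Qed.

Lemma averaging_iter (X : finType) (T : (X -> R) -> X -> R) t :
  averaging T -> averaging (fun f => iter t T f).
Proof.
move=> aT; elim: t => [|t IH]; first by split.
by have := averaging_comp aT IH.
Qed.

Lemma averaging_mean (X I : finType) (S : {set I})
    (T : I -> (X -> R) -> X -> R) : (0 < #|S|)%N ->
  (forall i, averaging (T i)) ->
  averaging (fun f x => mean S (fun i => T i f x)).
Proof.
move=> S0 aT; split=> [a f g x|f f0 x|x].
- by rewrite -mean_lin; apply: eq_mean => i _; exact: (avg_lin (aT i)).
- rewrite -(mean_cst S0 0); apply: ler_mean => i _; exact: (avg_ge0 (aT i)).
- rewrite -[RHS](mean_cst S0 1); apply: eq_mean => i _; exact: (avg_one (aT i)).
Qed.

End Averages.

(** * Reversible operators *)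

Section Reversible.
Variables (R : realType) (X : finType) (mu : X -> R).
Hypothesis mu_ge0 : forall x, 0 <= mu x.
Hypothesis mu_one : \sum_x mu x = 1.

Definition expect (f : X -> R) : R := \sum_x mu x * f x.
Definition dot (f g : X -> R) : R := expect (fun x => f x * g x).
Definition nsq (f : X -> R) : R := dot f f.

Definition selfadjoint (T : (X -> R) -> X -> R) : Prop :=
  forall f g, dot f (T g) = dot (T f) g.

Lemma averaging_expect : averaging (fun f (_ : X) => expect f).
Proof.
split=> [a f g _|f f0 _|_].
- rewrite /expect mulr_sumr -big_split; apply: eq_bigr => x _ /=; ring.
- by apply: sumr_ge0 => x _; rewrite mulr_ge0.
- by rewrite /expect -mulr_suml mu_one mulr1.
Qed.

Lemma le_expect f g : (forall x, f x <= g x) -> expect f <= expect g.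
Proof. by move=> fg; apply: ler_sum => x _; rewrite ler_wpM2l. Qed.

Lemma expect_lin a f g :
  expect (fun x => a * f x + g x) = a * expect f + expect g.
Proof.
rewrite /expect mulr_sumr -big_split; apply: eq_bigr => x _ /=; ring.
Qed.

Lemma expect_cst c : expect (fun=> c) = c.
Proof. by rewrite /expect -mulr_suml mu_one mul1r. Qed.

Lemma dotC f g : dot f g = dot g f.
Proof. by apply: eq_bigr => x _; rewrite (mulrC (f x)). Qed.

Lemma dotBl f g h : dot (fun x => f x - g x) h = dot f h - dot g h.
Proof.
rewrite /dot /expect -sumrB; apply: eq_bigr => x _ /=; ring.
Qed.

Lemma dotBr f g h : dot h (fun x => f x - g x) = dot h f - dot h g.
Proof. by rewrite dotC dotBl !(dotC _ h). Qed.

Lemma nsq_ge0 f : 0 <= nsq f.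
Proof. by apply: sumr_ge0 => x _; rewrite mulr_ge0 // -expr2 sqr_ge0. Qed.

Lemma nsqB f g : nsq (fun x => f x - g x) = nsq f - 2 * dot f g + nsq g.
Proof. by rewrite /nsq dotBl !dotBr (dotC g f); ring. Qed.

Lemma nsq_le_cst f c : 0 <= c -> (forall x, `|f x| <= c) -> nsq f <= c ^+ 2.
Proof.
move=> c0 h; rewrite -[leRHS](expect_cst (c ^+ 2)); apply: le_expect => x.
by rewrite -expr2 -(real_normK (num_real (f x))) lerXn2r ?nnegrE.
Qed.

Lemma cauchy_schwarz f g : dot f g ^+ 2 <= nsq f * nsq g.
Proof.
have h a b : 0 <= a ^+ 2 * nsq f - 2 * a * b * dot f g + b ^+ 2 * nsq g.
  have -> : a ^+ 2 * nsq f - 2 * a * b * dot f g + b ^+ 2 * nsq g =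
    nsq (fun x => a * f x - b * g x).
    rewrite /nsq /dot /expect !mulr_sumr -sumrB -big_split; apply: eq_bigr => x _ /=.
    ring.
  exact: nsq_ge0.
have f0 := nsq_ge0 f; have g0 := nsq_ge0 g.
have [g00|g_neq0] := eqVneq (nsq g) 0.
  rewrite g00 mulr0.
  have [->|fg] := eqVneq (dot f g) 0; first by rewrite expr0n.
  have := h 1 ((nsq f + 1) / (2 * dot f g)); rewrite g00.
  have -> : 1 ^+ 2 * nsq f - 2 * 1 * ((nsq f + 1) / (2 * dot f g)) * dot f g
    + ((nsq f + 1) / (2 * dot f g)) ^+ 2 * 0 = -1 by field.
  by move=> ?; lra.
have gp : 0 < nsq g by rewrite lt_def g_neq0.
have := h (nsq g) (dot f g).
have -> : nsq g ^+ 2 * nsq f - 2 * nsq g * dot f g * dot f g +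
  dot f g ^+ 2 * nsq g = nsq g * (nsq f * nsq g - dot f g ^+ 2) by ring.
by rewrite pmulr_rge0 // subr_ge0.
Qed.

Section SelfAdjoint.
Variable T : (X -> R) -> X -> R.
Hypothesis avT : averaging T.
Hypothesis saT : selfadjoint T.

Lemma expect_stationary f : expect (T f) = expect f.
Proof.
have := saT (fun=> 1) f.
rewrite /dot /expect.
under eq_bigr do rewrite mul1r.
move=> ->; apply: eq_bigr => x _; by rewrite (avg_one avT) mul1r.
Qed.

Let a f (s : nat) := nsq (iter s T f).

Lemma nsq_iterS f s : a f s.+1 = dot (iter s T f) (iter s.+2 T f).
Proof. by rewrite /a /nsq /= -saT. Qed.

(** With [a s] the square norm of [T^s f], self-adjointness makes [a] convex, so
    the decrements of [a] decrease while their sum is at most [a 0]. *)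
Lemma dirichlet_decay f t :
  a f t - a f t.+1 <= nsq f / t.+1%:R.
Proof.
have cvx s : a f s.+1 - a f s.+2 <= a f s - a f s.+1.
  have := nsq_ge0 (fun x => iter s T f x - iter s.+2 T f x).
  by rewrite nsqB -nsq_iterS -/(a f s) -/(a f s.+2) => ?; lra.
have mono s u : (s <= u)%N -> a f u - a f u.+1 <= a f s - a f s.+1.
  move=> /subnK <-; elim: (u - s)%N => [|d IH] //=.
  by apply: le_trans IH; rewrite addSn.
rewrite ler_pdivlMr ?ltr0n // mulrC.
suff h m : (m <= t.+1)%N -> m%:R * (a f t - a f t.+1) <= a f 0 - a f m.
  by apply: le_trans (h _ (leqnn _)) _; rewrite gerBl; exact: nsq_ge0.
elim: m => [|m IH] mt; first by rewrite mul0r subrr.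
have := mono m t mt; have := IH (ltnW mt).
by rewrite -natr1 mulrDl mul1r => ? ?; lra.
Qed.

(** By Cauchy-Schwarz the ratios of successive square norms increase, so a mean
    zero function with small Dirichlet form decays slowly; on the other hand
    every [t] steps divide its oscillation by two. *)
Lemma relaxation_lower_bound f eps t :
  expect f = 0 -> 0 < nsq f -> (1 - eps) * nsq f <= dot f (T f) ->
  (forall g (w : R), (forall x y, `|g x - g y| <= w) ->
     forall x y, `|iter t T g x - iter t T g y| <= w / 2) ->
  1 <= 4 * (t%:R * eps).
Proof.
move=> f0 nf hf hosc.
pose c : R := \sum_x `|f x|.
have fc x : `|f x| <= c by rewrite /c (bigD1 x) //= lerDl sumr_ge0.
have osc m x y :
    `|iter (m * t) T f x - iter (m * t) T f y| <= 2 * c / 2 ^+ m.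
  elim: m x y => [|m IH] x y.
    rewrite expr0 divr1 /=; apply: le_trans (ler_normB _ _) _.
    by have := fc x; have := fc y => ? ?; lra.
  rewrite mulSn iterD exprSr; apply: le_trans (hosc _ _ IH x y) _.
  by rewrite invfM mulrA.
have am m : a f (m * t) <= (2 * c) ^+ 2 / 4 ^+ m.
  have -> : (4 : R) = 2 ^+ 2 by ring.
  rewrite -exprAC -exprVn -exprMn.
  apply: nsq_le_cst => [|x]; first by rewrite divr_ge0 ?exprn_ge0 ?mulr_ge0 ?sumr_ge0.
  have -> : iter (m * t) T f x =
      expect (fun y => iter (m * t) T f x - iter (m * t) T f y).
    rewrite (avgB averaging_expect (fun=> iter (m * t) T f x) _ x).
    rewrite expect_cst.
    suff -> : expect (iter (m * t) T f) = 0 by rewrite subr0.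
    by elim: (m * t)%N => //= s IH; rewrite expect_stationary.
  exact: (avg_norm_le averaging_expect) (osc m x) x.
have low (r : R) : 0 <= r -> r * a f 0 <= a f 1 -> forall j, r ^+ j * a f 0 <= a f j.
  move=> r0; rewrite le_eqVlt in r0; case/orP: r0 => [/eqP <- _|r0 ra].
    case=> [|j]; first by rewrite mul1r.
    by rewrite exprS !mul0r nsq_ge0.
  suff h j : 0 < a f j /\ r * a f j <= a f j.+1.
    elim=> [|j IH]; first by rewrite mul1r.
    rewrite exprS -mulrA; apply: le_trans (h j).2.
    by rewrite ler_wpM2l // ltW.
  elim: j => [|j [aj0 raj]]; first by split.
  have aj1 : 0 < a f j.+1 by apply: lt_le_trans raj; rewrite mulr_gt0.
  split=> //; rewrite -(ler_pM2l aj0).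
  apply: (@le_trans _ _ (a f j.+1 ^+ 2)).
    rewrite expr2 [_ * (r * _)]mulrCA mulrA; apply: ler_wpM2r raj; exact: ltW.
  rewrite nsq_iterS; exact: cauchy_schwarz.
have key (r : R) : 0 <= r -> r * a f 0 <= a f 1 -> 4 * r ^+ t <= 1.
  move=> r0 /(low _ r0) {}low.
  apply: (@bounded_exp_le1 _ _ ((2 * c) ^+ 2 / a f 0)) => m.
  have := low (m * t)%N => /le_trans /(_ (am m)).
  rewrite ler_pdivlMr ?exprn_gt0 // ler_pdivlMr // mulnC exprM.
  suff -> : (4 * r ^+ t) ^+ m * a f 0 = (r ^+ t) ^+ m * a f 0 * 4 ^+ m by [].
  by rewrite exprMn; ring.
have [eps1|eps1] := leP 1 eps.
  have := key 0 (lexx _); rewrite mul0r nsq_ge0 => /(_ isT).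
  case: (t) => [|t' _]; first by rewrite expr0 => ?; lra.
  have : 1 <= t'.+1%:R * eps.
    have t1 : 1 <= t'.+1%:R :> R by rewrite ler1n.
    by nra.
  by move=> ?; lra.
have : 4 * ((1 - eps) ^+ 2) ^+ t <= 1.
  apply: key; first exact: sqr_ge0.
  rewrite -(ler_pM2l nf).
  apply: le_trans (cauchy_schwarz f (T f)).
  rewrite [X in X <= _](_ : _ = ((1 - eps) * nsq f) ^+ 2); last first.
    by rewrite /a /=; ring.
  have h0 : 0 <= (1 - eps) * nsq f by rewrite mulr_ge0 ?nsq_ge0 //; lra.
  by rewrite lerXn2r ?nnegrE // (le_trans h0).
rewrite -exprM => h.
have : 1 - (2 * t)%:R * eps <= (1 - eps) ^+ (2 * t) by apply: bernoulli_le; lra.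
by rewrite natrM => ?; lra.
Qed.

End SelfAdjoint.
End Reversible.
(** * Mixing distance of a kernel *)

Section Kernels.
Variables (R : realType) (X : finType).

Definition kact (K : X -> X -> R) (f : X -> R) (x : X) : R :=
  \sum_y K x y * f y.

Lemma kact_kid f : kact (@kid R X) f = f.
Proof.
apply/funext => x; rewrite /kact (bigD1 x) //= /kid eqxx mul1r big1 ?addr0 //.
by move=> y /negbTE yx; rewrite eq_sym yx mul0r.
Qed.

Lemma kact_kcomp K L f : kact (kcomp K L) f = kact K (kact L f).
Proof.
apply/funext => x; rewrite /kact /kcomp.
under eq_bigr do rewrite mulr_suml.
rewrite exchange_big; apply: eq_bigr => z _ /=.
by rewrite mulr_sumr; apply: eq_bigr => y _; rewrite mulrA.
Qed.

Lemma kact_kpow K t f : kact (kpow K t) f = iter t (kact K) f.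
Proof.
elim: t => [|t IH]; first exact: kact_kid.
by rewrite iterS -IH -kact_kcomp.
Qed.

Definition indic (A : {set X}) (x : X) : R := (x \in A)%:R.

Lemma kact_indic K (A : {set X}) x : \sum_(y in A) K x y = kact K (indic A) x.
Proof.
rewrite big_mkcond; apply: eq_bigr => y _ /=.
by rewrite /indic; case: (y \in A); rewrite ?mulr1 ?mulr0.
Qed.

Section Mixing.
Variables (mu : X -> R) (K : X -> X -> R).
Hypothesis mu_ge0 : forall x, 0 <= mu x.
Hypothesis mu_one : \sum_x mu x = 1.
Hypothesis avK : averaging (kact K).
Hypothesis saK : selfadjoint mu (kact K).

Let avKt t : averaging (fun f => iter t (kact K) f).
Proof. exact: averaging_iter. Qed.

(** Stationarity writes the distance to equilibrium as an average of differences
    between two starting points. *)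
Lemma kpow_indic_dev t (A : {set X}) x :
  \sum_(y in A) kpow K t x y - \sum_(y in A) mu y =
  expect mu (fun y => iter t (kact K) (indic A) x - iter t (kact K) (indic A) y).
Proof.
rewrite (avgB (averaging_expect mu_ge0 mu_one) (fun=> _) _ x) expect_cst //.
rewrite kact_indic kact_kpow; congr (_ - _).
have -> : expect mu (iter t (kact K) (indic A)) = expect mu (indic A).
  by elim: t => //= t IH; rewrite expect_stationary.
rewrite big_mkcond; apply: eq_bigr => y _ /=.
by rewrite /indic; case: (y \in A); rewrite ?mulr1 ?mulr0.
Qed.

Lemma mixing_dist_le t e : 0 <= e ->
  (forall A x y,
     `|iter t (kact K) (indic A) x - iter t (kact K) (indic A) y| <= e) ->
  mixing_dist K mu t <= e.
Proof.
move=> e0 h; apply: bigmax_le => // x _; apply: bigmax_le => // A _.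
rewrite kpow_indic_dev.
exact: (avg_norm_le (averaging_expect mu_ge0 mu_one)) (h A x) x.
Qed.

Lemma mixing_dist_ge t (A : {set X}) x :
  `|\sum_(y in A) kpow K t x y - \sum_(y in A) mu y| <= mixing_dist K mu t.
Proof.
apply: le_trans (le_bigmax (0 : R) (fun x => total_variation (kpow K t x) mu) x).
exact: (le_bigmax (0 : R) (fun A : {set X} =>
  `|\sum_(y in A) kpow K t x y - \sum_(y in A) mu y|) A).
Qed.

(** Pair [g - g z0], of absolute value at most [w], with the difference of the
    laws from [x] and [y], whose positive and negative parts have mass at most
    twice the distance to equilibrium. *)
Lemma mixing_dist_osc t e : mixing_dist K mu t <= e ->
  forall g (w : R), (forall x y, `|g x - g y| <= w) ->
  forall x y, `|iter t (kact K) g x - iter t (kact K) g y| <= 2 * e * w.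
Proof.
move=> de g w gw x y.
pose z0 := [arg min_(z < x) g z]%O.
have z0P z : 0 <= g z - g z0 <= w.
  apply/andP; split; last exact: le_trans (ler_norm _) (gw _ _).
  by rewrite subr_ge0 /z0; case: arg_minP => // i _; exact.
pose d z := kpow K t x z - kpow K t y z.
have dA (A : {set X}) : `|\sum_(z in A) d z| <= 2 * e.
  rewrite /d sumrB.
  have := mixing_dist_ge t A x; have := mixing_dist_ge t A y.
  rewrite !ler_norml => /andP[? ?] /andP[? ?]; apply/andP; split; lra.
have d0 : \sum_z d z = 0.
  have one u : \sum_z kpow K t u z = 1.
    rewrite -[RHS](avg_one (avKt t) u) -kact_kpow.
    by apply: eq_bigr => z _; rewrite mulr1.
  by rewrite /d sumrB !one subrr.
have eqd : iter t (kact K) g x - iter t (kact K) g y =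
    \sum_z d z * (g z - g z0).
  under [RHS]eq_bigr do rewrite mulrBr.
  rewrite sumrB -mulr_suml d0 mul0r subr0 -!kact_kpow /kact -sumrB.
  by apply: eq_bigr => z _; rewrite -mulrBl.
have e0 : 0 <= 2 * e by apply: le_trans (dA finset.set0); exact: normr_ge0.
have up (s : R) : s = 1 \/ s = -1 ->
    \sum_z (s * d z) * (g z - g z0) <= 2 * e * w.
  move=> sE; apply: (@le_trans _ _ (\sum_(z in [set z | 0 <= s * d z]) (s * d z) * w)).
    rewrite [leRHS]big_mkcond; apply: ler_sum => z _; rewrite inE.
    have /andP[g0 g1] := z0P z.
    case: ifPn => [h|]; first by rewrite ler_wpM2l.
    by rewrite -ltNge => h; rewrite mulr_le0_ge0 // ltW.
  have w0 : 0 <= w by apply: le_trans (gw x x).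
  rewrite -mulr_suml -mulr_sumr ler_wpM2r //.
  have := dA [set z | 0 <= s * d z]; rewrite ler_norml => /andP[].
  by move: (\sum_(z in _) d z) => Z; case: sE => -> ? ?; lra.
rewrite eqd ler_norml; apply/andP; split.
  have := up (-1) (or_intror erefl).
  rewrite [X in X <= _ -> _](_ : _ = - \sum_z d z * (g z - g z0)); first by move=> ?; lra.
  by rewrite -sumrN; apply: eq_bigr => z _; ring.
have := up 1 (or_introl erefl).
by under eq_bigr do rewrite mul1r.
Qed.

End Mixing.
End Kernels.

(** * The mean-field Ising model *)

Section Model.
Variables (R : realType) (n : nat).
Hypothesis n_gt0 : (0 < n)%N.
Local Notation conf := (config n).
Implicit Types (a b v w : 'I_n) (x y : conf) (f g : conf -> R)
  (L M : R).

Let n0 : n%:R != 0 :> R. Proof. by rewrite pnatr_eq0 -lt0n. Qed.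
Let np : 0 < n%:R :> R. Proof. by rewrite ltr0n. Qed.

Definition nplus x : nat := #|[set v | x v]|.
Definition total_spin x : R := \sum_v spin R x v.
Definition field v x : R := total_spin x - spin R x v.
Definition up v x : R := p_plus 1 (magnetization R x - spin R x v / n%:R).
(** The conditional expectation of [f] under [pi] given the spins off [v]. *)
Definition heat v f x : R :=
  up v x * f (set_spin x v true) + (1 - up v x) * f (set_spin x v false).
Definition scan (s : seq 'I_n) f : conf -> R := foldr heat f s.

Lemma kact_site_update v f : kact (site_update 1 v) f = heat v f.
Proof.
apply/funext => x; rewrite /kact /site_update /heat -/(up v x).
have pick z (c : R) : \sum_y c * (y == z)%:R * f y = c * f z.
  rewrite (bigD1 z) //= eqxx mulr1 big1 ?addr0 // => y /negbTE ->.
  by rewrite mulr0 mul0r.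
under eq_bigr do rewrite mulrDl.
by rewrite big_split /= !pick.
Qed.

Lemma kact_scan_update s f : kact (scan_update 1 s) f = scan s f.
Proof.
elim: s f => [|v s IH] f /=; first exact: kact_kid.
by rewrite kact_kcomp kact_site_update IH.
Qed.

(** * Spins and the heat-bath probabilities *)

Lemma set_spinE x v (b : bool) w : set_spin x v b w = if w == v then b else x w.
Proof. by rewrite ffunE. Qed.

Lemma set_spin_set x v (b c : bool) : set_spin (set_spin x v b) v c = set_spin x v c.
Proof. by apply/ffunP => w; rewrite !set_spinE; case: eqP. Qed.

Lemma set_spinC x v w (b c : bool) : v != w ->
  set_spin (set_spin x v b) w c = set_spin (set_spin x w c) v b.
Proof.
move=> vw; apply/ffunP => u; rewrite !set_spinE.
by have [->|//] := eqVneq u w; rewrite eq_sym (negbTE vw).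
Qed.

Lemma set_spin_id x v : set_spin x v (x v) = x.
Proof. by apply/ffunP => w; rewrite set_spinE; case: eqP => [->|]. Qed.

Lemma spin_sqr x v : spin R x v * spin R x v = 1.
Proof. by rewrite /spin; case: (x v); ring. Qed.

Lemma spin_norm x v : `|spin R x v| = 1.
Proof. by rewrite /spin; case: (x v); rewrite ?normrN normr1. Qed.

Lemma field_set v (b : bool) x : field v (set_spin x v b) = field v x.
Proof.
rewrite /field /total_spin !(bigD1 (P := xpredT) v) //=
  !(addrAC _ (\sum_(_ | _) _)) !subrr !add0r.
by apply: eq_bigr => w /negbTE wv; rewrite /spin set_spinE wv.
Qed.

Lemma total_spin_set v (b : bool) x :
  total_spin (set_spin x v b) = field v x + (if b then 1 else -1).
Proof.
by rewrite -(field_set v b) /field /spin set_spinE eqxx; ring.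
Qed.

Lemma total_spinE x : total_spin x = 2 * (nplus x)%:R - n%:R.
Proof.
rewrite /total_spin /nplus -sum1_card natr_sum.
under [in RHS]eq_bigl do rewrite inE.
have -> : n%:R = \sum_(v < n) 1 :> R by rewrite sumr_const card_ord.
rewrite [in RHS]big_mkcond /= mulr_sumr -sumrB.
by apply: eq_bigr => v _; rewrite /spin; case: (x v); ring.
Qed.

Lemma nplus_le x : (nplus x <= n)%N.
Proof. by rewrite -[leqRHS]card_ord max_card. Qed.

Lemma total_spin_norm x : `|total_spin x| <= n%:R.
Proof.
have : (nplus x)%:R <= n%:R :> R by rewrite ler_nat nplus_le.
have : 0 <= (nplus x)%:R :> R by [].
by rewrite total_spinE ler_norml => ? ?; apply/andP; split; lra.
Qed.

Lemma field_norm v x : `|field v x| <= n%:R.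
Proof.
have := total_spin_norm (set_spin x v true).
have := total_spin_norm (set_spin x v false).
rewrite !total_spin_set !ler_norml => /andP[? ?] /andP[? ?].
by apply/andP; split; lra.
Qed.

Lemma p_plusE (z : R) : p_plus 1 z = (1 + expR (- (2 * z)))^-1.
Proof.
rewrite /p_plus /tanh mul1r (_ : - (2 * z) = - z + - z); last by ring.
rewrite expRD expRN; have := expR_gt0 z; move: (expR z) => e e0.
have h1 : e * e + 1 != 0 by rewrite gt_eqF // ltr_wpDl // mulr_ge0 // ltW.
by field; rewrite (gt_eqF e0) h1.
Qed.

Lemma upE v x : up v x = p_plus 1 (field v x / n%:R).
Proof. by congr (p_plus _ _); rewrite /magnetization /field /total_spin; field. Qed.

Lemma up_set v (b : bool) x : up v (set_spin x v b) = up v x.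
Proof. by rewrite !upE field_set. Qed.

(** As the local field lies in [[-1, 1]], each outcome of an update has at least
    this probability. *)
Definition pmin : R := (1 + expR 2)^-1.

Lemma pmin_gt0 : 0 < pmin.
Proof. by rewrite invr_gt0 ltr_wpDl ?expR_gt0. Qed.

Lemma pmin_le1 : pmin <= 1.
Proof. by rewrite invf_le1 ?ltr_wpDl ?expR_gt0 // lerDl ltW ?expR_gt0. Qed.

Lemma up_range v x : pmin <= up v x <= 1 - pmin.
Proof.
rewrite upE p_plusE; set z := field v x / n%:R.
have : `|z| <= 1.
  rewrite /z normrM [`|_^-1|]ger0_norm ?invr_ge0 // ler_pdivrMr // mul1r.
  exact: field_norm.
rewrite ler_norml => /andP[z1 z2].
have e2 : 0 < expR 2 :> R by exact: expR_gt0.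
have ez : 0 < expR (- (2 * z)) by exact: expR_gt0.
have h1 : expR (- (2 * z)) <= expR 2 by rewrite ler_expR; lra.
have h2 : 1 <= expR 2 * expR (- (2 * z)).
  by rewrite -expRD -[leLHS]expR0 ler_expR; lra.
rewrite /pmin; apply/andP; split.
  by rewrite lef_pV2 ?posrE; lra.
have -> : 1 - (1 + expR 2)^-1 = (1 + (expR 2)^-1)^-1 :> R.
  by field; rewrite !gt_eqF //; lra.
have i2 : 0 < (expR 2)^-1 :> R by rewrite invr_gt0.
rewrite lef_pV2 ?posrE; try lra.
by rewrite lerD2l -[leLHS]mul1r ler_pdivrMr // mulrC.
Qed.

Lemma averaging_heat v : averaging (heat v).
Proof.
have p0 := pmin_gt0.
split=> [a f g x|f f0 x|x]; rewrite /heat; try ring.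
have /andP[? ?] := up_range v x.
by apply: addr_ge0; apply: mulr_ge0 => //; lra.
Qed.

Lemma averaging_scan s : averaging (scan s).
Proof.
elim: s => [|v s IH]; first by split.
exact: averaging_comp (averaging_heat v) IH.
Qed.

(** * The Gibbs measure and reversibility *)

Lemma sum_pairs x :
  \sum_(v < n) \sum_(w < n | (v < w)%N) spin R x v * spin R x w =
  (total_spin x ^+ 2 - n%:R) / 2.
Proof.
set S := LHS.
have lo : \sum_(v < n) \sum_(w < n | (w < v)%N) spin R x v * spin R x w = S.
  rewrite (exchange_big_dep xpredT) //=; apply: eq_bigr => v _.
  by apply: eq_bigr => w _; rewrite mulrC.
have -> : total_spin x ^+ 2 = S + (n%:R + S); last by field.
rewrite -{2}lo /S expr2 {1}/total_spin mulr_suml.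
have -> : n%:R = \sum_(v < n) 1 :> R by rewrite sumr_const card_ord.
rewrite -!big_split.
apply: eq_bigr => v _ /=; rewrite mulr_sumr (bigID (fun w : 'I_n => (v < w)%N)) /=.
congr (_ + _); rewrite (bigD1 v) ?ltnn //= spin_sqr; congr (_ + _).
by apply: eq_bigl => w; rewrite -leqNgt ltn_neqAle andbC.
Qed.

Lemma gibbs_weightE x :
  gibbs_weight 1 x = expR ((total_spin x ^+ 2 - n%:R) / (2 * n%:R)) :> R.
Proof. by rewrite /gibbs_weight sum_pairs; congr expR; field. Qed.

Definition zsum : R := \sum_(x : conf) gibbs_weight 1 x.
Definition pi x : R := gibbs 1 x.

Lemma zsum_gt0 : 0 < zsum.
Proof.
rewrite /zsum (bigD1 [ffun=> true]) //= ltr_wpDr ?expR_gt0 // sumr_ge0 // => y _.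
by rewrite ltW ?expR_gt0.
Qed.

Lemma pi_gt0 x : 0 < pi x.
Proof. by rewrite divr_gt0 ?expR_gt0 ?zsum_gt0. Qed.

Lemma pi_ge0 x : 0 <= pi x. Proof. exact/ltW/pi_gt0. Qed.

Lemma pi_one : \sum_x pi x = 1.
Proof. by rewrite -mulr_suml mulfV // gt_eqF ?zsum_gt0. Qed.

Lemma piE x : pi x = expR ((total_spin x ^+ 2 - n%:R) / (2 * n%:R)) / zsum.
Proof. by rewrite /pi /gibbs gibbs_weightE. Qed.

(** The field at [v] does not depend on the spin at [v], and flipping that spin
    multiplies the weight by [expR (2 * field v x / n)]. *)
Lemma pi_balance v x :
  pi (set_spin x v true) * (1 - up v x) = pi (set_spin x v false) * up v x.
Proof.
rewrite upE p_plusE !piE !total_spin_set; set h := field v x.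
have -> : expR (((h - 1) ^+ 2 - n%:R) / (2 * n%:R)) =
    expR (((h + 1) ^+ 2 - n%:R) / (2 * n%:R)) * expR (- (2 * (h / n%:R))).
  by rewrite -expRD; congr expR; field.
have := expR_gt0 (- (2 * (h / n%:R))).
move: (expR (- _)) (expR (_ / _)) => e e' e0.
by field; rewrite !gt_eqF ?zsum_gt0 //; lra.
Qed.

Lemma sum_flip v (F : conf -> R) :
  \sum_x F x = 2^-1 * \sum_x (F (set_spin x v true) + F (set_spin x v false)).
Proof.
pose fl x : conf := set_spin x v (~~ x v).
have flK : involutive fl.
  by move=> x; rewrite /fl set_spin_set set_spinE eqxx negbK set_spin_id.
have -> : \sum_x (F (set_spin x v true) + F (set_spin x v false)) =
  \sum_x (F x + F (fl x)).
  apply: eq_bigr => x _; rewrite /fl -{3}(set_spin_id x v).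
  by case: (x v); rewrite //= addrC.
rewrite big_split /=.
have <- : \sum_x F x = \sum_x F (fl x) by exact: (reindex_inj (inv_inj flK)).
by field.
Qed.

Lemma heat_set v (b : bool) f x : heat v f (set_spin x v b) = heat v f x.
Proof. by rewrite /heat up_set !set_spin_set. Qed.

Lemma heat_idem v f : heat v (heat v f) = heat v f.
Proof. by apply/funext => x; rewrite {1}/heat !heat_set; ring. Qed.

(** Group the configurations in pairs that differ at [v]: on a pair [heat v f] is
    constant, equal to the [pi]-weighted mean of the two values of [f]. *)
Lemma heat_selfadjoint v : selfadjoint pi (heat v).
Proof.
have dotE f g : dot pi f (heat v g) = 2^-1 * \sum_x
   (pi (set_spin x v true) + pi (set_spin x v false)) * (heat v f x * heat v g x).
  rewrite /dot /expect (sum_flip v); congr (_ * _); apply: eq_bigr => x _.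
  rewrite !heat_set {3}/heat.
  have := pi_balance v x; set A := pi _; set B := pi _; set p := up v x => bal.
  have [W [-> -> ->]] : exists W, [/\ A + B = W, A = W * p & B = W * (1 - p)].
    exists (A + B); split=> //; first by rewrite mulrDl -bal; ring.
    by rewrite mulrDl bal; ring.
  ring.
by move=> f g; rewrite dotE dotC dotE; congr (_ * _); apply: eq_bigr => x _; ring.
Qed.

(** * Scans over uniformly chosen distinct sites *)

Definition utuples (j : nat) : {set j.-tuple 'I_n} :=
  [set s : j.-tuple 'I_n | uniq s].
Definition utuples_avoid v (j : nat) : {set j.-tuple 'I_n} :=
  [set s : j.-tuple 'I_n | uniq (v :: s)].

Definition rscan (j : nat) f x : R := mean (utuples j) (fun s => scan s f x).
Definition rscan_avoid v (j : nat) f x : R :=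
  mean (utuples_avoid v j) (fun s => scan s f x).
Definition glauber f x : R := mean [set: 'I_n] (fun v => heat v f x).

Lemma card_utuples j : #|utuples j| = (n ^_ j)%N.
Proof.
rewrite -[in RHS](card_ord n) -card_uniq_tuples; apply: eq_card => s.
by rewrite !inE (eq_all (a2 := predT)) ?all_predT.
Qed.

Lemma card_utuples_avoid v j : #|utuples_avoid v j| = (n.-1 ^_ j)%N.
Proof.
have -> : n.-1 = #|predC1 v| by rewrite cardC1 card_ord.
rewrite -card_uniq_tuples; apply: eq_card => s.
rewrite !inE /=; congr (_ && _); rewrite -has_pred1 -all_predC.
exact: eq_all.
Qed.

Lemma card_sites_avoid (s : seq 'I_n) :
  uniq s -> #|[set v | v \notin s]| = (n - size s)%N.
Proof.
move=> us; rewrite -(card_uniqP us); apply/eqP.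
rewrite -(eqn_add2l #|s|) subnKC; last by rewrite -[leqRHS]card_ord max_card.
rewrite -[X in _ == X]card_ord -(cardC (mem s)) eqn_add2l; apply/eqP.
by apply: eq_card => v; rewrite !inE.
Qed.

Lemma utuples_gt0 j : (j <= n)%N -> (0 < #|utuples j|)%N.
Proof. by move=> jn; rewrite card_utuples ffact_gt0. Qed.

Lemma utuples_avoid_gt0 v j : (j < n)%N -> (0 < #|utuples_avoid v j|)%N.
Proof. by move=> jn; rewrite card_utuples_avoid ffact_gt0; lia. Qed.

Lemma sites_gt0 : (0 < #|[set: 'I_n]|)%N.
Proof. by rewrite cardsT card_ord. Qed.

Lemma sum_utuplesS j (F : seq 'I_n -> R) :
  \sum_(s in utuples j.+1) F s =
  \sum_v \sum_(s in utuples_avoid v j) F (v :: s).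
Proof.
rewrite pair_big_dep /=.
rewrite (reindex (fun p : 'I_n * j.-tuple 'I_n => cons_tuple p.1 p.2)) /=.
  by apply: eq_bigl => -[v s]; rewrite !inE.
exists (fun t : j.+1.-tuple 'I_n => (thead t, [tuple of behead t])) => t _ /=.
  by rewrite [t]surjective_pairing /= theadE; congr pair; exact: val_inj.
by case/tupleP: t => v s; apply: val_inj.
Qed.

Lemma mean_utuplesS j (F : seq 'I_n -> R) : (j < n)%N ->
  mean (utuples j.+1) F =
  mean [set: 'I_n] (fun v => mean (utuples_avoid v j) (fun s => F (v :: s))).
Proof.
move=> jn; rewrite /mean sum_utuplesS card_utuples ffactnS cardsT card_ord.
rewrite natrM invfM -mulrA; congr (_ * _).
rewrite mulr_sumr; apply: eq_big => [v|v _]; first by rewrite inE.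
by rewrite card_utuples_avoid.
Qed.

Lemma mean_utuplesS_tail j (F : seq 'I_n -> R) : (j < n)%N ->
  mean (utuples j.+1) F =
  mean (utuples j) (fun s => mean [set v | v \notin s] (fun v => F (v :: s))).
Proof.
move=> jn; rewrite /mean sum_utuplesS !card_utuples ffactnSr natrM invfM -mulrA.
congr (_ * _).
rewrite (exchange_big_dep (mem (utuples j))) /=; last first.
  by move=> v s _; rewrite !inE /= => /andP[].
rewrite mulr_sumr; apply: eq_bigr => s; rewrite inE => us.
rewrite card_sites_avoid // size_tuple; congr (_ * _).
by apply: eq_bigl => v; rewrite !inE /= us andbT.
Qed.

Lemma averaging_rscan j : (j <= n)%N -> averaging (rscan j).
Proof. move=> jn; apply: (averaging_mean (T := fun s : j.-tuple 'I_n => scan s)).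
  exact: utuples_gt0.
by move=> s; exact: averaging_scan. Qed.

Lemma averaging_glauber : averaging glauber.
Proof. exact: averaging_mean sites_gt0 averaging_heat. Qed.

Lemma kact_rscan k f : kact (randomized_systematic_scan 1 k) f = rscan k f.
Proof.
apply/funext => x; rewrite /kact /randomized_systematic_scan /rscan /mean.
under eq_bigr do rewrite -mulrA mulr_suml.
rewrite -mulr_sumr exchange_big /=; congr (_ * _).
apply: eq_big => [s|s _]; first by rewrite inE.
by rewrite -kact_scan_update.
Qed.

Lemma scan_adjoint s f g : dot pi f (scan s g) = dot pi (scan (rev s) f) g.
Proof.
elim: s f => [|v s IH] f //=.
rewrite heat_selfadjoint IH rev_cons -cats1 /scan foldr_cat.
done.
Qed.

Lemma dot_mean (I : finType) (S : {set I}) (F : I -> conf -> R) g :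
  dot pi (fun x => mean S (fun i => F i x)) g = mean S (fun i => dot pi (F i) g).
Proof.
rewrite /mean exchange_big /= mulr_sumr; apply: eq_bigr => x _.
by rewrite -mulr_sumr -mulr_suml; ring.
Qed.

(** Reversing the order of a uniform scan does not change its law, and the
    adjoint of a scan is the scan in the reverse order. *)
Lemma rscan_selfadjoint j : selfadjoint pi (rscan j).
Proof.
move=> f g; rewrite dotC !dot_mean /mean; congr (_ * _).
have revI : injective (fun s : j.-tuple 'I_n => [tuple of rev s]).
  by apply: inv_inj => s; apply: val_inj; rewrite /= revK.
rewrite (reindex_inj revI) /=.
apply: eq_big => [s|s _]; first by rewrite !inE rev_uniq.
by rewrite dotC scan_adjoint revK dotC.
Qed.

(** * Dirichlet form of the total spin *)

Definition flip_lip (L : R) g : Prop :=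
  forall v x, `|g (set_spin x v true) - g (set_spin x v false)| <= L.

Lemma p_plus_lip (a c : R) : `|p_plus 1 a - p_plus 1 c| <= 2 * `|a - c|.
Proof.
wlog ca : a c / c <= a.
  have [ca|/ltW ac] := leP c a; first exact.
  by rewrite distrC [`|a - c|]distrC; exact.
rewrite [`|a - c|]ger0_norm ?subr_ge0 // !p_plusE.
have e0 (z : R) : 0 < expR z by exact: expR_gt0.
set A := expR (- (2 * a)); set C := expR (- (2 * c)).
have AC : A = C * expR (- (2 * (a - c))) by rewrite -expRD; congr expR; ring.
have ac1 : A <= C by rewrite ler_expR; lra.
have A0 : 0 < A by exact: e0.
have C0 : 0 < C by exact: e0.
have -> : (1 + A)^-1 - (1 + C)^-1 = (C - A) / ((1 + A) * (1 + C)).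
  by field; rewrite !gt_eqF //; lra.
rewrite ger0_norm; last by rewrite divr_ge0 ?mulr_ge0 //; lra.
have D0 : 0 < (1 + A) * (1 + C) by rewrite mulr_gt0 //; lra.
rewrite ler_pdivrMr //.
have h := expR_ge1Dx (- (2 * (a - c))).
have : C - A <= C * (2 * (a - c)).
  by rewrite AC -{1}(mulr1 C) -mulrBr ler_pM2l //; lra.
move=> /le_trans; apply; rewrite [leRHS]mulrC.
by apply: ler_wpM2r; nra.
Qed.

Lemma heat_split v w f x : v != w ->
  heat w f (set_spin x v true) - heat w f (set_spin x v false) =
  up w (set_spin x v true) *
    (f (set_spin (set_spin x w true) v true) -
     f (set_spin (set_spin x w true) v false)) +
  (1 - up w (set_spin x v true)) *
    (f (set_spin (set_spin x w false) v true) -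
     f (set_spin (set_spin x w false) v false)) +
  (up w (set_spin x v true) - up w (set_spin x v false)) *
    (f (set_spin (set_spin x v false) w true) -
     f (set_spin (set_spin x v false) w false)).
Proof. by move=> vw; rewrite /heat !(set_spinC _ _ _ vw); ring. Qed.

Lemma up_flip v w x : v != w ->
  `|up w (set_spin x v true) - up w (set_spin x v false)| <= 4 / n%:R.
Proof.
move=> vw; rewrite !upE; apply: le_trans (p_plus_lip _ _) _.
rewrite -mulrBl.
have -> : field w (set_spin x v true) - field w (set_spin x v false) = 2.
  rewrite /field !total_spin_set /spin !set_spinE eq_sym (negbTE vw).
  ring.
by rewrite ger0_norm ?divr_ge0 //; lra.
Qed.

(** Besides the difference already present in [g], a flip at [v] changes by at
    most [4 / n] the probability that the update at [w] gives [+1], and the two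
    outcomes of that update differ by at most [L] under [g]. *)
Lemma flip_lip_heat L w g : 0 <= L ->
  flip_lip L g -> flip_lip (L * (1 + 4 / n%:R)) (heat w g).
Proof.
move=> L0 gL v x; have n4 : 0 <= 4 / n%:R :> R by rewrite divr_ge0.
have [->|vw] := eqVneq v w.
  by rewrite !heat_set subrr normr0 mulr_ge0 // addr_ge0.
rewrite heat_split //.
have p0 := pmin_gt0; have /andP[u1 u2] := up_range w (set_spin x v true).
set u := up w _; set u' := up w _.
apply: le_trans (ler_normD _ _) _; rewrite [L * _]mulrDr mulr1; apply: lerD.
  apply: le_trans (ler_normD _ _) _; rewrite (normrM u) (normrM (1 - u)).
  have h1 := gL v (set_spin x w true); have h2 := gL v (set_spin x w false).
  rewrite (ger0_norm (x := u)); last by rewrite /u; lra.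
  rewrite (ger0_norm (x := 1 - u)); last by rewrite /u; lra.
  have -> : L = u * L + (1 - u) * L by ring.
  by apply: lerD; apply: ler_wpM2l => //; rewrite /u; lra.
rewrite normrM mulrC; apply: ler_pM => //; exact: up_flip.
Qed.

Lemma heat_dev L v g x : flip_lip L g -> `|g x - heat v g x| <= L.
Proof.
move=> gL; have := gL v x.
have p0 := pmin_gt0; have /andP[u1 u2] := up_range v x.
rewrite -{3}(set_spin_id x v) /heat; set u := up v x.
set a := g _; set c := g _ => h.
have -> : g (set_spin x v (x v)) - (u * a + (1 - u) * c) =
   (if x v then 1 - u else - u) * (a - c).
  by rewrite /a /c; case: (x v); ring.
rewrite normrM; apply: le_trans h; rewrite ler_piMl //.
by case: (x v); rewrite ?normrN ger0_norm /u; lra.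
Qed.

Lemma dot_norm_le f g (L M : R) : 0 <= L ->
  (forall x, `|f x| <= L) -> (forall x, `|g x| <= M) -> dot pi f g <= L * M.
Proof.
move=> L0 fL gM; rewrite -[leRHS](expect_cst pi_one).
apply: (le_expect pi_ge0) => x; apply: le_trans (ler_norm _) _.
by rewrite normrM ler_pM.
Qed.

(** Telescoping [1 - scan s] over the updated sites and using that each [heat v]
    is an orthogonal projection, the form is a sum of [size s] products of
    one-site increments. *)
Lemma scan_dirichlet_le L M s f g : 0 <= L -> 0 <= M ->
  flip_lip L f -> flip_lip M g ->
  dot pi f g - dot pi f (scan s g) <=
  (size s)%:R * (L * (1 + 4 / n%:R) ^+ size s * M).
Proof.
have n4 : 0 <= 4 / n%:R :> R by rewrite divr_ge0.
elim: s L f => [|v s IH] L f L0 M0 fL gM /=; first by rewrite subrr mul0r.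
have -> : dot pi f g - dot pi f (heat v (scan s g)) =
    dot pi (fun x => f x - heat v f x) (fun x => g x - heat v g x) +
    (dot pi (heat v f) g - dot pi (heat v f) (scan s g)).
  rewrite heat_selfadjoint dotBl !dotBr -(heat_selfadjoint v f g).
  by rewrite -[in X in _ - X + _](heat_selfadjoint v f) heat_idem; ring.
have h := IH _ _ (mulr_ge0 L0 (addr_ge0 ler01 n4)) M0 (flip_lip_heat v L0 fL) gM.
have e1 : 1 <= (1 + 4 / n%:R) ^+ (size s).+1 :> R by rewrite exprn_ege1 // lerDl.
rewrite -natr1 mulrDl mul1r addrC; apply: lerD.
  by move: h; rewrite -[in X in X -> _](mulrA L) -exprS.
apply: le_trans (dot_norm_le (M := M) L0 _ _) _; first by move=> x; exact: heat_dev.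
  by move=> x; exact: heat_dev.
by apply: ler_wpM2r => //; rewrite ler_peMr.
Qed.

Lemma flip_lip_total_spin : flip_lip 2 total_spin.
Proof.
by move=> v x; rewrite !total_spin_set ger0_norm; lra.
Qed.

(** The Lipschitz constant grows by a factor at most [(1 + 4 / n) ^ k <= expR 4]
    along the scan, so the form is of the order of the number of updates. *)
Lemma rscan_dirichlet_le k : (k <= n)%N ->
  nsq pi total_spin - dot pi total_spin (rscan k total_spin) <=
  4 * expR 4 * k%:R.
Proof.
move=> kn; rewrite [in X in _ - X]dotC dot_mean -[nsq _ _](mean_cst (utuples_gt0 kn)) -meanB.
rewrite -[leRHS](mean_cst (utuples_gt0 kn)); apply: ler_mean => s _.
have := scan_dirichlet_le s (ler0n R 2) (ler0n R 2) flip_lip_total_spin flip_lip_total_spin.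
rewrite [dot _ (scan s _) _]dotC => /le_trans; apply; rewrite size_tuple mulrC ler_wpM2r //.
have : (1 + 4 / n%:R) ^+ k <= expR 4 :> R.
  apply: (@le_trans _ _ (expR (4 / n%:R) ^+ k)).
    rewrite lerXn2r ?nnegrE ?expR_ge0 ?expR_ge1Dx //.
  rewrite -expRM_natl ler_expR mulrCA -[leRHS]mulr1 ler_wpM2l //.
  by rewrite ler_pdivrMr // mul1r ler_nat.
by lra.
Qed.

Lemma expect_total_spin : expect pi total_spin = 0.
Proof.
pose neg x : conf := [ffun v => ~~ x v].
have negK : involutive neg by move=> x; apply/ffunP => v; rewrite !ffunE negbK.
have negM x : total_spin (neg x) = - total_spin x.
  rewrite /total_spin -sumrN; apply: eq_bigr => v _.
  by rewrite /spin ffunE; case: (x v); rewrite ?opprK.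
have : expect pi total_spin = - expect pi total_spin.
  rewrite {1}/expect (reindex_inj (inv_inj negK)) /= -sumrN.
  by apply: eq_bigr => x _; rewrite !piE negM sqrrN; ring.
by move=> ?; lra.
Qed.

(** * Drift of the squared total spin *)

Definition sqspin x : R := total_spin x ^+ 2.

Lemma tanh_upE v x : tanh (field v x / n%:R) = 2 * up v x - 1.
Proof. by rewrite upE /p_plus mul1r; field. Qed.

Definition spin_drift v x : R :=
  2 * field v x * (tanh (field v x / n%:R) - spin R x v).

Lemma heat_sqspin v x : heat v sqspin x = sqspin x + spin_drift v x.
Proof.
rewrite /heat /sqspin !total_spin_set /spin_drift tanh_upE.
have -> : total_spin x = field v x + spin R x v by rewrite /field; ring.
have := spin_sqr x v; move: (spin R x v) => e e1.
have -> : (field v x + e) ^+ 2 = field v x ^+ 2 + 2 * field v x * e + 1.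
  by transitivity (field v x ^+ 2 + 2 * field v x * e + e * e); [ring | rewrite e1].
ring.
Qed.

Lemma spin_drift_norm v x : `|spin_drift v x| <= 4 * (`|total_spin x| + 1).
Proof.
rewrite /spin_drift !normrM tanh_upE.
have p0 := pmin_gt0; have /andP[u1 u2] := up_range v x.
have h1 : `|2 * up v x - 1 - spin R x v| <= 2.
  apply: le_trans (ler_normB _ _) _; rewrite spin_norm.
  have : `|2 * up v x - 1| <= 1 by rewrite ler_norml; apply/andP; split; lra.
  by lra.
have h2 : `|field v x| <= `|total_spin x| + 1.
  by apply: le_trans (ler_normB _ _) _; rewrite spin_norm.
rewrite (ger0_norm (x := 2)) //.
have := normr_ge0 (field v x); have := normr_ge0 (2 * up v x - 1 - spin R x v).
by nra.
Qed.

(** An affine bound in the spin at [v], so that summation over [v] reproduces the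
    total spin; [tanh_taylor] at [field v x / n] supplies the quartic term. *)
Lemma spin_drift_le v x : spin_drift v x <=
  (2 * (total_spin x ^+ 2 + 1) / n%:R + 2
    - (total_spin x ^+ 4 / 8 - 1) / (4 * n%:R ^+ 3))
  - (4 / n%:R + 2) * total_spin x * spin R x v.
Proof.
set z := field v x / n%:R.
have z1 : `|z| <= 1.
  rewrite /z normrM [`|_^-1|]ger0_norm ?invr_ge0 // ler_pdivrMr // mul1r.
  exact: field_norm.
have hz : field v x = n%:R * z by rewrite /z; field.
have := tanh_taylor z1; rewrite -(ler_pM2l (mulr_gt0 (ltr0n R 2) np)).
have s2 := spin_sqr x v.
have M4 : total_spin x ^+ 4 / 8 - 1 <= field v x ^+ 4.
  have -> : total_spin x = field v x + spin R x v by rewrite /field; ring.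
  move: (field v x) => h.
  have : 0 <= (h - spin R x v) ^+ 2 *
      (2 * h ^+ 2 + 5 * (h + spin R x v) ^+ 2 + 2 * spin R x v ^+ 2).
    by rewrite mulr_ge0 ?sqr_ge0 // !addr_ge0 // mulr_ge0 ?sqr_ge0.
  by rewrite /spin; case: (x v) => ?; lra.
move=> h.
have : (total_spin x ^+ 4 / 8 - 1) / (4 * n%:R ^+ 3) <= field v x ^+ 4 / (4 * n%:R ^+ 3).
  by rewrite ler_pM2r // invr_gt0 mulr_gt0 // exprn_gt0.
have -> : field v x ^+ 4 / (4 * n%:R ^+ 3) = n%:R * z ^+ 4 / 4.
  by rewrite hz; field.
rewrite /spin_drift -/z.
have -> : 2 * (total_spin x ^+ 2 + 1) / n%:R =
    2 * n%:R * z ^+ 2 + 4 / n%:R * total_spin x * spin R x v.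
  have -> : total_spin x = n%:R * z + spin R x v by rewrite -hz /field; ring.
  have : spin R x v = 1 \/ spin R x v = -1 by rewrite /spin; case: (x v); [left|right].
  by case=> ->; field.
have -> : 2 * field v x * (tanh z - spin R x v) =
  2 * n%:R * (z * tanh z) - 2 * total_spin x * spin R x v + 2.
  rewrite hz (_ : total_spin x = n%:R * z + spin R x v); last by rewrite -hz /field; ring.
  have : spin R x v = 1 \/ spin R x v = -1 by rewrite /spin; case: (x v); [left|right].
  by case=> ->; ring.
move=> h2; have : 2 * n%:R * (z ^+ 2 - z ^+ 4 / 8) = 2 * n%:R * z ^+ 2 - n%:R * z ^+ 4 / 4.
  by field.
lra.
Qed.

(** The terms in [total_spin x ^ 2] cancel at order one, which is the criticality
    of [beta = 1]; the remaining one, of order [1 / n], is negative. *)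
Lemma sum_spin_drift x :
  \sum_v spin_drift v x <= 5 * n%:R - sqspin x ^+ 2 / (32 * n%:R ^+ 2).
Proof.
set c := 2 * (total_spin x ^+ 2 + 1) / n%:R + 2
    - (total_spin x ^+ 4 / 8 - 1) / (4 * n%:R ^+ 3).
apply: (@le_trans _ _ (\sum_v (c - (4 / n%:R + 2) * total_spin x * spin R x v))).
  by apply: ler_sum => v _; exact: spin_drift_le.
rewrite sumrB -mulr_sumr sumr_const card_ord -/(total_spin x) -[c *+ n]mulr_natl.
have n1 : 1 <= n%:R :> R by rewrite ler1n.
have -> : n%:R * c - (4 / n%:R + 2) * total_spin x * total_spin x =
   2 * n%:R + 2 - 4 * total_spin x ^+ 2 / n%:R - sqspin x ^+ 2 / (32 * n%:R ^+ 2)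
   + 1 / (4 * n%:R ^+ 2).
  by rewrite /c /sqspin; field.
have : 0 <= 4 * total_spin x ^+ 2 / n%:R by rewrite divr_ge0 // mulr_ge0 // sqr_ge0.
have : 1 / (4 * n%:R ^+ 2) <= 1 :> R.
  by rewrite ler_pdivrMr; nra.
lra.
Qed.

(** Leaving out the sites already updated in the current scan biases the average
    by a multiple of [size s * (|M| + 1) / n], where [M] is the total spin; the
    quartic term absorbs this as soon as [size s ^ 4 <= n]. *)
Lemma drift_avoid (s : seq 'I_n) x : uniq s ->
  (2 * size s <= n)%N -> (size s ^ 4 <= n)%N ->
  mean [set v | v \notin s] (fun v => heat v sqspin x) <=
  sqspin x + 100 - sqspin x ^+ 2 / (64 * n%:R ^+ 3).
Proof.
move=> us s2n s4n.
have sn : (size s < n)%N by lia.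
have S0 : (0 < #|[set v | v \notin s]|)%N by rewrite card_sites_avoid // subn_gt0.
have -> : mean [set v | v \notin s] (fun v => heat v sqspin x) =
  sqspin x + mean [set v | v \notin s] (spin_drift^~ x).
  rewrite -{1}(mean_cst S0 (sqspin x)) -[mean _ (fun=> _)]mul1r -mean_lin.
  by apply: eq_mean => v _; rewrite heat_sqspin mul1r.
rewrite -addrA lerD2l.
set M := total_spin x; set f : R := (size s)%:R; set N : R := n%:R.
have N1 : 1 <= N by rewrite ler1n.
have f2 : 2 * f <= N by rewrite /f /N -natrM ler_nat.
have f0 : 0 <= f by [].
have f4 : f ^+ 4 <= N by rewrite /f /N -natrX ler_nat.
have sumle : \sum_(v in [set v | v \notin s]) spin_drift v x <=
    5 * N - M ^+ 4 / (32 * N ^+ 2) + f * (4 * (`|M| + 1)).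
  have := sum_spin_drift x; rewrite (bigID (mem [set v | v \notin s])) /=.
  have -> : sqspin x ^+ 2 = M ^+ 4 by rewrite /sqspin -exprM.
  have : - (\sum_(v | v \notin [set v | v \notin s]) spin_drift v x) <=
     f * (4 * (`|M| + 1)).
    apply: le_trans (ler_norm _) _; rewrite normrN.
    apply: le_trans (ler_norm_sum _ _ _) _.
    apply: (@le_trans _ _ (\sum_(v | v \notin [set v | v \notin s]) (4 * (`|M| + 1)))).
      by apply: ler_sum => v _; exact: spin_drift_norm.
    rewrite sumr_const -[X in X <= _]mulr_natl.
    have M0 : 0 <= 4 * (`|M| + 1) by rewrite mulr_ge0 ?addr_ge0.
    apply: (ler_wpM2r M0); rewrite ler_nat.
    rewrite -(card_uniqP us) subset_leq_card //.
    by apply/fintype.subsetP => v; rewrite unfold_in inE negbK.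
  by rewrite -/N; lra.
rewrite /mean card_sites_avoid // natrB ?(ltnW sn) // -/N -/f.
have m0 : 0 < N - f by lra.
rewrite mulrC ler_pdivrMr //; apply: le_trans sumle _.
have -> : sqspin x ^+ 2 = M ^+ 4 by rewrite /sqspin -exprM.
set Q := M ^+ 4 / N ^+ 3.
have Q0 : 0 <= Q.
  by apply: divr_ge0; [exact: exprn_even_ge0 | apply: exprn_ge0; lra].
have N0 : N != 0 by rewrite gt_eqF //; lra.
have -> : M ^+ 4 / (32 * N ^+ 2) = N * Q / 32 by rewrite /Q; field.
have -> : M ^+ 4 / (64 * N ^+ 3) = Q / 64 by rewrite /Q; field.
pose y := f * `|M| / N.
have y0 : 0 <= y by rewrite /y !mulr_ge0 ?invr_ge0 //; lra.
have yQ : y ^+ 4 <= Q.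
  have -> : y ^+ 4 = f ^+ 4 / N * Q.
    rewrite /y /Q !exprMn exprVn.
    have M4 : `|M| ^+ 4 = M ^+ 4 by rewrite -normrX ger0_norm // exprn_even_ge0.
    by rewrite M4; field.
  by rewrite ler_piMl // ler_pdivrMr ?mul1r //; lra.
(* [y] is the bias and [Q] the restoring force: [y ^ 4 <= Q] by [size s ^ 4 <= n],
   so that half of the force compensates the bias up to a constant. *)
have ybound : 8 * y <= 64 + y ^+ 4 / 64.
  have [y8|/ltW y8] := leP y 8; first by have := exprn_ge0 4 y0; lra.
  have : 8 ^+ 3 <= y ^+ 3 by rewrite lerXn2r ?nnegrE.
  by rewrite (exprS y 3); nra.
have -> : f * (4 * (`|M| + 1)) = 4 * (N * y) + 4 * f by rewrite /y; field.
have h1 : N * y <= N * (8 + Q / 512) by rewrite ler_wpM2l; lra.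
have h2 : 0 <= f * Q by rewrite mulr_ge0.
have h3 : 0 <= N * Q by apply: mulr_ge0 => //; lra.
have -> : (100 - Q / 64) * (N - f) = 100 * N - 100 * f - N * Q / 64 + f * Q / 64.
  by field.
lra.
Qed.

Lemma rscan_rev j f x :
  rscan j f x = mean (utuples j) (fun s => scan (rev s) f x).
Proof.
have revI : injective (fun s : j.-tuple 'I_n => [tuple of rev s]).
  by apply: inv_inj => s; apply: val_inj; rewrite /= revK.
rewrite /rscan /mean (reindex_inj revI) /=; congr (_ * _).
by apply: eq_bigl => s; rewrite !inE rev_uniq.
Qed.

(** Linearizing the square at [a] makes the drift inequality affine, hence stable
    under averaging over the earlier sites of the scan. *)
Lemma rscan_drift j (a : R) x : (2 * j <= n)%N -> (j ^ 4 <= n)%N ->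
  0 <= a <= n%:R ^+ 2 ->
  rscan j sqspin x <= (1 - 2 * a / (64 * n%:R ^+ 3)) ^+ j * sqspin x
     + j%:R * (100 + a ^+ 2 / (64 * n%:R ^+ 3)).
Proof.
move=> jn j4 /andP[a0 an].
have n3 : 0 < 64 * n%:R ^+ 3 :> R by rewrite mulr_gt0 // exprn_gt0.
have n1 : 1 <= n%:R :> R by rewrite ler1n.
set r := 1 - _; set c := 100 + _.
have c0 : 0 <= c by rewrite addr_ge0 // divr_ge0 ?sqr_ge0 // ltW.
have r0 : 0 <= r.
  rewrite subr_ge0 ler_pdivrMr // mul1r exprS.
  have : 0 <= n%:R ^+ 2 :> R by exact: sqr_ge0.
  by nra.
have r1 : r <= 1 by rewrite gerBl divr_ge0 ?mulr_ge0 // ltW.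
rewrite rscan_rev; elim: j jn j4 => [|j IH] jn j4.
  rewrite expr0 mul1r mul0r addr0 -[leRHS](mean_cst (utuples_gt0 (leq0n n))).
  by apply: ler_mean => s _; rewrite (tuple0 s).
have j4' : (j ^ 4 <= n)%N by apply: leq_trans j4; rewrite leq_exp2r.
rewrite (mean_utuplesS_tail (fun s => scan (rev s) sqspin x));
  last by apply: leq_trans jn; rewrite leq_pmull.
apply: (@le_trans _ _ (mean (utuples j)
    (fun s => r * scan (rev s) sqspin x + c))).
  apply: ler_mean => s; rewrite inE => us.
  have -> : mean [set v | v \notin s] (fun v => scan (rev (v :: s)) sqspin x) =
     scan (rev s) (fun y => mean [set v | v \notin s] (fun v => heat v sqspin y)) x.
    rewrite (avg_mean (averaging_scan _)); apply: eq_mean => v _.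
    by rewrite rev_cons -cats1 /scan foldr_cat.
  rewrite -(avg_cst (averaging_scan (rev s)) c x) -(avg_lin (averaging_scan _)).
  apply: (avg_le (averaging_scan _)) => y.
  apply: le_trans (drift_avoid _ us _ _) _; rewrite ?size_tuple //.
    by apply: leq_trans jn; rewrite leq_mul2l leqnSn.
  rewrite /r /c; move: (sqspin y) => F.
  have : 0 <= (64 * n%:R ^+ 3)^-1 :> R by rewrite invr_ge0 ltW.
  move: (64 * n%:R ^+ 3)^-1 => q q0; have := mulr_ge0 q0 (sqr_ge0 (F - a)).
  by move=> ?; lra.
have jn' : (2 * j <= n)%N by apply: leq_trans jn; rewrite leq_mul2l leqnSn.
have U0 : (0 < #|utuples j|)%N.
  by apply: utuples_gt0; apply: leq_trans jn'; rewrite leq_pmull.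
rewrite mean_lin mean_cst //.
have {}IH := IH jn' j4'.
apply: (@le_trans _ _ (r * (r ^+ j * sqspin x + j%:R * c) + c)).
  by rewrite lerD2r ler_wpM2l.
rewrite exprS -natr1; have : r * (j%:R * c) <= j%:R * c.
  by rewrite ler_piMl // mulr_ge0.
by move: (r ^+ j) => q ?; lra.
Qed.

(** * The critical scale *)

(** [n ^ (3/2)], the order of the squared total spin at equilibrium. *)
Definition crit : R := Num.sqrt (n%:R ^+ 3).

Lemma crit_sqr : crit ^+ 2 = n%:R ^+ 3.
Proof. by rewrite sqr_sqrtr // exprn_ge0. Qed.

Lemma crit_ge0 : 0 <= crit. Proof. exact: sqrtr_ge0. Qed.

Lemma crit_ge : n%:R <= crit.
Proof.
have n1 : 1 <= n%:R :> R by rewrite ler1n.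
rewrite -(ler_pXn2r (ltn0Sn 1)) ?nnegrE ?crit_ge0 // crit_sqr (exprS _ 2).
by rewrite ler_peMl ?sqr_ge0.
Qed.

Lemma crit_gt0 : 0 < crit. Proof. exact: lt_le_trans np crit_ge. Qed.

Lemma crit_le : crit <= n%:R ^+ 2.
Proof.
have n1 : 1 <= n%:R :> R by rewrite ler1n.
rewrite -(ler_pXn2r (ltn0Sn 1)) ?nnegrE ?crit_ge0 ?sqr_ge0 // crit_sqr -exprM.
by rewrite (exprS _ 3) ler_peMl ?exprn_ge0.
Qed.

Lemma sqspin_ge0 x : 0 <= sqspin x. Proof. exact: sqr_ge0. Qed.

Lemma sqspin_le x : sqspin x <= n%:R ^+ 2.
Proof.
rewrite /sqspin -(real_normK (num_real _)) lerXn2r ?nnegrE //.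
exact: total_spin_norm.
Qed.

Lemma rscan_drift_quad k x (a : R) : (2 * k <= n)%N -> (k ^ 4 <= n)%N ->
  0 <= a <= n%:R ^+ 2 -> rscan k sqspin x <=
    (1 - k%:R * a / (64 * n%:R ^+ 3)) * sqspin x +
    k%:R * (100 + a ^+ 2 / (64 * n%:R ^+ 3)).
Proof.
move=> k2 k4 a_n; have /andP[a0 an] := a_n.
apply: le_trans (rscan_drift x k2 k4 a_n) _; rewrite lerD2r ler_wpM2r ?sqspin_ge0 //.
have n1 : 1 <= n%:R :> R by rewrite ler1n.
have n3 : 0 < 64 * n%:R ^+ 3 :> R by rewrite mulr_gt0 // exprn_gt0.
have kn : 2 * k%:R <= n%:R :> R by rewrite -natrM ler_nat.
have k0 : 0 <= k%:R :> R by [].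
have ka : k%:R * (2 * a) <= 64 * n%:R ^+ 3.
  rewrite (exprS _ 2); have : 0 <= n%:R ^+ 2 :> R by exact: sqr_ge0.
  have : k%:R * a <= n%:R * n%:R ^+ 2 by apply: ler_pM => //; lra.
  move: (n%:R ^+ 2) => q; have : 0 <= n%:R :> R by [].
  by move=> ? ? ?; nra.
apply: le_trans (exp_one_sub_le _ _) _.
- rewrite divr_ge0 ?mulr_ge0 ?(ltW n3) //= ler_pdivrMr // mul1r.
  rewrite (exprS _ 2); move: an; have : 0 <= n%:R ^+ 2 :> R by exact: sqr_ge0.
  by move: (n%:R ^+ 2) => q; nra.
- by rewrite mulrA ler_pdivrMr // mul1r.
by rewrite le_eqVlt; apply/orP; left; apply/eqP; field.
Qed.

(** In expectation the squared total spin loses a multiple of [k * y ^ 2 / n ^ 3]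
    per scan and gains at most [100 * k], so [quadratic_decay] brings it down to
    the order at which the two balance. *)
Lemma burn_in k t x : (0 < k)%N -> (2 * k <= n)%N -> (k ^ 4 <= n)%N ->
  2 * crit <= t%:R * k%:R -> iter t (rscan k) sqspin x <= 600 * crit.
Proof.
move=> k0 k2 k4 tk.
have kn : (k <= n)%N by lia.
have kp : 0 < k%:R :> R by rewrite ltr0n.
have kn' : 2 * k%:R <= n%:R :> R by rewrite -natrM ler_nat.
have avT s := averaging_iter s (averaging_rscan kn).
pose y s := iter s (rscan k) sqspin x.
have y_range s : 0 <= y s <= n%:R ^+ 2.
  apply: (avg_range (avT s)) => z; by rewrite sqspin_ge0 sqspin_le.
have n3 : 0 < 64 * n%:R ^+ 3 :> R by rewrite mulr_gt0 // exprn_gt0.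
have rec s : y s.+1 <= y s - k%:R / (256 * n%:R ^+ 3) * y s ^+ 2 + 100 * k%:R.
  have /andP[ys0 ysn] := y_range s.
  (* [a = y s / 2] maximizes the gain [a * y s - a ^+ 2] of the linearization. *)
  have as_n : 0 <= y s / 2 <= n%:R ^+ 2 by apply/andP; split; lra.
  rewrite {1}/y iterSr.
  apply: le_trans (avg_le (avT s) (fun z => rscan_drift_quad z k2 k4 as_n) x) _.
  rewrite (avg_lin (avT s)) (avg_cst (avT s)) -/(y s).
  rewrite le_eqVlt; apply/orP; left; apply/eqP; field.
  by rewrite gt_eqF.
have q0 : 0 < k%:R / (256 * n%:R ^+ 3) :> R
  by rewrite divr_gt0 ?mulr_gt0 ?exprn_gt0 ?ltr0n.
have k100 : 0 <= 100 * k%:R :> R := mulr_ge0 (ler0n R 100) (ltW kp).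
(* [227 ^+ 2 >= 2 * 100 * 256], the condition on the level in the comparison. *)
have b0 : 0 <= 227 * crit := mulr_ge0 (ler0n R 227) crit_ge0.
have c0 := crit_gt0; have cn := crit_ge.
have db : 2 * (100 * k%:R) <= k%:R / (256 * n%:R ^+ 3) * (227 * crit) ^+ 2.
  rewrite exprMn crit_sqr.
  rewrite [leRHS](_ : _ = k%:R * (227 ^+ 2 / 256)); last by field.
  by nra.
case: (quadratic_decay q0 k100 b0 db (fun s => proj1 (andP (y_range s))) rec t).
  by rewrite -/(y t) => h; lra.
rewrite -/(y t) => h.
have /andP[yt0 _] := y_range t.
have : 2 * crit * y t <= 512 * crit ^+ 2.
  rewrite crit_sqr; apply: le_trans (ler_wpM2r yt0 tk) _.
  have -> : t%:R * k%:R * y t = (256 * n%:R ^+ 3) * (k%:R / (256 * n%:R ^+ 3) * t%:R * y t).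
    by field; rewrite gt_eqF.
  have -> : 512 * n%:R ^+ 3 = 256 * n%:R ^+ 3 * 2 :> R by ring.
  by rewrite ler_wpM2l ?mulr_ge0 ?exprn_ge0 ?ler0n.
rewrite (_ : 512 * crit ^+ 2 = 2 * crit * (256 * crit)); last by ring.
by rewrite ler_pM2l ?mulr_gt0 // => ?; lra.
Qed.

Lemma glauber_drift x :
  glauber sqspin x <= sqspin x + 100 - sqspin x ^+ 2 / (64 * n%:R ^+ 3).
Proof.
have := @drift_avoid [::] x isT (leq0n _) (leq0n _).
have -> // : [set v | v \notin [::]] = [set: 'I_n].
by apply/setP => v; rewrite !inE.
Qed.

Lemma glauber_iter_drift i x : iter i glauber sqspin x <= sqspin x + 100 * i%:R.
Proof.
elim: i => [|i IH]; first by rewrite mulr0 addr0.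
rewrite iterSr.
have avg := averaging_iter i averaging_glauber.
apply: (@le_trans _ _ (iter i glauber (fun y => sqspin y + 100) x)).
  apply: (avg_le avg) => y; apply: le_trans (glauber_drift y) _.
  by rewrite gerBl divr_ge0 ?sqr_ge0 // mulr_ge0 // exprn_ge0.
by rewrite (avgD avg) (avg_cst avg) -natr1; lra.
Qed.

Lemma glauber_selfadjoint : selfadjoint pi glauber.
Proof.
move=> f g; rewrite dotC !dot_mean; apply: eq_mean => v _.
by rewrite dotC heat_selfadjoint.
Qed.

(** A stationary expectation has no drift, so the mean of the quartic term is at
    most the constant one. *)
Lemma expect_sqspin : expect pi sqspin <= 80 * crit.
Proof.
have aE := averaging_expect pi_ge0 pi_one.
have x0 : conf := [ffun=> true].
have := le_expect pi_ge0 glauber_drift.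
rewrite (expect_stationary averaging_glauber glauber_selfadjoint).
rewrite (avgB aE (fun y => sqspin y + 100) _ x0) (avgD aE _ _ x0) expect_cst ?pi_one //.
have -> : (fun y => sqspin y ^+ 2 / (64 * n%:R ^+ 3)) =
   (fun y => (64 * n%:R ^+ 3)^-1 * sqspin y ^+ 2) by apply/funext => y; rewrite mulrC.
rewrite (avgZ aE _ _ x0) => h.
have n3 : 0 < 64 * n%:R ^+ 3 :> R by rewrite mulr_gt0 // exprn_gt0.
have h1 : expect pi (fun y => sqspin y ^+ 2) <= 6400 * crit ^+ 2.
  rewrite crit_sqr (_ : 6400 * _ = 64 * n%:R ^+ 3 * 100); last by ring.
  by rewrite -ler_pdivrMl //; lra.
have h2 : expect pi sqspin ^+ 2 <= (80 * crit) ^+ 2.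
  apply: le_trans (avg_sqr_le aE sqspin x0) (le_trans h1 _).
  by rewrite exprMn le_eqVlt; apply/orP; left; apply/eqP; ring.
rewrite -(ler_pXn2r (ltn0Sn 1)) // nnegrE ?mulr_ge0 ?crit_ge0 //.
by apply: (avg_ge0 aE _ x0) => y; exact: sqspin_ge0.
Qed.

(** Markov's inequality for the law that [T] attaches to [x]. *)
Lemma avg_far_le (T : (conf -> R) -> conf -> R) (D C : R) x :
  averaging T -> 0 < D -> T sqspin x <= C ->
  T (fun y => (D < sqspin y)%R%:R) x <= C / D.
Proof.
move=> aT D0 TC; apply: (@le_trans _ _ (T (fun y => D^-1 * sqspin y) x)).
  apply: (avg_le aT) => y; rewrite mulrC; case: ltP => h.
    by rewrite ler_pdivlMr // mul1r ltW.
  by rewrite divr_ge0 ?sqspin_ge0 // ltW.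
by rewrite (avgZ aT) mulrC ler_wpM2r // invr_ge0 ltW.
Qed.

(** * Occupation probabilities of the total spin *)

Definition occ (j : nat) : R := \sum_(x | nplus x == j) pi x.

Lemma occ_ge0 j : 0 <= occ j.
Proof. by apply: sumr_ge0 => x _; exact: pi_ge0. Qed.

Lemma expect_nplus (F : nat -> R) :
  expect pi (fun x => F (nplus x)) = \sum_(j < n.+1) occ j * F j.
Proof.
rewrite /expect (partition_big (fun x => inord (nplus x) : 'I_n.+1) xpredT) //=.
apply: eq_bigr => j _; rewrite /occ mulr_suml.
have jE x : (inord (nplus x) == j) = (nplus x == j).
  by rewrite -val_eqE /= inordK // ltnS nplus_le.
by apply: eq_big => [x|x]; rewrite jE // => /eqP ->.
Qed.

Lemma card_nplus j : #|[set x : conf | nplus x == j]| = 'C(n, j).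
Proof.
rewrite -[n in RHS]card_ord -card_draws.
pose S (x : conf) := [set v | x v].
have S_inj : injective S.
  by move=> x y /setP xy; apply/ffunP => v; have := xy v; rewrite !inE.
rewrite -(card_imset _ S_inj); apply: eq_card => A; rewrite !inE.
apply/imsetP/idP => [[x]|Aj]; first by rewrite inE => ? ->.
exists [ffun v => v \in A]; last by apply/setP => v; rewrite !inE ffunE.
rewrite inE /nplus (_ : [set v | _] = A) //.
by apply/setP => v; rewrite inE ffunE.
Qed.

Lemma occE j : occ j = 'C(n, j)%:R *
  (expR (((2 * j%:R - n%:R) ^+ 2 - n%:R) / (2 * n%:R)) / zsum).
Proof.
rewrite -card_nplus mulr_natl -sumr_const /occ.
rewrite big_mkcond [RHS]big_mkcond; apply: eq_bigr => x _; rewrite inE.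
by case: eqP => // <-; rewrite piE total_spinE.
Qed.

Lemma occ_ratio j : (j < n)%N ->
  j.+1%:R * occ j.+1 =
  (n - j)%:R * expR (2 * (2 * j%:R - n%:R + 1) / n%:R) * occ j.
Proof.
move=> jn; rewrite !occE !mulrA -natrM mul_bin_left natrM.
have -> : expR (((2 * j.+1%:R - n%:R) ^+ 2 - n%:R) / (2 * n%:R)) =
    expR (2 * (2 * j%:R - n%:R + 1) / n%:R) *
    expR (((2 * j%:R - n%:R) ^+ 2 - n%:R) / (2 * n%:R)) :> R.
  by rewrite -expRD; congr expR; rewrite -natr1; field.
by ring.
Qed.

(** Here [a] and [b] are consecutive occupation probabilities, [b] being the one
    farther from balance, and [e] is the correction of order [M / n ^ 2] in the
    exponent of their ratio, for a total spin [M]. *)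
Lemma ratio_bounds (a b u e : R) : 0 <= a -> 0 <= b -> 0 <= u <= 1 / 2 ->
  0 <= e -> (1 + u) * b = (1 - u) * expR (2 * u + e) * a ->
  b <= expR e * a /\ a <= expR (2 * u ^+ 3) * b.
Proof.
move=> a0 b0 /andP[u0 u1] e0 ab.
have h1 : (1 - u) * expR (2 * u) <= 1 + u by apply: expR2_ratio_le; apply/andP; split; lra.
have h2 : 1 + u <= (1 - u) * expR (2 * u + 2 * u ^+ 3).
  by apply: expR2_ratio_ge; apply/andP; split.
have ee : 1 <= expR e by rewrite -[leLHS]expR0 ler_expR.
split.
  have p : 0 < 1 + u by lra.
  rewrite -(ler_pM2l p) ab expRD.
  have h : 0 <= expR e * a by rewrite mulr_ge0 ?expR_ge0.
  apply: le_trans (ler_wpM2r h h1).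
  by rewrite le_eqVlt; apply/orP; left; apply/eqP; ring.
have p : 0 < (1 - u) * expR (2 * u) by rewrite mulr_gt0 ?expR_gt0 //; lra.
rewrite -(ler_pM2l p); apply: (@le_trans _ _ ((1 + u) * b)).
  rewrite ab expRD [_ * (_ * expR e)]mulrA; apply: ler_wpM2r => //.
  by rewrite ler_peMr // ltW.
apply: le_trans (ler_wpM2r b0 h2) _; rewrite expRD.
by rewrite le_eqVlt; apply/orP; left; apply/eqP; ring.
Qed.

Definition window (m j : nat) : bool := (n <= 2 * j + m)%N && (2 * j <= n + m)%N.

Lemma window_le m j : (m <= n)%N -> window m j -> (j <= n)%N.
Proof. by rewrite /window; lia. Qed.

Lemma window_half m : (0 < m)%N -> window m (n %/ 2).
Proof. by rewrite /window; lia. Qed.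

Lemma window_spin m x : window m (nplus x) = (sqspin x <= m%:R ^+ 2).
Proof.
rewrite /sqspin -[in RHS](real_normK (num_real (total_spin x))).
rewrite ler_pXn2r ?nnegrE // total_spinE ler_norml.
have e1 : (2 * nplus x + m)%:R = 2 * (nplus x)%:R + m%:R :> R by rewrite natrD natrM.
have e2 : (2 * nplus x)%:R = 2 * (nplus x)%:R :> R by rewrite natrM.
rewrite /window -(ler_nat R n) -(ler_nat R (2 * nplus x)) e1 e2 natrD.
by congr (_ && _); apply/idP/idP => ?; lra.
Qed.

(** One step inside a window: the ratio of consecutive occupation probabilities
    is [(1 - u) / (1 + u) * expR (2 u (1 + 1/n))] with [u = M / (n + 1)], where
    [M] lies between the two values of the total spin; at the critical
    temperature the terms linear in [u] cancel, and what remains is of order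
    [u ^ 3 + u / n]. *)
Lemma occ_step m j : (2 * m <= n)%N -> window m j -> window m j.+1 ->
  let k := 2 * (m%:R / n%:R) ^+ 3 + 2 * m%:R / n%:R ^+ 2 in
  occ j <= expR k * occ j.+1 /\ occ j.+1 <= expR k * occ j.
Proof.
move=> mn wj wj1 k.
have jn : (j < n)%N by apply: (@window_le m) wj1; lia.
set u := (2 * j%:R - n%:R + 1) / (n%:R + 1) : R.
have N1 : 0 < n%:R + 1 :> R by rewrite ltr_wpDl.
have mR : 2 * m%:R <= n%:R :> R by rewrite -natrM ler_nat.
have m0 : 0 <= m%:R :> R by [].
have /andP[M1 M2] : (- m%:R <= 2 * j%:R - n%:R + 1 :> R) && (2 * j%:R - n%:R + 1 <= m%:R :> R).
  move: wj wj1; rewrite /window => /andP[]; rewrite -!(ler_nat R) !natrD !natrM.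
  by rewrite -natr1 => ? _ /andP[_ ?]; apply/andP; split; lra.
have absu : `|u| <= m%:R / n%:R.
  rewrite /u normrM normfV (ger0_norm (x := n%:R + 1)) ?(ltW N1) //.
  rewrite ler_pdivrMr //; apply: (@le_trans _ _ m%:R).
    by rewrite ler_norml M1 M2.
  by rewrite mulrAC ler_pdivlMr // ler_wpM2l //; lra.
have u12 : `|u| <= 1 / 2.
  by apply: le_trans absu _; rewrite ler_pdivrMr //; lra.
have eq1 : (1 + u) * occ j.+1 = (1 - u) * expR (2 * u + 2 * u / n%:R) * occ j.
  have := occ_ratio jn; rewrite natrB ?(ltnW jn) // -natr1.
  have -> : 2 * u + 2 * u / n%:R = 2 * (2 * j%:R - n%:R + 1) / n%:R.
    by rewrite /u; field; rewrite n0 gt_eqF.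
  move: (expR _) => E e1.
  have -> : 1 + u = 2 * (j%:R + 1) / (n%:R + 1) by rewrite /u; field; rewrite gt_eqF.
  have -> : 1 - u = 2 * (n%:R - j%:R) / (n%:R + 1) by rewrite /u; field; rewrite gt_eqF.
  have -> : 2 * (j%:R + 1) / (n%:R + 1) * occ j.+1 = 2 / (n%:R + 1) * ((j%:R + 1) * occ j.+1).
    by field; rewrite gt_eqF.
  by rewrite e1; field; rewrite gt_eqF.
have k1 (w : R) : 0 <= w -> w <= m%:R / n%:R -> expR (2 * w / n%:R) <= expR k.
  move=> w0 wm; rewrite ler_expR /k.
  apply: (@le_trans _ _ (2 * m%:R / n%:R ^+ 2)).
    rewrite expr2 invfM mulrA ler_wpM2r ?invr_ge0 // -mulrA ler_wpM2l //.
  by rewrite lerDr mulr_ge0 // exprn_ge0 // divr_ge0.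
have k2 (w : R) : 0 <= w -> w <= m%:R / n%:R -> expR (2 * w ^+ 3) <= expR k.
  move=> w0 wm; rewrite ler_expR /k.
  apply: (@le_trans _ _ (2 * (m%:R / n%:R) ^+ 3)).
    by rewrite ler_wpM2l // lerXn2r ?nnegrE // divr_ge0.
  by rewrite lerDl divr_ge0 ?mulr_ge0 ?sqr_ge0.
have fin (a : nat) (w E : R) : E <= expR k -> w <= E * occ a -> w <= expR k * occ a.
  by move=> Ek /le_trans; apply; rewrite ler_wpM2r ?occ_ge0.
have [u0|u0] := leP 0 u.
  rewrite ger0_norm // in absu u12.
  have u0' : 0 <= u <= 1 / 2 by rewrite u0.
  have e0 : 0 <= 2 * u / n%:R by rewrite divr_ge0 // mulr_ge0.
  have [h1 h2] := ratio_bounds (occ_ge0 j) (occ_ge0 j.+1) u0' e0 eq1.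
  by split; [apply: fin h2; exact: k2 | apply: fin h1; exact: k1].
pose v := - u; have v0 : 0 <= v by rewrite oppr_ge0 ltW.
rewrite ltr0_norm // -/v in absu u12.
have v0' : 0 <= v <= 1 / 2 by rewrite v0.
have e0 : 0 <= 2 * v / n%:R by rewrite divr_ge0 // mulr_ge0.
have eq2 : (1 + v) * occ j = (1 - v) * expR (2 * v + 2 * v / n%:R) * occ j.+1.
  have -> : (1 - v) * expR (2 * v + 2 * v / n%:R) * occ j.+1 =
    (1 + u) * occ j.+1 * expR (2 * v + 2 * v / n%:R) by rewrite /v; ring.
  rewrite eq1 (_ : 2 * v + _ = - (2 * u + 2 * u / n%:R)); last by rewrite /v; ring.
  have := expRxMexpNx_1 (2 * u + 2 * u / n%:R).
  move: (expR _) (expR _) => E E' EE'; rewrite /v.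
  by rewrite -[LHS]mulr1 -EE'; ring.
have [h1 h2] := ratio_bounds (occ_ge0 j.+1) (occ_ge0 j) v0' e0 eq2.
by split; [apply: fin h1; exact: k1 | apply: fin h2; exact: k2].
Qed.

(** The logarithmic error of [occ_step]. *)
Definition step_cost (m : nat) : R :=
  2 * (m%:R / n%:R) ^+ 3 + 2 * m%:R / n%:R ^+ 2.

Lemma step_cost_ge0 m : 0 <= step_cost m.
Proof.
by rewrite addr_ge0 ?divr_ge0 ?mulr_ge0 ?exprn_ge0 ?divr_ge0 ?sqr_ge0.
Qed.

Lemma occ_chain m i d : (2 * m <= n)%N -> window m i -> window m (i + d) ->
  occ i <= expR (d%:R * step_cost m) * occ (i + d) /\
  occ (i + d) <= expR (d%:R * step_cost m) * occ i.
Proof.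
move=> mn wi; elim: d => [|d IH] wd; first by rewrite addn0 mul0r expR0 !mul1r.
have wd' : window m (i + d).
  by move: wi wd; rewrite /window => /andP[? ?] /andP[? ?]; apply/andP; split; lia.
rewrite addnS in wd *; have [h1 h2] := IH wd'.
have [h3 h4] := occ_step mn wd' wd.
rewrite -natr1 mulrDl mul1r expRD; split.
  apply: le_trans h1 _; rewrite -mulrA; apply: ler_wpM2l h3; exact: expR_ge0.
apply: le_trans h4 _; rewrite -/(step_cost m) [in leRHS]mulrAC [leRHS]mulrC.
by apply: ler_wpM2l h2; exact: expR_ge0.
Qed.

Lemma occ_compare m i j : (2 * m <= n)%N -> window m i -> window m j ->
  occ i <= expR (m%:R * step_cost m) * occ j.
Proof.
move=> mn wi wj.
have aux d : (d <= m)%N -> expR (d%:R * step_cost m) <= expR (m%:R * step_cost m).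
  by move=> dm; rewrite ler_expR ler_wpM2r ?step_cost_ge0 ?ler_nat.
have [ij|ij] := leqP i j.
  have jE : j = (i + (j - i))%N by rewrite subnKC.
  have := (occ_chain mn wi (etrans (congr1 (window m) (esym jE)) wj)).1.
  rewrite -jE => /le_trans; apply; rewrite ler_wpM2r ?occ_ge0 //; apply: aux.
  by move: wi wj; rewrite /window => /andP[? ?] /andP[? ?]; lia.
have iE : i = (j + (i - j))%N by rewrite subnKC // ltnW.
have := (occ_chain mn wj (etrans (congr1 (window m) (esym iE)) wi)).2.
rewrite -iE => /le_trans; apply; rewrite ler_wpM2r ?occ_ge0 //; apply: aux.
by move: wi wj; rewrite /window => /andP[? ?] /andP[? ?]; lia.
Qed.

Lemma card_window m : (#|[set j : 'I_n.+1 | window m j]| <= m.+1)%N.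
Proof.
pose j0 := ((n - m).+1 %/ 2)%N.
rewrite -[leqRHS](card_ord m.+1).
have h (j : 'I_n.+1) : window m j -> (j0 <= j)%N /\ (j - j0 < m.+1)%N.
  by rewrite /window /j0 => /andP[? ?]; lia.
rewrite -(card_in_imset (f := fun j : 'I_n.+1 => inord (j - j0) : 'I_m.+1)).
  exact: max_card.
move=> i j; rewrite !inE => /h[i1 i2] /h[j1 j2] /(congr1 val) /=.
by rewrite !inordK // => e; apply: val_inj => /=; lia.
Qed.

(** By [expect_sqspin] the window carries half of the mass, which [occ_compare]
    spreads evenly over its at most [m + 1] values. *)
Lemma occ_ge m j : (2 * m <= n)%N -> (0 < m)%N -> 160 * crit <= m%:R ^+ 2 ->
  window m j ->
  1 <= 4 * m%:R * expR (m%:R * step_cost m) * occ j.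
Proof.
move=> mn m_gt0 mcrit wj.
have mp : 0 < m%:R ^+ 2 :> R by rewrite exprn_gt0 ?ltr0n.
have aE := averaging_expect pi_ge0 pi_one.
have x0 : conf := [ffun=> true].
have far : expect pi (fun y => (m%:R ^+ 2 < sqspin y)%R%:R) <= 1 / 2.
  have h := avg_far_le (T := fun f _ => expect pi f) (x := x0) aE mp expect_sqspin.
  apply: le_trans h _.
  by rewrite ler_pdivrMr //; lra.
have near : 1 / 2 <= expect pi (fun y => (window m (nplus y))%:R).
  have -> : expect pi (fun y => (window m (nplus y))%:R) =
     expect pi (fun y => 1 - (m%:R ^+ 2 < sqspin y)%R%:R).
    apply: eq_bigr => y _; congr (_ * _).
    by rewrite window_spin; case: ltP; rewrite ?subr0 ?subrr.
  by rewrite (avgB aE (fun=> 1) _ x0) expect_cst ?pi_one //; lra.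
move: near; rewrite (expect_nplus (fun j => (window m j)%:R)).
set E := expR _ => near.
have : \sum_(i < n.+1) occ i * (window m i)%:R <= m.+1%:R * (E * occ j).
  rewrite (bigID (fun i : 'I_n.+1 => window m i)) /= addrC big1; last first.
    by move=> i /negbTE ->; rewrite mulr0.
  rewrite add0r; apply: (@le_trans _ _ (\sum_(i < n.+1 | window m i) (E * occ j))).
    by apply: ler_sum => i wi; rewrite wi mulr1; exact: occ_compare.
  rewrite sumr_const -[_ *+ _]mulr_natl ler_wpM2r ?mulr_ge0 ?expR_ge0 ?occ_ge0 //.
  rewrite ler_nat; apply: leq_trans (card_window m).
  by apply: subset_leq_card; apply/fintype.subsetP => i; rewrite unfold_in inE.
have : m.+1%:R <= 2 * m%:R :> R by rewrite -natrM ler_nat; lia.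
have : 0 <= E * occ j by rewrite mulr_ge0 ?expR_ge0 ?occ_ge0.
rewrite -[_ * E * _]mulrA; move: (E * occ j) => q.
move=> q0 m2 h; have : m.+1%:R * q <= 2 * m%:R * q by rewrite ler_wpM2r.
lra.
Qed.

(** * Symmetric functions on a window *)

Definition flip_grad v f x : R := f (set_spin x v true) - f (set_spin x v false).

(** Bounded, through [nsq_grad], by the dissipation of one update at a uniform
    site, but free of the probabilities of the outcomes. *)
Definition grad_energy f : R := mean [set: 'I_n] (fun v => nsq pi (flip_grad v f)).

Lemma nplus_true x v : x v = false -> nplus (set_spin x v true) = (nplus x).+1.
Proof.
move=> xv; rewrite /nplus (cardsD1 v) inE set_spinE eqxx add1n; congr _.+1.
apply: eq_card => w; rewrite !inE set_spinE.
by have [->|//] := eqVneq w v; rewrite xv.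
Qed.

Lemma grad_energy_sym (g : nat -> R) :
  \sum_(j < n.+1) occ j * ((n - j)%:R * (g j.+1 - g j) ^+ 2) <=
  n%:R * grad_energy (fun x => g (nplus x)).
Proof.
rewrite -(expect_nplus (fun j => (n - j)%:R * (g j.+1 - g j) ^+ 2)).
rewrite /grad_energy /mean cardsT card_ord mulrA mulfV // mul1r.
rewrite /nsq /dot /expect exchange_big /=; apply: ler_sum => x _.
rewrite -mulr_sumr ler_wpM2l ?pi_ge0 //.
have -> : (n - nplus x)%N = #|[set v | ~~ x v]|.
  rewrite /nplus -{1}(card_ord n) -(cardsC [set v | x v]) addKn.
  by apply: eq_card => v; rewrite !inE.
rewrite mulr_natl -sumr_const big_mkcond [leRHS](eq_bigl xpredT); last first.
  by move=> v; rewrite inE.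
apply: ler_sum => v _; rewrite inE; case: ifPn => [xv|_]; last first.
  by rewrite -expr2 sqr_ge0.
have x_set : set_spin x v false = x by rewrite -{2}(set_spin_id x v) (negbTE xv).
by rewrite /flip_grad nplus_true ?(negbTE xv) // x_set expr2.
Qed.

Lemma sum_sqr_le (I : finType) (S : {pred I}) (F : I -> R) :
  (\sum_(i in S) F i) ^+ 2 <= #|S|%:R * \sum_(i in S) F i ^+ 2.
Proof.
pose A := [set i in S].
have AE (G : I -> R) : \sum_(i in S) G i = \sum_(i in A) G i.
  by apply: eq_bigl => i; rewrite inE.
have -> : #|S| = #|A| by apply: eq_card => i; rewrite inE.
rewrite !AE; have [A0|A0] := posnP #|A|.
  by rewrite (eq_bigl xpred0) ?big_pred0_eq ?expr0n ?A0 ?mul0r // => i; rewrite (card0_eq A0).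
have Ap : 0 < #|A|%:R :> R by rewrite ltr0n.
have := mean_sqr_le A0 F; rewrite /mean exprMn => h.
rewrite -(ler_pM2l (exprn_gt0 2 (_ : 0 < #|A|%:R^-1))) ?invr_gt0 //.
by apply: le_trans h _; rewrite mulrA expr2 mulfVK // gt_eqF.
Qed.

(** Cauchy-Schwarz along the window: one factor [m] is the number of steps, the
    other the inverse of the occupation probabilities, up to a constant. *)
Lemma window_osc m (g : nat -> R) i j :
  (4 * m <= n)%N -> (0 < m)%N -> 160 * crit <= m%:R ^+ 2 ->
  window m i -> window m j ->
  (g i - g j) ^+ 2 <= 16 * m%:R ^+ 2 * expR (m%:R * step_cost m) *
     grad_energy (fun x => g (nplus x)).
Proof.
move=> mn m_gt0 mcrit; wlog ij : i j / (i <= j)%N.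
  move=> h wi wj; have [ij|/ltnW ji] := leqP i j; first exact: h.
  by rewrite -sqrrN opprB; exact: h.
move=> wi wj; set E := expR _; set G := grad_energy _.
have mn2 : (2 * m <= n)%N by lia.
have win l : (i <= l < j)%N -> window m l.
  by move: wi wj; rewrite /window => /andP[? ?] /andP[? ?] ?; apply/andP; lia.
have jn : (j <= n)%N by apply: window_le wj; lia.
pose S := [pred l : 'I_n.+1 | (i <= l < j)%N].
have telescope : g j - g i = \sum_(l in S) (g l.+1 - g l).
  rewrite -(telescope_sumr g ij) big_nat (big_nat_widen _ _ n.+1).
    rewrite (big_nat_widenl _ 0) // big_mkord; apply: eq_bigl => l.
    by rewrite inE; lia.
  exact: leq_trans jn (leqnSn n).
have cardS : (#|S| <= m)%N.
  apply: (@leq_trans (j - i)%N); last first.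
    by move: wi wj; rewrite /window => /andP[? ?] /andP[? ?]; lia.
  rewrite -sum1_card -[leqRHS]muln1 -sum_nat_const_nat.
  rewrite big_nat (big_nat_widen _ _ n.+1); last exact: leq_trans jn (leqnSn n).
  rewrite (big_nat_widenl _ 0) // big_mkord leq_eqVlt; apply/orP; left; apply/eqP.
  by apply: eq_bigl => l; rewrite inE; lia.
have n_gt : 0 < n%:R :> R by [].
(* In the window at least a quarter of the sites are minus, so that a step of [g]
   is seen by a fixed proportion of the one-site increments. *)
have occl (l : 'I_n.+1) : l \in S -> (g l.+1 - g l) ^+ 2 <=
   16 * m%:R * E / n%:R * (occ l * ((n - l)%:R * (g l.+1 - g l) ^+ 2)).
  rewrite inE => ilj; have wl := win l ilj.
  have := occ_ge mn2 m_gt0 mcrit wl; rewrite -/E.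
  have : n%:R <= 4 * (n - l)%:R :> R.
    by rewrite -natrM ler_nat; move: wl; rewrite /window => /andP[? ?]; lia.
  have := sqr_ge0 (g l.+1 - g l); move: ((g _ - _) ^+ 2) => q q0 nl o.
  have -> : 16 * m%:R * E / n%:R * (occ l * ((n - l)%:R * q)) =
    (4 * m%:R * E * occ l) * (4 * (n - l)%:R / n%:R) * q by field.
  rewrite -[leLHS]mul1r; apply: ler_wpM2r => //.
  rewrite -[leLHS]mul1r; apply: ler_pM => //.
  by rewrite ler_pdivlMr // mul1r.
rewrite -sqrrN opprB telescope; apply: le_trans (sum_sqr_le _ _) _.
have mE : 0 <= 16 * m%:R * E by rewrite !mulr_ge0 ?expR_ge0.
apply: (@le_trans _ _ (m%:R * (16 * m%:R * E / n%:R * (n%:R * G)))).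
  apply: ler_pM => //; first by apply: sumr_ge0 => l _; exact: sqr_ge0.
    by rewrite ler_nat.
  apply: le_trans (ler_sum _ occl) _.
  rewrite -mulr_sumr; apply: ler_wpM2l; first by rewrite divr_ge0.
  apply: le_trans (grad_energy_sym g); rewrite [leRHS](bigID (mem S)) /= lerDl.
  by apply: sumr_ge0 => l _; rewrite mulr_ge0 ?occ_ge0 // mulr_ge0 // sqr_ge0.
by rewrite le_eqVlt; apply/orP; left; apply/eqP; field.
Qed.

(** * Exchanging two sites *)

Definition swap_sites a b x : conf := [ffun v => x (tperm a b v)].

Definition antisym a b f : Prop :=
  (forall x, f (swap_sites a b x) = - f x).

Lemma swapK a b : involutive (swap_sites a b).
Proof. by move=> x; apply/ffunP => v; rewrite !ffunE tpermK. Qed.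

Lemma swap_set a b v (c : bool) x :
  swap_sites a b (set_spin x v c) = set_spin (swap_sites a b x) (tperm a b v) c.
Proof.
apply/ffunP => w; rewrite !ffunE.
by rewrite -(inj_eq (@perm_inj _ (tperm a b)) w) tpermK.
Qed.

Lemma total_spin_swap a b x : total_spin (swap_sites a b x) = total_spin x.
Proof.
rewrite /total_spin [RHS](reindex_inj (@perm_inj _ (tperm a b))) /=.
by apply: eq_bigr => v _; rewrite /spin ffunE.
Qed.

Lemma up_swap a b v x : up (tperm a b v) (swap_sites a b x) = up v x.
Proof. by rewrite !upE /field total_spin_swap /spin ffunE tpermK. Qed.

Lemma heat_swap a b v f x :
  heat (tperm a b v) f (swap_sites a b x) = heat v (fun y => f (swap_sites a b y)) x.
Proof. by rewrite /heat up_swap !swap_set. Qed.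

Lemma scan_swap a b s f x :
  scan (map (tperm a b) s) f (swap_sites a b x) = scan s (fun y => f (swap_sites a b y)) x.
Proof.
elim: s x => [|v s IH] x //=; rewrite heat_swap /=; congr (heat v _ x).
by apply/funext => y; rewrite IH.
Qed.

Lemma rscan_swap a b j f x :
  rscan j f (swap_sites a b x) = rscan j (fun y => f (swap_sites a b y)) x.
Proof.
have mapI : injective (fun s : j.-tuple 'I_n => [tuple of map (tperm a b) s]).
  move=> s t /(congr1 val) /= st; apply: val_inj.
  exact: (inj_map (@perm_inj _ (tperm a b))) st.
rewrite /rscan /mean (reindex_inj mapI) /=; congr (_ * _).
apply: eq_big => [s|s _]; last by rewrite /= scan_swap.
by rewrite !inE map_inj_uniq //; exact: perm_inj.
Qed.

Lemma antisym_rscan a b j f : antisym a b f -> antisym a b (rscan j f).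
Proof.
move=> af x; rewrite rscan_swap /rscan /mean -mulrN -sumrN; congr (_ * _).
apply: eq_bigr => s _; have aS := averaging_scan s.
rewrite -mulN1r -(avgZ aS); congr (scan s _ x).
by apply/funext => y; rewrite af mulN1r.
Qed.

Lemma antisym_heat a b v f :
  v != a -> v != b -> antisym a b f -> antisym a b (heat v f).
Proof.
move=> va vb af x; rewrite -{1}(tpermD (x := a) (y := b) (z := v)) 1?eq_sym // heat_swap.
have aH := averaging_heat v.
rewrite -mulN1r -(avgZ aH); congr (heat v _ x).
by apply/funext => y; rewrite af mulN1r.
Qed.

Lemma antisym_scan a b s f : a \notin s -> b \notin s ->
  antisym a b f -> antisym a b (scan s f).
Proof.
elim: s => [|v s IH] //=; rewrite !inE !negb_or => /andP[av as_] /andP[bv bs] af.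
by apply: antisym_heat; rewrite 1?eq_sym //; exact: IH.
Qed.

Lemma antisym_diag a b f x : antisym a b f -> x a = x b -> f x = 0.
Proof.
move=> af xab; have : f x = - f x.
  rewrite -{1}(_ : swap_sites a b x = x) //; apply/ffunP => v; rewrite ffunE.
  by case: tpermP => // ->.
by move=> ?; lra.
Qed.

Lemma antisymC a b f : antisym a b f -> antisym b a f.
Proof. by move=> af x; rewrite -af; congr f; apply/ffunP => v; rewrite !ffunE tpermC. Qed.

(** One of the two outcomes of the update at [a] makes the spins at [a] and [b]
    agree, and there [f] vanishes. *)
Lemma heat_antisym_le a b f M x : a != b -> antisym a b f ->
  (forall y, `|f y| <= M) -> `|heat a f x| <= (1 - pmin) * M.
Proof.
move=> ab af fM; rewrite /heat.
have p0 := pmin_gt0; have /andP[u1 u2] := up_range a x; set u := up a x in u1 u2 *.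
have M0 : 0 <= M := le_trans (normr_ge0 (f x)) (fM x).
have f0 : f (set_spin x a (x b)) = 0.
  by apply: (antisym_diag af); rewrite !set_spinE eqxx eq_sym (negbTE ab).
case xb : (x b) f0 => ->; rewrite mulr0 ?addr0 ?add0r normrM.
  by apply: ler_pM => //; rewrite ger0_norm; lra.
by apply: ler_pM => //; rewrite ger0_norm; lra.
Qed.

(** At the last visit to [a] or [b] the rest of the scan avoids both sites and
    hence keeps the antisymmetry, so [heat_antisym_le] applies there; the earlier
    updates only average. *)
Lemma scan_antisym_le a b s f M x : a != b -> antisym a b f ->
  (forall y, `|f y| <= M) -> a \in s -> `|scan s f x| <= (1 - pmin) * M.
Proof.
move=> ab af fM; have M0 : 0 <= M := le_trans (normr_ge0 (f x)) (fM x).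
have p0 := pmin_gt0; have p1 := pmin_le1.
suff h : (a \in s) || (b \in s) -> forall x, `|scan s f x| <= (1 - pmin) * M.
  by move=> as_; apply: h; rewrite as_.
elim: s => [|v s IH] // vs.
case: (boolP ((a \in s) || (b \in s))) => [abs|].
  by apply: (avg_norm_le (averaging_heat v)); exact: IH.
rewrite negb_or => /andP[as_ bs] y /=.
have aS := antisym_scan as_ bs af.
have sM : forall z, `|scan s f z| <= M by exact: (avg_norm_le (averaging_scan s)).
have : (v == a) || (v == b).
  by move: vs; rewrite !inE (negbTE as_) (negbTE bs) !orbF !(eq_sym v).
case/orP => /eqP ->; first exact: (heat_antisym_le _ ab).
by apply: (@heat_antisym_le b a); rewrite 1?eq_sym //; exact: antisymC.
Qed.

Lemma card_utuples_mem a j : (j <= n)%N ->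
  (n * #|[set s in utuples j | a \in s]|)%N = (j * #|utuples j|)%N.
Proof.
move=> jn; have : (#|[set s in utuples j | a \in s]| + #|utuples_avoid a j| = #|utuples j|)%N.
  rewrite -(cardsID [set s : j.-tuple 'I_n | a \in s] (utuples j)); congr addn.
    by apply: eq_card => s; rewrite !inE.
  by apply: eq_card => s; rewrite !inE /= andbC.
rewrite card_utuples_avoid card_utuples => e.
have : (n * n.-1 ^_ j = (n - j) * n ^_ j)%N.
  by rewrite -ffactnS ffactnSr mulnC.
by rewrite -{1}e mulnBl => h; nia.
Qed.

(** A scan visits [a] with probability [k / n]. *)
Lemma rscan_antisym_le a b k f M : (k <= n)%N -> a != b -> antisym a b f ->
  (forall y, `|f y| <= M) ->
  forall x, `|rscan k f x| <= (1 - pmin * k%:R / n%:R) * M.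
Proof.
move=> kn ab af fM x; have M0 : 0 <= M := le_trans (normr_ge0 (f x)) (fM x).
apply: le_trans (ler_norm_mean _ _) _.
have Up : 0 < #|utuples k|%:R :> R by rewrite ltr0n utuples_gt0.
apply: (@le_trans _ _ (mean (utuples k)
    (fun s => M - pmin * M * (a \in s)%:R))).
  apply: ler_mean => s _; case: (boolP (a \in s)) => as_.
    by apply: le_trans (scan_antisym_le x ab af fM as_) _; rewrite mulr1; lra.
  by rewrite mulr0 subr0; exact: (avg_norm_le (averaging_scan s)).
rewrite meanB mean_cst ?utuples_gt0 //.
have -> : mean (utuples k) (fun s => pmin * M * (a \in s)%:R) =
    pmin * M * (k%:R / n%:R).
  rewrite /mean -mulr_sumr mulrCA; congr (_ * _).
  have -> : \sum_(s in utuples k) (a \in s)%:R =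
      #|[set s in utuples k | a \in s]|%:R :> R.
    rewrite -sum1_card natr_sum [RHS]big_mkcond [LHS]big_mkcond.
    by apply: eq_bigr => s _; rewrite !inE; case: (uniq s); case: (a \in s).
  apply: (mulfI (mulf_neq0 (lt0r_neq0 np) (lt0r_neq0 Up))).
  have := congr1 (fun m : nat => m%:R : R) (card_utuples_mem a kn).
  rewrite !natrM; move: (#|_|%:R) (#|_|%:R) Up => A U Up e.
  have -> : n%:R * U * (U^-1 * A) = n%:R * A by field; rewrite gt_eqF.
  by rewrite e; field.
by rewrite le_eqVlt; apply/orP; left; apply/eqP; ring.
Qed.

Lemma iter_rscan_antisym_le a b k t f M : (k <= n)%N -> a != b ->
  antisym a b f -> (forall y, `|f y| <= M) ->
  forall x, `|iter t (rscan k) f x| <= (1 - pmin * k%:R / n%:R) ^+ t * M.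
Proof.
move=> kn ab af fM.
suff : antisym a b (iter t (rscan k) f) /\
  forall x, `|iter t (rscan k) f x| <= (1 - pmin * k%:R / n%:R) ^+ t * M by case.
elim: t => [|t [IHa IH]]; first by split=> // x; rewrite mul1r.
split; first exact: antisym_rscan.
move=> x; rewrite exprS -mulrA; exact: (rscan_antisym_le kn ab IHa IH).
Qed.

Lemma iter_rscan_swap a b k t f x :
  iter t (rscan k) f (swap_sites a b x) = iter t (rscan k) (fun y => f (swap_sites a b y)) x.
Proof.
elim: t x => [|t IH] x //; rewrite !iterS rscan_swap; congr (rscan k _ x).
by apply/funext => y; rewrite IH.
Qed.

(** Exchanging a site that is plus only in [x] with one that is plus only in [y]
    lowers the number of disagreements, so at most [n] exchanges are needed. *)
Lemma swap_dist f (e : R) x y : 0 <= e ->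
  (forall a b z, `|f (swap_sites a b z) - f z| <= e) ->
  nplus x = nplus y -> `|f x - f y| <= n%:R * e.
Proof.
move=> e0 fe.
pose D x y := #|[set v | x v != y v]|.
have Dn (u w : conf) : (D u w <= n)%N by rewrite -[leqRHS]card_ord max_card.
suff h m : forall x, (D x y <= m)%N -> nplus x = nplus y -> `|f x - f y| <= m%:R * e.
  exact: h (Dn x y).
elim: m => [|m IH] {}x Dm xy.
  suff -> : x = y by rewrite subrr normr0 mulr_ge0.
  apply/ffunP => v; apply/eqP; rewrite -[_ == _]negbK; apply/negP => xyv.
  by move: Dm; rewrite leqn0 cards_eq0 => /eqP/setP/(_ v); rewrite !inE xyv.
have [D0|D0] := posnP (D x y).
  by apply: le_trans (IH x _ xy) _; rewrite ?D0 // ler_wpM2r // ler_nat.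
pose A := [set v | x v]; pose B := [set v | y v].
have AB : #|A| = #|B| by exact: xy.
have AnB : A != B.
  apply: contraTneq D0 => AB'; rewrite -leqNgt leqn0 cards_eq0; apply/eqP/setP => v.
  by have /setP/(_ v) := AB'; rewrite !inE => ->; rewrite eqxx.
have /subsetPn [a aA aB] : ~~ (A \subset B).
  by apply: contra AnB => sAB; rewrite eqEcard sAB AB /=.
have /subsetPn [b bB bA] : ~~ (B \subset A).
  by apply: contra AnB => sBA; rewrite eq_sym eqEcard sBA AB /=.
move: aA aB bA bB; rewrite !inE => xa /negbTE ya /negbTE xb yb.
pose x' := swap_sites a b x.
have ab : a != b by apply: contraTneq xa => ->; rewrite xb.
have x'y : nplus x' = nplus y.
  apply/eqP; rewrite -(eqr_nat R); have := total_spin_swap a b x.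
  by rewrite !total_spinE -xy => ?; apply/eqP; lra.
have Dx' : (D x' y <= m)%N.
  rewrite -ltnS; apply: leq_trans Dm; apply: proper_card; apply/properP; split.
    apply/fintype.subsetP => v; rewrite !inE ffunE.
    by case: tpermP => [->|->|//]; rewrite ?xa ?xb ?ya ?yb.
  by exists a; rewrite !inE; [rewrite xa ya | rewrite ffunE tpermL xb ya].
have -> : f x - f y = - (f x' - f x) + (f x' - f y) by ring.
rewrite -natr1 mulrDl mul1r addrC; apply: le_trans (ler_normD _ _) _.
by apply: lerD; [exact: IH | rewrite normrN; exact: fe].
Qed.

Definition rep (j : nat) : conf := [ffun v : 'I_n => (v < j)%N].

Lemma nplus_rep j : (j <= n)%N -> nplus (rep j) = j.
Proof.
move=> jn; rewrite /nplus -[RHS](card_ord j).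
rewrite -(card_imset _ (f := widen_ord jn)); last first.
  by move=> u v /(congr1 val) uv; exact: val_inj.
apply: eq_card => v; rewrite !inE ffunE; apply/idP/imsetP => [vj|[u _ ->]] //=.
by exists (Ordinal vj) => //; exact: val_inj.
Qed.

Definition symm f x : R := f (rep (nplus x)).

(** The increment of [f] along an exchange of two sites is antisymmetric, hence
    decays by [iter_rscan_antisym_le], and at most [n] exchanges lead from a
    configuration to its representative. *)
Lemma symm_close k t f x : (k <= n)%N -> (forall y, 0 <= f y <= 1) ->
  `|iter t (rscan k) f x - symm (iter t (rscan k) f) x| <=
  n%:R * (1 - pmin * k%:R / n%:R) ^+ t.
Proof.
move=> kn f01; rewrite /symm.
have q0 : 0 <= 1 - pmin * k%:R / n%:R.
  rewrite subr_ge0 ler_pdivrMr // mul1r; have : k%:R <= n%:R :> R by rewrite ler_nat.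
  apply: le_trans; rewrite ler_piMl // pmin_le1 //.
apply: swap_dist; first exact: exprn_ge0.
  move=> a b z; have [<-|ab] := eqVneq a b.
    rewrite (_ : swap_sites a a z = z) ?subrr ?normr0 ?exprn_ge0 //.
    by apply/ffunP => v; rewrite ffunE tperm1 perm1.
  rewrite iter_rscan_swap.
  have aT := averaging_iter t (averaging_rscan kn).
  rewrite -[_ - _](avgB aT (fun y => f (swap_sites a b y)) f z).
  rewrite -[leRHS]mulr1; apply: (@iter_rscan_antisym_le a b k t
    (fun y => f (swap_sites a b y) - f y) 1 kn ab) => y.
    by rewrite swapK opprB.
  have := f01 (swap_sites a b y); have := f01 y => /andP[? ?] /andP[? ?].
  by rewrite ler_norml; apply/andP; split; lra.
by rewrite nplus_rep // nplus_le.
Qed.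

Definition symmetric f : Prop := forall x, f x = f (rep (nplus x)).

Lemma symmetric_swap f : (forall a b x, f (swap_sites a b x) = f x) -> symmetric f.
Proof.
move=> fs x; apply/eqP; rewrite -subr_eq0 -normr_le0 -(mulr0 n%:R).
apply: swap_dist => // [a b z|]; first by rewrite fs subrr normr0.
by rewrite nplus_rep // nplus_le.
Qed.

Lemma nplus_swap a b x : nplus (swap_sites a b x) = nplus x.
Proof.
apply/eqP; rewrite -(eqr_nat R); have := total_spin_swap a b x.
by rewrite !total_spinE => ?; apply/eqP; lra.
Qed.

Lemma symmetric_rscan j f : symmetric f -> symmetric (rscan j f).
Proof.
move=> fs; apply: symmetric_swap => a b x; rewrite rscan_swap; congr (rscan j _ x).
by apply/funext => y; rewrite fs nplus_swap -fs.
Qed.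

Lemma symmetric_iter_rscan k t f : symmetric f -> symmetric (iter t (rscan k) f).
Proof. by move=> fs; elim: t => //= t IH; exact: symmetric_rscan. Qed.

Lemma symmetric_symm f : symmetric (symm f).
Proof. by move=> x; rewrite /symm nplus_rep // nplus_le. Qed.

(** * Dissipation inside a scan *)

(** Pythagoras for the orthogonal projection [heat v]. *)
Lemma nsq_heat v f : nsq pi f - nsq pi (heat v f) = nsq pi (fun x => f x - heat v f x).
Proof.
rewrite nsqB heat_selfadjoint.
have -> : dot pi (heat v f) f = nsq pi (heat v f).
  by rewrite /nsq heat_selfadjoint heat_idem.
by ring.
Qed.

Lemma heat_grad v f x : pmin ^+ 2 * flip_grad v f x ^+ 2 <= (f x - heat v f x) ^+ 2.
Proof.
have p0 := pmin_gt0; have /andP[u1 u2] := up_range v x.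
rewrite /heat /flip_grad -{3}(set_spin_id x v); set u := up v x in u1 u2 *.
set a := f (set_spin x v true); set c := f (set_spin x v false).
have -> : f (set_spin x v (x v)) - (u * a + (1 - u) * c) =
   (if x v then 1 - u else - u) * (a - c).
  by rewrite /a /c; case: (x v); ring.
rewrite exprMn; apply: ler_wpM2r; first exact: sqr_ge0.
case: (x v); rewrite ?sqrrN lerXn2r ?nnegrE //; lra.
Qed.

Lemma nsq_grad v f :
  pmin ^+ 2 * nsq pi (flip_grad v f) <= nsq pi f - nsq pi (heat v f).
Proof.
rewrite nsq_heat /nsq /dot /expect mulr_sumr; apply: ler_sum => x _.
by rewrite mulrCA ler_wpM2l ?pi_ge0 // -!expr2 heat_grad.
Qed.

(** The square norm after [j] of the sites of a scan; the mean over the orderings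
    is taken outside the norm, so that a stage can be compared with the next. *)
Definition scan_nsq (j : nat) f : R := mean (utuples j) (fun s => nsq pi (scan s f)).

Lemma nsq_mean_le (I : finType) (S : {set I}) (F : I -> conf -> R) :
  (0 < #|S|)%N -> nsq pi (fun x => mean S (fun i => F i x)) <= mean S (fun i => nsq pi (F i)).
Proof.
move=> S0; rewrite /nsq dot_mean.
have -> : mean S (fun i => dot pi (F i) (F i)) =
   expect pi (fun x => mean S (fun i => F i x ^+ 2)).
  have aE := averaging_expect pi_ge0 pi_one; have x0 : conf := [ffun=> true].
  rewrite (avg_mean aE _ _ x0); apply: eq_mean => i _.
  by apply: eq_bigr => x _; rewrite expr2.
rewrite -dot_mean; apply: (le_expect pi_ge0) => x; rewrite -expr2; exact: mean_sqr_le.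
Qed.

Lemma mean_utuples_avoid j (F : seq 'I_n -> R) : (j < n)%N ->
  mean (utuples j) F = mean [set: 'I_n] (fun v => mean (utuples_avoid v j) F).
Proof.
move=> jn; rewrite -(mean_utuplesS (fun s => F (behead s)) jn).
rewrite (mean_utuplesS_tail (fun s => F (behead s)) jn) /=.
apply: eq_mean => s; rewrite inE => us; rewrite mean_cst //.
by rewrite card_sites_avoid // size_tuple subn_gt0.
Qed.

(** Updating one more site [v] loses the part of the scanned functions that
    depends on the spin at [v]; averaging over the scans that avoid [v] first
    only decreases it. *)
Lemma scan_nsq_step j f : (j < n)%N ->
  pmin ^+ 2 * mean [set: 'I_n] (fun v => nsq pi (flip_grad v (rscan_avoid v j f)))
  <= scan_nsq j f - scan_nsq j.+1 f.
Proof.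
move=> jn; rewrite /scan_nsq (mean_utuplesS (fun s => nsq pi (scan s f)) jn).
rewrite (mean_utuples_avoid (fun s => nsq pi (scan s f)) jn) -meanB.
rewrite -[leLHS]addr0 -(mean_cst sites_gt0 0) -mean_lin.
apply: ler_mean => v _; rewrite addr0 -meanB.
have A0 := utuples_avoid_gt0 v jn.
apply: (@le_trans _ _ (mean (utuples_avoid v j)
    (fun s => pmin ^+ 2 * nsq pi (flip_grad v (scan s f)) + 0))).
  rewrite mean_lin mean_cst // addr0 ler_wpM2l ?sqr_ge0 //.
  apply: le_trans (nsq_mean_le (fun (s : j.-tuple 'I_n) x => flip_grad v (scan s f) x) A0).
  rewrite le_eqVlt; apply/orP; left; apply/eqP; congr (nsq pi _).
  by apply/funext => x; rewrite meanB.
by apply: ler_mean => s _; rewrite addr0 /=; exact: nsq_grad.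
Qed.

Lemma scan_nsq_mono i j f : (i <= j <= n)%N -> scan_nsq j f <= scan_nsq i f.
Proof.
move=> /andP[ij]; rewrite -(subnK ij) addnC; elim: (j - i)%N => [|d IH]; first by rewrite addn0.
rewrite addnS => idn; apply: le_trans (IH (ltnW idn)).
rewrite -subr_ge0; apply: le_trans (scan_nsq_step f idn).
rewrite mulr_ge0 ?sqr_ge0 // mulr_ge0 ?invr_ge0 // sumr_ge0 // => v _.
exact: nsq_ge0 pi_ge0 _.
Qed.

Lemma scan_nsq0 f : scan_nsq 0 f = nsq pi f.
Proof.
rewrite -[RHS](mean_cst (utuples_gt0 (leq0n n))); apply: eq_mean => s _.
by rewrite (tuple0 s).
Qed.

Lemma nsq_rscan_le k f : (k <= n)%N -> nsq pi (rscan k f) <= scan_nsq k f.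
Proof. by move=> kn; apply: nsq_mean_le; exact: utuples_gt0. Qed.

(** A scan of length [j] visits [v] with probability [j / n]. *)
Lemma rscan_avoid_close j v f x : (j < n)%N -> (forall y, 0 <= f y <= 1) ->
  `|rscan j f x - rscan_avoid v j f x| <= j%:R / n%:R.
Proof.
move=> jn f01; rewrite /rscan /rscan_avoid /mean.
have jR : j%:R <= n%:R :> R by rewrite ler_nat ltnW.
pose F (s : seq 'I_n) := scan s f x.
have F01 s : 0 <= F s <= 1 by exact: (avg_range (averaging_scan s)).
rewrite (bigID (fun s : j.-tuple 'I_n => v \in s)) /=.
have -> : \sum_(s in utuples j | v \notin s) F s = \sum_(s in utuples_avoid v j) F s.
  by apply: eq_bigl => s; rewrite !inE /= andbC.
set A : R := #|utuples_avoid v j|%:R; set U : R := #|utuples j|%:R.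
have Ap : 0 < A by rewrite ltr0n utuples_avoid_gt0.
have Up : 0 < U by rewrite ltr0n utuples_gt0 // ltnW.
have AU : A = U * (1 - j%:R / n%:R).
  have : n%:R * A = U * (n%:R - j%:R).
    rewrite -natrB ?(ltnW jn) // -!natrM card_utuples card_utuples_avoid.
    by rewrite -ffactnS ffactnSr.
  by move=> e; apply: (mulfI n0); rewrite e; field.
have cmem : \sum_(s in utuples j | v \in s) 1 = U - A :> R.
  have -> : U = \sum_(s in utuples j) 1 by rewrite sumr_const.
  rewrite [in RHS](bigID (fun s : j.-tuple 'I_n => v \in s)) /=.
  rewrite (_ : A = \sum_(s in utuples j | v \notin s) 1) ?addrK //.
  rewrite /A -sum1_card natr_sum; apply: eq_bigl => s.
  by rewrite !inE /= andbC.
have h1 : 0 <= \sum_(s in utuples j | v \in s) F s <= U - A.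
  rewrite -cmem sumr_ge0 /=; last by move=> s _; have /andP[] := F01 s.
  by apply: ler_sum => s _; have /andP[] := F01 s.
have h2 : 0 <= \sum_(s in utuples_avoid v j) F s <= A.
  rewrite sumr_ge0 /=; last by move=> s _; have /andP[] := F01 s.
  have -> : A = \sum_(s in utuples_avoid v j) 1 by rewrite sumr_const.
  by apply: ler_sum => s _; have /andP[] := F01 s.
move: h1 h2; set B := \sum_(s in _ | _) _; set C := \sum_(s in _) _.
move=> /andP[B0 B1] /andP[C0 C1].
have -> : U^-1 * (B + C) - A^-1 * C = B / U - (C / A) * (j%:R / n%:R).
  have A' : U * (1 - j%:R / n%:R) != 0 by rewrite -AU gt_eqF.
  have nj : n%:R - j%:R != 0 :> R.
    by rewrite subr_eq0 eqr_nat gtn_eqF.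
  by rewrite AU; field; rewrite nj n0 gt_eqF.
have jn0 : 0 <= j%:R / n%:R :> R by rewrite divr_ge0.
have b1 : B / U <= j%:R / n%:R.
  rewrite ler_pdivrMr //; apply: le_trans B1 _; rewrite AU.
  by rewrite le_eqVlt; apply/orP; left; apply/eqP; ring.
have b0 : 0 <= B / U by rewrite divr_ge0 // ltW.
have c1 : C / A <= 1 by rewrite ler_pdivrMr // mul1r.
have c0 : 0 <= C / A by rewrite divr_ge0 // ltW.
have c2 : C / A * (j%:R / n%:R) <= j%:R / n%:R by rewrite ler_piMl.
have c3 : 0 <= C / A * (j%:R / n%:R) by rewrite mulr_ge0.
by rewrite ler_norml; apply/andP; split; lra.
Qed.

(** [scan_nsq_step] controls the scans that avoid the site of the increment; by
    [rscan_avoid_close] passing to all scans costs [j / n] for each value. *)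
Lemma grad_energy_rscan j f : (j < n)%N -> (forall y, 0 <= f y <= 1) ->
  pmin ^+ 2 * grad_energy (rscan j f) <=
  2 * (scan_nsq j f - scan_nsq j.+1 f) + 8 * (j%:R / n%:R) ^+ 2.
Proof.
move=> jn f01; have := scan_nsq_step f jn.
set W := mean _ _ => hW.
have h : grad_energy (rscan j f) <= 2 * W + 8 * (j%:R / n%:R) ^+ 2.
  rewrite -[X in _ + X](mean_cst sites_gt0) -mean_lin; apply: ler_mean => v _.
  have x0 : conf := [ffun=> true].
  set e := _ ^+ 2; rewrite /nsq /dot.
  rewrite -(expect_cst pi_one (8 * e)) -expect_lin; apply: (le_expect pi_ge0) => x.
  have c1 := rscan_avoid_close v (set_spin x v true) jn f01.
  have c2 := rscan_avoid_close v (set_spin x v false) jn f01.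
  rewrite /flip_grad; move: c1 c2.
  move: (rscan j f _) (rscan j f _) (rscan_avoid v j f _) (rscan_avoid v j f _).
  rewrite /e; have : 0 <= j%:R / n%:R :> R by rewrite divr_ge0.
  move: (j%:R / n%:R) => d d0 p q p' q'; rewrite !ler_norml.
  move=> /andP[? ?] /andP[? ?].
  have : (p - q - (p' - q')) ^+ 2 <= (2 * d) ^+ 2.
    rewrite -(real_normK (num_real (p - q - _))) lerXn2r ?nnegrE ?mulr_ge0 //.
    by rewrite ler_norml; apply/andP; split; lra.
  have := sqr_ge0 (p - q - 2 * (p' - q')).
  by rewrite !expr2 => ? ?; nra.
have p0 := pmin_gt0; have p1 := pmin_le1.
have p2 : pmin ^+ 2 <= 1 by rewrite exprn_ile1 // ltW.
have := ler_wpM2l (sqr_ge0 pmin) h; have := sqr_ge0 (j%:R / n%:R : R).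
move: (pmin ^+ 2) ((j%:R / n%:R) ^+ 2) hW p2 => P e hW p2 e0; nra.
Qed.

(** The first site of a scan is uniform, and the condition that the others avoid
    it matters with probability [j / n]. *)
Lemma rscan_glauber_step j f x : (j < n)%N -> (forall y, 0 <= f y <= 1) ->
  `|rscan j.+1 f x - glauber (rscan j f) x| <= j%:R / n%:R.
Proof.
move=> jn f01.
rewrite /rscan (mean_utuplesS (fun s => scan s f x) jn) /glauber -meanB.
apply: le_trans (ler_norm_mean _ _) _.
rewrite -[leRHS](mean_cst sites_gt0); apply: ler_mean => v _ /=.
rewrite -(avg_mean (averaging_heat v)) distrC.
by apply: (avg_dist_le (averaging_heat v)) => y; exact: rscan_avoid_close.
Qed.

Lemma rscan_glauber j i f x : (j + i <= n)%N -> (forall y, 0 <= f y <= 1) ->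
  `|rscan (j + i) f x - iter i glauber (rscan j f) x| <= i%:R * ((j + i)%:R / n%:R).
Proof.
move=> jin f01; elim: i x jin => [|i IH] x jin.
  by rewrite addn0 subrr normr0 mul0r.
have jin' : (j + i < n)%N by rewrite -addnS.
have h1 := rscan_glauber_step x jin' f01.
have h2 : `|glauber (rscan (j + i) f) x - glauber (iter i glauber (rscan j f)) x|
    <= i%:R * ((j + i)%:R / n%:R).
  by apply: (avg_dist_le averaging_glauber) => y; apply: IH; exact: ltnW.
rewrite addnS iterS; set z := glauber (rscan _ _) x in h1 h2.
have -> : rscan (j + i).+1 f x - glauber (iter i glauber (rscan j f)) x =
  (rscan (j + i).+1 f x - z) + (z - glauber (iter i glauber (rscan j f)) x) by ring.
apply: le_trans (ler_normD _ _) _.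
have h3 : (j + i)%:R / n%:R <= (j + i).+1%:R / n%:R :> R.
  by rewrite ler_wpM2r ?invr_ge0 // ler_nat.
have h4 : i%:R * ((j + i)%:R / n%:R) <= i%:R * ((j + i).+1%:R / n%:R) :> R.
  by rewrite ler_wpM2l.
by rewrite -[i.+1%:R]natr1 mulrDl mul1r; lra.
Qed.

(** By Jensen the stages together dissipate at most what the whole scan does, so
    one of them dissipates at most a [k]-th of it. *)
Lemma scan_nsq_pigeonhole k f : (0 < k <= n)%N ->
  exists2 j, (j < k)%N & k%:R * (scan_nsq j f - scan_nsq j.+1 f) <=
    nsq pi f - nsq pi (rscan k f).
Proof.
move=> /andP[k0 kn].
pose D j := scan_nsq j f - scan_nsq j.+1 f.
have [j _ jmin] := @arg_minP _ _ _ (Ordinal k0) xpredT (fun j : 'I_k => D j) isT.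
exists j => //; rewrite -/(D j).
apply: (@le_trans _ _ (\sum_(i < k) D i)).
  have -> : k%:R * D j = \sum_(i < k) D j by rewrite sumr_const card_ord mulr_natl.
  by apply: ler_sum => i _; exact: jmin.
rewrite -(big_mkord xpredT D) /D.
have -> : \sum_(0 <= i < k) (scan_nsq i f - scan_nsq i.+1 f) = scan_nsq 0 f - scan_nsq k f.
  rewrite -[RHS]opprB -(telescope_sumr (scan_nsq^~ f) (leq0n k)) -sumrN.
  by apply: eq_bigr => i _; rewrite opprB.
by rewrite scan_nsq0 lerD2l lerN2 nsq_rscan_le.
Qed.

(** * The bounds for a fixed chain *)

(** Seen from the function, [t1] scans make [f] nearly symmetric, [t2] scans make
    the dissipation small, one scan is interrupted at a stage [j] where the
    function [G] is nearly constant on the window and completed by independent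
    updates, and [t3] scans bring the chain into the window. The four errors
    are, in order, those of the symmetrization, of the independent completion,
    the oscillation of [G] in the window and the escape from it. *)
Lemma rscan_nearly_constant k m t1 t2 t3 (eta : R) f :
  (0 < k)%N -> (2 * k <= n)%N -> (k ^ 4 <= n)%N ->
  (4 * m <= n)%N -> (0 < m)%N -> 160 * crit <= m%:R ^+ 2 ->
  2 * crit <= t3%:R * k%:R -> 0 <= eta ->
  16 * m%:R ^+ 2 * expR (m%:R * step_cost m) *
    (2 / (k%:R * t2.+1%:R) + 8 * (k%:R / n%:R) ^+ 2) <= pmin ^+ 2 * eta ^+ 2 ->
  (forall y, 0 <= f y <= 1) ->
  exists c, forall x, `|iter (t3 + (1 + (t2 + t1))) (rscan k) f x - c| <=
    n%:R * (1 - pmin * k%:R / n%:R) ^+ t1 + k%:R ^+ 2 / n%:R + eta +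
    (600 * crit + 100 * k%:R) / m%:R ^+ 2.
Proof.
move=> k0 k2 k4 m4 m0 mcrit t3k eta0 etaP f01.
have kn : (k <= n)%N by apply: leq_trans k2; rewrite leq_pmull.
have kp : 0 < k%:R :> R by rewrite ltr0n.
have p0 := pmin_gt0.
have avP := averaging_rscan kn.
have avPt t := averaging_iter t avP.
pose f1 := iter t1 (rscan k) f; pose fs := symm f1.
have f1_01 x : 0 <= f1 x <= 1 by exact: (avg_range (avPt t1)).
have fs01 x : 0 <= fs x <= 1 by exact: f1_01.
have close1 x : `|f1 x - fs x| <= n%:R * (1 - pmin * k%:R / n%:R) ^+ t1.
  exact: symm_close.
pose g := iter t2 (rscan k) fs.
have g01 x : 0 <= g x <= 1 by exact: (avg_range (avPt t2)).
have gsym : symmetric g by apply: symmetric_iter_rscan; exact: symmetric_symm.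
have [j jk jE] := @scan_nsq_pigeonhole k g (etrans (congr2 andb k0 kn) erefl).
have jn : (j < n)%N by exact: leq_trans jk kn.
pose G := rscan j g.
have G01 x : 0 <= G x <= 1 by exact: (avg_range (averaging_rscan (ltnW jn))).
have Gsym : symmetric G by exact: symmetric_rscan.
have GE : G = (fun x => G (rep (nplus x))) by apply/funext => x; exact: Gsym.
have energy : pmin ^+ 2 * grad_energy G <=
    2 / (k%:R * t2.+1%:R) + 8 * (k%:R / n%:R) ^+ 2.
  apply: le_trans (grad_energy_rscan jn g01) _; apply: lerD.
    have := dirichlet_decay pi_ge0 (@rscan_selfadjoint k) fs t2.
    rewrite -/g => /(le_trans jE) h; rewrite ler_wpM2l //.
    rewrite invfM -ler_pdivrMl ?invr_gt0 // invrK; apply: le_trans h _.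
    rewrite ler_pdivrMr ?ltr0n // mulVf ?pnatr_eq0 //.
    rewrite -[leRHS](expr1n R 2); apply: (nsq_le_cst pi_ge0 pi_one) => // x.
    by have /andP[? ?] := fs01 x; rewrite ger0_norm.
  rewrite ler_wpM2l // lerXn2r ?nnegrE ?divr_ge0 //.
  by rewrite ler_wpM2r ?invr_ge0 // ler_nat ltnW.
have osc i l : window m i -> window m l -> `|G (rep i) - G (rep l)| <= eta.
  move=> wi wl; have := window_osc (fun i => G (rep i)) m4 m0 mcrit wi wl.
  rewrite -GE => h.
  rewrite -(ler_pXn2r (ltn0Sn 1)) ?nnegrE // (real_normK (num_real _)).
  rewrite -(ler_pM2l (exprn_gt0 2 p0)); apply: le_trans etaP.
  apply: le_trans (ler_wpM2l (sqr_ge0 pmin) h) _; rewrite mulrCA.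
  apply: ler_wpM2l; last exact: energy.
  by rewrite mulr_ge0 ?expR_ge0 // mulr_ge0 // sqr_ge0.
pose w := (n %/ 2)%N; have ww : window m w by exact: window_half.
pose c := G (rep w).
pose far x : R := (m%:R ^+ 2 < sqspin x)%R%:R.
have near x : `|G x - c| <= eta + far x.
  rewrite /far; case: ltP => h.
    have /andP[? ?] := G01 x; have /andP[? ?] := G01 (rep w).
    have -> : true%:R = 1 :> R by [].
    by rewrite ler_norml /c; apply/andP; split; lra.
  by rewrite addr0 Gsym /c; apply: osc => //; rewrite window_spin.
pose i := (k - j)%N; have ijk : (j + i)%N = k by rewrite subnKC // ltnW.
pose S h := iter t3 (rscan k) (iter i glauber h).
have avQ := averaging_iter i averaging_glauber.
have avS : averaging S by exact: averaging_comp (avPt t3) avQ.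
have Ssq x : S sqspin x <= 600 * crit + 100 * k%:R.
  apply: (@le_trans _ _ (iter t3 (rscan k) (fun y => sqspin y + 100 * i%:R) x)).
    by apply: (avg_le (avPt t3)) => y; exact: glauber_iter_drift.
  rewrite (avgD (avPt t3)) (avg_cst (avPt t3)); apply: lerD; first exact: burn_in.
  by rewrite ler_wpM2l // ler_nat leq_subr.
have m2 : 0 < m%:R ^+ 2 :> R by rewrite exprn_gt0 ?ltr0n.
have close3 x : `|S G x - c| <= eta + (600 * crit + 100 * k%:R) / m%:R ^+ 2.
  rewrite -(avg_cst avS c x) -(avgB avS); apply: le_trans (avg_norm avS _ _) _.
  apply: le_trans (avg_le avS near x) _; rewrite (avgD avS) (avg_cst avS) lerD2l.
  exact: avg_far_le.
have close2 x : `|rscan k g x - iter i glauber G x| <= k%:R ^+ 2 / n%:R.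
  have h := @rscan_glauber j i g x; rewrite ijk in h.
  apply: le_trans (h kn g01) _; rewrite expr2 -mulrA ler_wpM2r ?divr_ge0 //.
  by rewrite ler_nat leq_subr.
exists c => x; rewrite !iterD -/f1.
have d1 y : `|iter t2 (rscan k) f1 y - g y| <= n%:R * (1 - pmin * k%:R / n%:R) ^+ t1.
  exact: (avg_dist_le (avPt t2)).
have d2 y : `|iter 1 (rscan k) (iter t2 (rscan k) f1) y - rscan k g y| <=
    n%:R * (1 - pmin * k%:R / n%:R) ^+ t1.
  exact: (avg_dist_le avP).
have d3 y : `|iter 1 (rscan k) (iter t2 (rscan k) f1) y - iter i glauber G y| <=
    n%:R * (1 - pmin * k%:R / n%:R) ^+ t1 + k%:R ^+ 2 / n%:R.
  apply: le_trans (ler_distD (rscan k g y) _ _) _; exact: lerD.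
have d4 := avg_dist_le (avPt t3) d3 x.
apply: le_trans (ler_distD (S G x) _ _) _.
by rewrite -addrA; apply: lerD.
Qed.

(** The values of the total spin between [2 * q] and [4 * q] carry a mass of order
    one, since [occ_ge] applies to each of the [q] corresponding counts. *)
Lemma nsq_total_spin_ge q : (16 * q <= n)%N -> (0 < q)%N ->
  160 * crit <= (4 * q)%:R ^+ 2 ->
  q%:R ^+ 2 <= 4 * expR ((4 * q)%:R * step_cost (4 * q)) * nsq pi total_spin.
Proof.
move=> qn q0 qcrit; set E := expR _; set m := (4 * q)%N.
have E0 : 0 < E by exact: expR_gt0.
pose F (j : nat) := occ j * (2 * j%:R - n%:R) ^+ 2.
have nsqE : nsq pi total_spin = \sum_(0 <= j < n.+1) F j.
  rewrite big_mkord -(expect_nplus (fun j => (2 * j%:R - n%:R) ^+ 2)).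
  by apply: eq_bigr => x _; rewrite total_spinE expr2.
have F0 j : 0 <= F j by rewrite mulr_ge0 ?occ_ge0 ?sqr_ge0.
pose h := (n.+1 %/ 2 + q)%N.
have hn : (h + q <= n.+1)%N by rewrite /h; lia.
have sub : \sum_(h <= j < h + q) F j <= nsq pi total_spin.
  have hn1 : (h <= n.+1)%N by apply: leq_trans hn; exact: leq_addr.
  have cat1 : \sum_(0 <= j < n.+1) F j = \sum_(0 <= j < h) F j + \sum_(h <= j < n.+1) F j.
    exact: big_cat_nat.
  have cat2 : \sum_(h <= j < n.+1) F j =
      \sum_(h <= j < h + q) F j + \sum_(h + q <= j < n.+1) F j.
    by apply: big_cat_nat => //; exact: leq_addr.
  rewrite nsqE cat1 cat2.
  rewrite addrCA lerDl addr_ge0 // sumr_ge0 // => j _; exact: F0.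
have Fj j : (h <= j < h + q)%N -> q%:R <= 4 * E * F j.
  move=> hj; have wj : window m j.
    by move: hj; rewrite /window /m /h => /andP[? ?]; apply/andP; lia.
  have m2 : (2 * m <= n)%N by rewrite /m; lia.
  have m0 : (0 < m)%N by rewrite /m; lia.
  have := occ_ge m2 m0 qcrit wj; rewrite -/E => o.
  have j2 : 2 * q%:R <= 2 * j%:R - n%:R :> R.
    have : (n + 2 * q <= 2 * j)%N by move: hj; rewrite /h => /andP[? ?]; lia.
    by rewrite -(ler_nat R) natrD !natrM => ?; lra.
  have qp : 0 <= q%:R :> R by [].
  have j3 : (2 * q%:R) ^+ 2 <= (2 * j%:R - n%:R) ^+ 2 :> R.
    by rewrite lerXn2r ?nnegrE ?mulr_ge0 //; apply: le_trans j2; rewrite mulr_ge0.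
  have o' : 1 <= 16 * q%:R * (E * occ j).
    by apply: le_trans o _; rewrite /m natrM le_eqVlt; apply/orP; left; apply/eqP; ring.
  have eo : 0 <= E * occ j by rewrite mulr_ge0 ?occ_ge0 // ltW.
  rewrite /F (_ : 4 * E * _ = 4 * (E * occ j) * (2 * j%:R - n%:R) ^+ 2); last by ring.
  have h1 := ler_wpM2l (mulr_ge0 (ler0n R 4) eo) j3; apply: le_trans h1.
  have := ler_wpM2l qp o'; rewrite mulr1 => /le_trans; apply.
  by rewrite le_eqVlt; apply/orP; left; apply/eqP; ring.
apply: (@le_trans _ _ (4 * E * \sum_(h <= j < h + q) F j)); last first.
  by rewrite ler_wpM2l // mulr_ge0 // ltW.
rewrite mulr_sumr; apply: (@le_trans _ _ (\sum_(h <= j < h + q) q%:R)).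
  by rewrite sumr_const_nat addKn expr2 mulr_natr.
rewrite big_nat [leRHS]big_nat; apply: ler_sum => j; exact: Fj.
Qed.

Lemma exists_conf_neq : exists x y : conf, total_spin x - total_spin y = 2.
Proof.
pose v : 'I_n := Ordinal n_gt0; pose x : conf := [ffun=> true].
exists (set_spin x v true), (set_spin x v false).
by rewrite !total_spin_set; ring.
Qed.

Section Chain.
Variable k : nat.
Hypothesis kn : (0 < k <= n)%N.
Let K := @randomized_systematic_scan R n 1 k.

Let kn' : (k <= n)%N. Proof. by case/andP: kn. Qed.

Let KE : kact K = rscan k.
Proof. by apply/funext => f; exact: kact_rscan. Qed.

Let avK : averaging (kact K). Proof. by rewrite KE; exact: averaging_rscan. Qed.

Let saK : selfadjoint pi (kact K).
Proof. by rewrite KE; exact: rscan_selfadjoint. Qed.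

Lemma chain_mixing_le t (e : R) : 0 <= e ->
  (forall f, (forall y, 0 <= f y <= 1) ->
     forall x y, `|iter t (rscan k) f x - iter t (rscan k) f y| <= e) ->
  mixing_dist K pi t <= e.
Proof.
move=> e0 h; apply: mixing_dist_le pi_ge0 pi_one avK saK _ _ e0 _ => A x y.
rewrite KE; apply: h => z; rewrite /indic; by case: (z \in A); rewrite ?lexx ler01.
Qed.

Lemma chain_contract t : mixing_dist K pi t <= 1 / 4 ->
  forall g (w : R), (forall x y, `|g x - g y| <= w) ->
  forall x y, `|iter t (rscan k) g x - iter t (rscan k) g y| <= w / 2.
Proof.
move=> h g w gw x y.
have := mixing_dist_osc avK h gw x y.
by rewrite KE (_ : 2 * (1 / 4) * w = w / 2) //; field.
Qed.

(** At time zero oscillations have not decreased. *)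
Lemma mixing_pos t : mixing_dist K pi t <= 1 / 4 -> (0 < t)%N.
Proof.
case: t => // /chain_contract h.
have [x [y xy]] := exists_conf_neq.
pose g z : R := (z == x)%:R.
have gw u z : `|g u - g z| <= 1.
  rewrite /g; case: (u == x); case: (z == x);
    by rewrite ?subrr ?subr0 ?sub0r ?normrN ?normr0 ?normr1.
have := h g 1 gw x y; rewrite /= /g eqxx.
have -> : (y == x) = false.
  apply/eqP => yx; move: xy; rewrite yx subrr => /eqP.
  by rewrite eq_sym pnatr_eq0.
by rewrite subr0 normr1 => ?; lra.
Qed.

(** [relaxation_lower_bound] for the total spin, whose Dirichlet form relative to
    its square norm is at most [eps]. *)
Lemma mixing_lower t : mixing_dist K pi t <= 1 / 4 ->
  nsq pi total_spin <= 16 * expR 4 * (t%:R * k%:R).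
Proof.
move=> h; have nq0 : 0 <= nsq pi total_spin by exact: nsq_ge0 pi_ge0 _.
have [->|nq] := eqVneq (nsq pi total_spin) 0.
  by rewrite !mulr_ge0 ?expR_ge0.
have nqp : 0 < nsq pi total_spin by rewrite lt_def nq.
pose eps := 4 * expR 4 * k%:R / nsq pi total_spin.
have := @relaxation_lower_bound R conf pi pi_ge0 pi_one (rscan k)
  (averaging_rscan kn') (@rscan_selfadjoint k) total_spin eps t
  expect_total_spin nqp _ (chain_contract h).
rewrite mulrBl mul1r /eps mulfVK // lerBlDr -lerBlDl => /(_ (rscan_dirichlet_le kn')).
rewrite -(ler_pM2r nqp) mul1r => /le_trans; apply.
by rewrite le_eqVlt; apply/orP; left; apply/eqP; field.
Qed.

(** All configurations have positive mass, so a small one-site energy bounds every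
    one-site increment, and [n] flips join any two configurations. *)
Lemma mixing_finite : exists t, mixing_dist K pi t <= 1 / 4.
Proof.
have /andP[k0 _] := kn.
pose x0 : conf := [arg min_(x < [ffun=> true]) pi x]%O.
have pi0 y : pi x0 <= pi y by rewrite /x0; case: arg_minP => // i _; exact.
have p0 : 0 < pmin by exact: pmin_gt0.
pose C := 2 * n%:R / (pi x0 * pmin ^+ 2).
have C0 : 0 <= C.
  by apply: divr_ge0; apply: mulr_ge0 => //; [exact: pi_ge0 | exact: sqr_ge0].
pose t := Num.truncn (C * (4 * n%:R) ^+ 2).
have tP : C * (4 * n%:R) ^+ 2 <= t.+1%:R by rewrite ltW // truncnS_gt.
exists t; apply: chain_mixing_le => // f f01 x y.
pose g := iter t (rscan k) f; rewrite -/g.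
have energy : pmin ^+ 2 * grad_energy g <= 2 / t.+1%:R.
  have /= h := @grad_energy_rscan 0 g n_gt0 _.
  have g01 : forall y, 0 <= g y <= 1.
    exact: (avg_range (averaging_iter t (averaging_rscan kn'))).
  have r0 : rscan 0 g = g.
    apply/funext => z; rewrite /rscan -[RHS](mean_cst (utuples_gt0 (leq0n n))).
    by apply: eq_mean => s _; rewrite (tuple0 s).
  have := h g01; rewrite r0 mul0r expr0n mulr0 addr0 scan_nsq0 => /le_trans; apply.
  rewrite ler_wpM2l //.
  have mono : scan_nsq k g <= scan_nsq 1 g by apply: scan_nsq_mono; rewrite k0.
  have := nsq_rscan_le g kn'.
  have := dirichlet_decay pi_ge0 (@rscan_selfadjoint k) f t.
  rewrite -/g => d.
  have : nsq pi f / t.+1%:R <= (t.+1%:R)^-1.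
    rewrite ler_piMl ?invr_ge0 // -[leRHS](expr1n R 2).
    apply: (nsq_le_cst pi_ge0 pi_one) => // z.
    by have /andP[? ?] := f01 z; rewrite ger0_norm.
  move=> h1 h2; apply: le_trans h1; apply: le_trans d.
  by rewrite iterS -/g lerD2l lerN2; exact: le_trans h2 mono.
have grad v z : flip_grad v g z ^+ 2 <= C / t.+1%:R.
  have h1 : pi x0 * flip_grad v g z ^+ 2 <= n%:R * grad_energy g.
    rewrite /grad_energy /mean cardsT card_ord [n%:R * _]mulrA mulfV //
      mul1r (bigD1 v) ?inE //=.
    rewrite -[leLHS]addr0; apply: lerD; last first.
      by apply: sumr_ge0 => u _; exact: nsq_ge0 pi_ge0 _.
    rewrite /nsq /dot /expect (bigD1 z) //= -[leLHS]addr0; apply: lerD.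
      by rewrite -expr2 ler_wpM2r ?sqr_ge0.
    by apply: sumr_ge0 => u _; rewrite mulr_ge0 ?pi_ge0 // -expr2 sqr_ge0.
  have h2 := ler_wpM2l (ltW np) energy.
  have h3 := ler_wpM2l (sqr_ge0 pmin) h1.
  have q0 : 0 < pi x0 * pmin ^+ 2 by rewrite mulr_gt0 ?pi_gt0 // exprn_gt0.
  have -> : C / t.+1%:R = n%:R * (2 / t.+1%:R) / (pi x0 * pmin ^+ 2) by rewrite /C; ring.
  rewrite ler_pdivlMr //; move: h2 h3; move: (2 / t.+1%:R) => T h2 h3.
  by lra.
have grad' v z : `|flip_grad v g z| <= 1 / (4 * n%:R).
  rewrite -(ler_pXn2r (ltn0Sn 1)) ?nnegrE ?divr_ge0 ?mulr_ge0 //.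
  rewrite (real_normK (num_real _)); apply: le_trans (grad v z) _.
  by rewrite expr_div_n expr1n ler_pdivrMr ?ltr0n // mulrAC mul1r ler_pdivlMr ?exprn_gt0 ?mulr_gt0.
pose D (u z : conf) := #|[set v | u v != z v]|.
suff path m : forall u, (D u y <= m)%N -> `|g u - g y| <= m%:R * (1 / (4 * n%:R)).
  apply: le_trans (path n x _) _; first by rewrite -[leqRHS]card_ord max_card.
  by rewrite le_eqVlt; apply/orP; left; apply/eqP; field.
have e0 : 0 <= 1 / (4 * n%:R) :> R by rewrite divr_ge0 ?mulr_ge0.
elim: m => [|m IH] u Dm.
  suff -> : u = y by rewrite subrr normr0 mul0r.
  apply/ffunP => v; apply/eqP; rewrite -[_ == _]negbK; apply/negP => uyv.
  by move: Dm; rewrite leqn0 cards_eq0 => /eqP/setP/(_ v); rewrite !inE uyv.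
have [D0|] := posnP (D u y).
  by apply: le_trans (IH u _) _; rewrite ?D0 // ler_wpM2r // ler_nat.
case/card_gt0P => v; rewrite inE => uyv.
pose u' := set_spin u v (y v).
have Du' : (D u' y <= m)%N.
  rewrite -ltnS; apply: leq_trans Dm; apply: proper_card; apply/properP; split.
    apply/fintype.subsetP => w; rewrite !inE set_spinE.
    by have [->|//] := eqVneq w v; rewrite eqxx.
  by exists v; rewrite !inE ?set_spinE ?eqxx.
have step : `|g u - g u'| <= 1 / (4 * n%:R).
  have := grad' v u; rewrite /flip_grad /u' -{3}(set_spin_id u v).
  move: uyv; case uv : (u v); case yv : (y v) => // _ //.
  by rewrite distrC.
rewrite -natr1 mulrDl (mul1r (1 / _)) [leRHS]addrC.
by apply: le_trans (ler_distD (g u') _ _) _; apply: lerD; [exact: step | exact: IH].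
Qed.

End Chain.

End Model.

(** * Constants uniform in the size *)

Section Asymptotics.
(** The window is [|M| <= 4 * q] with [q ^ 2] between [B * crit] and
    [4 * B * crit]; from [B = 2800] on, the mass escaping from it in
    [rscan_nearly_constant] is at most [700 / (16 * B) <= 1 / 64]. *)
Variables (R : realType) (B : R).
Hypothesis B_ge : 2800 <= B.

Definition logcost : R := 2 * (64 * B) ^+ 2 + 2 * (64 * B).

(** On the scale [m = 4 * q] of order [n ^ (3/4)] the total logarithmic error
    [m * step_cost m], of order [m ^ 4 / n ^ 3 + m ^ 2 / n ^ 2], is bounded
    independently of [n]. *)
Lemma scale_width n : (0 < n)%N -> (32 ^+ 2 * B) ^+ 2 <= n%:R ->
  exists2 q, [/\ (0 < q)%N, (16 * q <= n)%N & B * crit R n <= q%:R ^+ 2] &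
    q%:R ^+ 2 <= 4 * B * crit R n /\
    (4 * q)%:R * step_cost R n (4 * q) <= logcost.
Proof.
move=> n0 nB; have c0 := crit_gt0 R n0; have cn := crit_ge R n0.
have cn2 := crit_le R n0; have c2 := crit_sqr R n.
have n1 : 1 <= n%:R :> R by rewrite ler1n.
have c1 : 1 <= crit R n by exact: le_trans cn.
have B1 := B_ge; have B0 : 0 < B by lra.
pose s : R := Num.sqrt (B * crit R n).
have Bc : 0 <= B * crit R n by rewrite mulr_ge0 // ltW.
have s2 : s ^+ 2 = B * crit R n by rewrite sqr_sqrtr.
have s0 : 0 <= s by exact: sqrtr_ge0.
have s1 : 1 <= s by rewrite -[leLHS]sqrtr1 ler_sqrt //; nra.
pose q := (Num.truncn s).+1.
have q1 : s <= q%:R by rewrite ltW // truncnS_gt.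
have q2 : q%:R <= 2 * s.
  have : (Num.truncn s)%:R <= s by rewrite truncn_le.
  by rewrite /q -natr1 => ?; lra.
have qq1 : B * crit R n <= q%:R ^+ 2 by rewrite -s2 lerXn2r ?nnegrE.
have qq2 : q%:R ^+ 2 <= 4 * B * crit R n.
  by rewrite -mulrA -s2 (_ : 4 * s ^+ 2 = (2 * s) ^+ 2); [rewrite lerXn2r ?nnegrE ?mulr_ge0 | ring].
exists q; first split=> //.
  rewrite -(ler_nat R) natrM -(ler_pXn2r (ltn0Sn 1)) ?nnegrE ?mulr_ge0 //.
  rewrite exprMn; apply: (@le_trans _ _ (32 ^+ 2 * B * crit R n)); first by lra.
  rewrite -(ler_pXn2r (ltn0Sn 1)) ?nnegrE ?mulr_ge0 ?sqr_ge0 ?(ltW B0) ?(ltW c0) //.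
  rewrite exprMn c2 -exprM (exprS _ 3) ler_wpM2r ?exprn_ge0 //.
split=> //; set m : R := (4 * q)%:R.
have m2 : m ^+ 2 <= 64 * B * crit R n.
  by rewrite /m natrM exprMn; lra.
have np : 0 < n%:R :> R by lra.
have -> : m * step_cost R n (4 * q) = 2 * (m ^+ 2) ^+ 2 / n%:R ^+ 3 + 2 * m ^+ 2 / n%:R ^+ 2.
  by rewrite /step_cost -/m; field; rewrite gt_eqF.
have m20 : 0 <= m ^+ 2 by exact: sqr_ge0.
apply: lerD.
  rewrite ler_pdivrMr ?exprn_gt0 // -c2 -mulrA -exprMn ler_wpM2l //.
  by rewrite lerXn2r ?nnegrE ?mulr_ge0 ?(ltW B0) ?(ltW c0).
rewrite ler_pdivrMr ?exprn_gt0 // -mulrA ler_wpM2l //; apply: le_trans m2 _.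
by rewrite ler_wpM2l // mulr_ge0 // ltW.
Qed.

Lemma exists_time (c : R) n k : 0 <= c -> (0 < n)%N -> (0 < k)%N ->
  exists2 t : nat, c * crit R n <= t%:R * k%:R & t%:R <= c * (crit R n / k%:R) + 1.
Proof.
move=> c0 n0 k0; have kp : 0 < k%:R :> R by rewrite ltr0n.
have x0 : 0 <= c * (crit R n / k%:R) by rewrite mulr_ge0 // divr_ge0 // crit_ge0.
exists (Num.truncn (c * (crit R n / k%:R))).+1.
  by rewrite -ler_pdivrMr // -mulrA ltW // truncnS_gt.
by rewrite -natr1 lerD2r truncn_le.
Qed.

(** With [y = a * crit / n], of order [n ^ (1/2)], the power is at most
    [expR (- y) <= (4 / y) ^ 4], of order [1 / n ^ 2], which beats the factor [n]. *)
Lemma exp_decay_bound (a : R) n t k : 0 < a <= 1 -> (0 < n)%N -> (k <= n)%N ->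
  crit R n <= t%:R * k%:R ->
  n%:R * (1 - a * k%:R / n%:R) ^+ t <= 256 / (a ^+ 4 * n%:R).
Proof.
move=> /andP[a0 a1] n0 kn tk.
have np : 0 < n%:R :> R by rewrite ltr0n.
have c0 := crit_gt0 R n0; have c2 := crit_sqr R n.
have kR : k%:R <= n%:R :> R by rewrite ler_nat.
have k0 : 0 <= k%:R :> R by [].
have d0 : 0 <= 1 - a * k%:R / n%:R.
  rewrite subr_ge0 ler_pdivrMr // mul1r; apply: le_trans kR; rewrite ler_piMl //.
pose y := a * crit R n / n%:R; have y0 : 0 < y by rewrite divr_gt0 // mulr_gt0.
have h1 : (1 - a * k%:R / n%:R) ^+ t <= expR (- y).
  apply: (@le_trans _ _ (expR (- (a * k%:R / n%:R)) ^+ t)).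
    by rewrite lerXn2r ?nnegrE ?expR_ge0 // expR_ge1Dx.
  rewrite -expRM_natl ler_expR mulrN lerN2 /y.
  have -> : t%:R * (a * k%:R / n%:R) = a / n%:R * (t%:R * k%:R) by ring.
  have -> : a * crit R n / n%:R = a / n%:R * crit R n by ring.
  by rewrite ler_wpM2l // divr_ge0 ?ltW.
have h2 : (y / 4) ^+ 4 <= expR y.
  rewrite (_ : expR y = expR (y / 4) ^+ 4);
    last by rewrite -expRM_natl; congr expR; field.
  have y40 : 0 <= y / 4 by lra.
  rewrite lerXn2r ?nnegrE ?expR_ge0 //.
  by apply: (@le_trans _ _ (1 + y / 4)); [lra | exact: expR_ge1Dx].
have y4 : 0 < (y / 4) ^+ 4 by rewrite exprn_gt0 // divr_gt0.
apply: (@le_trans _ _ (n%:R * expR (- y))); first by rewrite ler_wpM2l.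
rewrite expRN; apply: (@le_trans _ _ (n%:R * ((y / 4) ^+ 4)^-1)).
  by rewrite ler_wpM2l // lef_pV2 ?posrE ?expR_gt0.
rewrite le_eqVlt; apply/orP; left; apply/eqP.
have -> : (y / 4) ^+ 4 = a ^+ 4 * (crit R n ^+ 2) ^+ 2 / (256 * n%:R ^+ 4).
  by rewrite /y; field; rewrite gt_eqF.
by rewrite c2; field; rewrite !gt_eqF.
Qed.

(** Constants of the upper bound: with [t2] of order [smoothing_time * crit / k]
    and [k ^ 4 <= density ^ 2 * n], the oscillation left in the window after the
    smoothing phase is at most [1 / 32]. *)
Definition window_cost : R := 16 * (64 * B) * expR logcost.
Definition density : R := pmin R ^+ 2 / (128 ^+ 2 * window_cost).
Definition smoothing_time : R := 64 ^+ 2 * window_cost / pmin R ^+ 2.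

Lemma window_cost_gt0 : 0 < window_cost.
Proof.
by have B1 := B_ge; apply: mulr_gt0 (expR_gt0 _); lra.
Qed.

Lemma density_gt0 : 0 < density.
Proof.
apply: divr_gt0; first by rewrite exprn_gt0 ?pmin_gt0.
by apply: mulr_gt0 window_cost_gt0; exact: exprn_gt0.
Qed.

Lemma smoothing_time_gt0 : 0 < smoothing_time.
Proof.
apply: divr_gt0; last by rewrite exprn_gt0 ?pmin_gt0.
by apply: mulr_gt0 window_cost_gt0; exact: exprn_gt0.
Qed.

(** Each of the two terms of the energy is allowed one half of the bound: the
    first fixes [smoothing_time], the second [density]. *)
Lemma window_energy_small n k q t : (0 < n)%N -> (0 < k)%N ->
  q%:R ^+ 2 <= 4 * B * crit R n ->
  (4 * q)%:R * step_cost R n (4 * q) <= logcost ->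
  k%:R ^+ 4 <= density ^+ 2 * n%:R ->
  smoothing_time * crit R n <= t%:R * k%:R ->
  16 * (4 * q)%:R ^+ 2 * expR ((4 * q)%:R * step_cost R n (4 * q)) *
    (2 / (k%:R * t.+1%:R) + 8 * (k%:R / n%:R) ^+ 2) <=
  pmin R ^+ 2 * (1 / 32) ^+ 2.
Proof.
move=> n0 k0 qB qcost kn tk.
have c0 := crit_gt0 R n0; have c2 := crit_sqr R n.
have W0 := window_cost_gt0; have e0 := density_gt0.
have p0 : 0 < pmin R ^+ 2 by rewrite exprn_gt0 ?pmin_gt0.
have kp : 0 < k%:R :> R by rewrite ltr0n.
have np : 0 < n%:R :> R by rewrite ltr0n.
have mB : (4 * q)%:R ^+ 2 <= 64 * B * crit R n by rewrite natrM exprMn; lra.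
have z0 : 0 <= 2 / (k%:R * t.+1%:R) + 8 * (k%:R / n%:R) ^+ 2 :> R.
  by rewrite addr_ge0 ?divr_ge0 ?mulr_ge0 ?sqr_ge0.
apply: (@le_trans _ _ (window_cost * crit R n *
    (2 / (k%:R * t.+1%:R) + 8 * (k%:R / n%:R) ^+ 2))).
  apply: ler_wpM2r => //.
  have -> : window_cost * crit R n = 16 * (64 * B * crit R n) * expR logcost.
    by rewrite /window_cost; ring.
  apply: ler_pM; rewrite ?expR_ge0 ?mulr_ge0 ?sqr_ge0 ?ler_expR //.
  by rewrite ler_wpM2l.
have h1 : window_cost * crit R n * (2 / (k%:R * t.+1%:R)) <= pmin R ^+ 2 / (2 * 32 ^+ 2).
  have tp : 0 < k%:R * t.+1%:R :> R by rewrite mulr_gt0 ?ltr0n.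
  rewrite mulrA ler_pdivrMr //.
  have : smoothing_time * crit R n <= k%:R * t.+1%:R.
    by apply: le_trans tk _; rewrite mulrC ler_wpM2l ?(ltW kp) // ler_nat.
  have p' : 0 <= pmin R ^+ 2 / (2 * 32 ^+ 2) by rewrite divr_ge0 ?sqr_ge0.
  move=> /(ler_wpM2l p'); apply: le_trans.
  rewrite le_eqVlt; apply/orP; left; apply/eqP; rewrite /smoothing_time.
  by field; rewrite gt_eqF // pmin_gt0.
have h2 : window_cost * crit R n * (8 * (k%:R / n%:R) ^+ 2) <= pmin R ^+ 2 / (2 * 32 ^+ 2).
  have kc : k%:R ^+ 2 * crit R n <= density * n%:R ^+ 2.
    have h0 : 0 <= k%:R ^+ 2 * crit R n by apply: mulr_ge0 (ltW c0); exact: sqr_ge0.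
    have h2 : 0 <= density * n%:R ^+ 2 by apply: mulr_ge0 (ltW e0) _; exact: sqr_ge0.
    rewrite -(ler_pXn2r (ltn0Sn 1)) ?nnegrE //.
    have -> : (k%:R ^+ 2 * crit R n) ^+ 2 = k%:R ^+ 4 * n%:R ^+ 3 by rewrite -c2; ring.
    have -> : (density * n%:R ^+ 2) ^+ 2 = (density ^+ 2 * n%:R) * n%:R ^+ 3 by ring.
    by rewrite ler_wpM2r ?exprn_ge0.
  have -> : window_cost * crit R n * (8 * (k%:R / n%:R) ^+ 2) =
      8 * window_cost / n%:R ^+ 2 * (k%:R ^+ 2 * crit R n).
    by field; rewrite gt_eqF.
  have q1 : 0 <= 8 * window_cost / n%:R ^+ 2.
    by rewrite divr_ge0 ?sqr_ge0 // mulr_ge0 // ltW.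
  apply: le_trans (ler_wpM2l q1 kc) _.
  rewrite le_eqVlt; apply/orP; left; apply/eqP; rewrite /density.
  by field; rewrite !gt_eqF.
rewrite mulrDr; apply: le_trans (lerD h1 h2) _.
by rewrite le_eqVlt; apply/orP; left; apply/eqP; field.
Qed.

Lemma upper_large : exists N0 theta C : R, [/\ 0 < theta, 0 < C &
  forall n k, (0 < n)%N -> (0 < k <= n)%N -> N0 <= n%:R ->
    k%:R ^+ 4 <= theta * n%:R ->
  exists2 t, t%:R <= C * (crit R n / k%:R) &
    mixing_dist (@randomized_systematic_scan R n 1 k) (@pi R n) t <= 1 / 4].
Proof.
have p0 := pmin_gt0 R; have p1 := pmin_le1 R.
have e0 := density_gt0; have s0 := smoothing_time_gt0.
have p4 : 0 < pmin R ^+ 4 by rewrite exprn_gt0.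
have p40 : 0 <= 8 * 32 ^+ 2 / pmin R ^+ 4 by apply: divr_ge0 (ltW p4); exact: mulr_ge0.
have B2 : 0 <= (32 ^+ 2 * B) ^+ 2 := sqr_ge0 _.
pose theta := Num.min 1 (density ^+ 2).
have th0 : 0 < theta by rewrite lt_min ltr01 exprn_gt0.
have th1 : theta <= 1 by rewrite ge_min lexx.
have the : theta <= density ^+ 2 by rewrite ge_min lexx orbT.
exists ((32 ^+ 2 * B) ^+ 2 + 8 * 32 ^+ 2 / pmin R ^+ 4 + 32 ^+ 2), theta, (smoothing_time + 8).
split=> //; first by rewrite addr_gt0.
move=> n k n0 kn nN kth; have /andP[k0 kn'] := kn.
have np : 0 < n%:R :> R by rewrite ltr0n.
have [nB nP n_big] : [/\ (32 ^+ 2 * B) ^+ 2 <= n%:R :> R,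
    8 * 32 ^+ 2 / pmin R ^+ 4 <= n%:R :> R & 32 ^+ 2 <= n%:R :> R].
  move: nN p40 B2; move: ((32 ^+ 2 * B) ^+ 2) (_ / pmin R ^+ 4) (n%:R : R) => b c N h h1 h2.
  by clear -h h1 h2; split; lra.
have c0 := crit_gt0 R n0; have cn := crit_ge R n0.
have k4R : k%:R ^+ 4 <= n%:R :> R.
  by apply: le_trans kth _; rewrite ler_piMl // ltW.
have k4 : (k ^ 4 <= n)%N by rewrite -(ler_nat R) natrX.
have k2R : k%:R ^+ 2 <= n%:R / 32 :> R.
  rewrite -(ler_pXn2r (ltn0Sn 1)) ?nnegrE ?divr_ge0 ?sqr_ge0 // -exprM.
  apply: le_trans k4R _.
  have -> : (n%:R / 32) ^+ 2 = n%:R * (n%:R / 32 ^+ 2) :> R by field.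
  have h : 1 <= n%:R / 32 ^+ 2 :> R by rewrite ler_pdivlMr ?exprn_gt0 // mul1r.
  by rewrite (ler_peMr _ h) // ltW.
have kR1 : 1 <= k%:R :> R by rewrite ler1n.
have k2 : (2 * k <= n)%N.
  rewrite -(ler_nat R) natrM; move: (k%:R : R) (n%:R : R) k2R kR1 => K N h h1.
  by clear -h h1; nra.
have [q [q0 qn qB] [qB2 qcost]] := scale_width n0 nB.
have m0 : (0 < 4 * q)%N by rewrite muln_gt0.
have m4 : (4 * (4 * q) <= n)%N by rewrite mulnA.
have m2E : (4 * q)%:R ^+ 2 = 16 * q%:R ^+ 2 :> R by rewrite natrM; ring.
have qB' : 2800 * crit R n <= q%:R ^+ 2.
  by apply: le_trans qB; apply: (ler_wpM2r (ltW c0)); exact: B_ge.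
have mcrit : 160 * crit R n <= (4 * q)%:R ^+ 2.
  by rewrite m2E; move: (q%:R ^+ 2) qB' => Q h; clear -h c0; lra.
have [t1 t1a t1b] := exists_time ler01 n0 k0; rewrite mul1r in t1a.
have [t2 t2a t2b] := exists_time (ltW s0) n0 k0.
have [t3 t3a t3b] := exists_time (ler0n R 2) n0 k0.
exists (t3 + (1 + (t2 + t1)))%N.
  rewrite !natrD.
  have ck1 : 1 <= crit R n / k%:R.
    by rewrite ler_pdivlMr ?ltr0n // mul1r; apply: le_trans cn; rewrite ler_nat.
  move: t1b t2b t3b; move: (crit R n / k%:R) ck1 => z z1.
  move=> h1 h2 h3; rewrite [leRHS]mulrDl; move: (smoothing_time * z) h2 => z2 h2.
  by clear -z1 h1 h2 h3; lra.
apply: (chain_mixing_le n0 kn) => // f f01 x y.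
have kd : k%:R ^+ 4 <= density ^+ 2 * n%:R.
  by apply: le_trans kth _; apply: (ler_wpM2r (ltW np)); exact: the.
have energy := window_energy_small n0 k0 qB2 qcost kd t2a.
have eta0 : 0 <= 1 / 32 :> R by [].
have [c hc] := rscan_nearly_constant n0 t1 k0 k2 k4 m4 m0 mcrit t3a eta0 energy f01.
have b1 : n%:R * (1 - pmin R * k%:R / n%:R) ^+ t1 <= 1 / 32.
  apply: le_trans (exp_decay_bound _ n0 kn' t1a) _; first by rewrite p0 p1.
  rewrite ler_pdivrMr ?mulr_gt0 //; move: nP; rewrite ler_pdivrMr // => h.
  by clear -h; lra.
have b2 : k%:R ^+ 2 / n%:R <= 1 / 32 :> R.
  by rewrite ler_pdivrMr // mulrC mulrA mulr1.
have b3 : (600 * crit R n + 100 * k%:R) / (4 * q)%:R ^+ 2 <= 1 / 64.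
  rewrite ler_pdivrMr ?exprn_gt0 ?ltr0n // m2E.
  have kc : k%:R <= crit R n by apply: le_trans cn; rewrite ler_nat.
  by move: (q%:R ^+ 2) qB' => Q h; clear -h kc; lra.
(* The four errors add up to at most [3 / 32 + 1 / 64] for each of the two starting
   points, hence to at most [7 / 32]. *)
apply: le_trans (ler_distD c _ _) _; rewrite [`|c - _|]distrC.
have := hc x; have := hc y; move: b1 b2 b3.
move: (n%:R * _) (k%:R ^+ 2 / _) ((_ + _) / _) => u1 u2 u3 h1 h2 h3 h4 h5.
by clear -h1 h2 h3 h4 h5; lra.
Qed.

(** The mixing time is at least of order [nsq pi total_spin / k] by
    [mixing_lower], and the square norm is at least of the order of [q ^ 2],
    that is of [crit]. *)
Lemma lower_large : exists N0 c : R, 0 < c /\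
  forall n k t, (0 < n)%N -> (0 < k <= n)%N -> N0 <= n%:R ->
  mixing_dist (@randomized_systematic_scan R n 1 k) (@pi R n) t <= 1 / 4 ->
  c * (crit R n / k%:R) <= t%:R.
Proof.
pose L := expR logcost; have L0 : 0 < L := expR_gt0 _.
have B1 := B_ge; have B0 : 0 < B by lra.
have e4 : 0 < expR 4 :> R := expR_gt0 _.
exists ((32 ^+ 2 * B) ^+ 2), (B / (64 * expR 4 * L)); split.
  by rewrite divr_gt0 // mulr_gt0 // mulr_gt0.
move=> n k t n0 kn nB hmix; have /andP[k0 kn'] := kn.
have kp : 0 < k%:R :> R by rewrite ltr0n.
have c0 := crit_gt0 R n0.
have [q [q0 qn qB] [_ qcost]] := scale_width n0 nB.
have qcrit : 160 * crit R n <= (4 * q)%:R ^+ 2.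
  rewrite natrM exprMn; apply: (@le_trans _ _ (16 * (B * crit R n))).
    by rewrite mulrA ler_wpM2r ?(ltW c0) //; lra.
  by rewrite (_ : 4 ^+ 2 = 16) ?ler_wpM2l //; ring.
have h1 := nsq_total_spin_ge n0 qn q0 qcrit.
have h2 := mixing_lower n0 kn hmix.
have EL : expR ((4 * q)%:R * step_cost R n (4 * q)) <= L by rewrite ler_expR.
have N0 : 0 <= nsq (@pi R n) (@total_spin R n).
  by apply: nsq_ge0; exact: pi_ge0.
have h3 : q%:R ^+ 2 <= 4 * L * (16 * expR 4 * (t%:R * k%:R)).
  apply: le_trans h1 _; apply: ler_pM; rewrite ?mulr_ge0 ?expR_ge0 //.
  by rewrite ler_wpM2l.
have D0 : 0 < 64 * expR 4 * L by rewrite mulr_gt0 // mulr_gt0.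
rewrite mulrA ler_pdivrMr // mulrAC ler_pdivrMr //.
apply: le_trans qB (le_trans h3 _).
by rewrite le_eqVlt; apply/orP; left; apply/eqP; ring.
Qed.

End Asymptotics.

(** * The mixing time *)

Lemma crit_powR (R : realType) n : n%:R `^ (3 / 2) = crit R n.
Proof. by rewrite powRrM powR12_sqrt ?powR_ge0 // powR_mulrn. Qed.

Lemma mixing_bounded (R : realType) (k : nat -> nat) (N : nat) :
  (forall n, (0 < n)%N -> (1 <= k n <= n)%N) ->
  exists M : R, 0 <= M /\ forall n, (0 < n)%N -> (n < N)%N ->
    exists2 t, t%:R <= M &
      mixing_dist (@randomized_systematic_scan R n 1 (k n)) (@pi R n) t <= 1 / 4.
Proof.
move=> hk; elim: N => [|N [M [M0 hM]]]; first by exists 0.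
case: (posnP N) => [->|N0].
  by exists 0; split=> // -[].
have [t ht] := @mixing_finite R N N0 (k N) (hk N N0).
exists (M + t%:R); split; first by rewrite addr_ge0.
move=> n n0; rewrite ltnS leq_eqVlt => /orP[/eqP ->|nN].
  by exists t => //; rewrite lerDr.
have [t' t'M ht'] := hM n n0 nN; exists t' => //.
by apply: le_trans t'M _; rewrite lerDl.
Qed.

Local Open Scope classical_set_scope.
Local Open Scope ring_scope.

Theorem theorem1p2 (R : realType) (k : nat -> nat)
  (hk : forall n : nat, (0 < n)%N -> (1 <= k n <= n)%N)
  (hko : (fun n : nat => (k n)%:R : R) =o_\oo (fun n : nat => n%:R `^ (1 / 4) : R)) :
  exists c1 c2 : R, [/\ 0 < c1, 0 < c2 &
    forall n : nat, (0 < n)%N ->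
      let t_mix : R -> \bar R :=
        mixing_time (@randomized_systematic_scan R n 1 (k n)) (@gibbs R n 1) in
      ((c1 * (n%:R `^ (3 / 2) / (k n)%:R))%:E <= t_mix (1 / 4)%R)%E /\
      (t_mix (1 / 4)%R <= (c2 * (n%:R `^ (3 / 2) / (k n)%:R))%:E)%E].
Proof.
have [N1 [theta [C [theta0 C0 upper]]]] := upper_large (lexx (2800 : R)).
have [N2 [c [c0 lower]]] := lower_large (lexx (2800 : R)).
have [N3 kN3] : exists N3, forall n, (N3 <= n)%N -> (k n)%:R ^+ 4 <= theta * n%:R.
  (* [e <= 1] gives [e ^+ 4 <= e <= theta]. *)
  pose e : R := Num.min 1 theta; have e0 : 0 < e by rewrite lt_min ltr01.
  move: hko => /eqoP /(_ e e0) [N3 _ hN3]; exists N3 => n nN.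
  have := hN3 n nN; rewrite /= !ger0_norm ?powR_ge0 // => kn.
  have : (k n)%:R ^+ 4 <= (e * n%:R `^ (1 / 4)) ^+ 4.
    by rewrite lerXn2r ?nnegrE ?mulr_ge0 ?powR_ge0 // ltW.
  move=> /le_trans; apply.
  rewrite exprMn -[(n%:R `^ _) ^+ 4]powR_mulrn ?powR_ge0 // -powRrM.
  rewrite (_ : 1 / 4 * 4 = 1); last by field.
  rewrite powRr1 // ler_wpM2r //; apply: (@le_trans _ _ e);
    last by rewrite ge_min lexx orbT.
  by rewrite (exprS _ 3) ler_piMr ?(ltW e0) // exprn_ile1 ?(ltW e0) // ge_min lexx.
pose N := maxn N3 (maxn (Num.truncn N1).+1 (Num.truncn N2).+1).
have big n : (N <= n)%N -> [/\ (N3 <= n)%N, N1 <= n%:R & N2 <= n%:R].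
  rewrite !geq_max => /and3P[n3 n1 n2]; split=> //.
    by apply: le_trans (ltW (truncnS_gt _)) _; rewrite ler_nat.
  by apply: le_trans (ltW (truncnS_gt _)) _; rewrite ler_nat.
have [M [M0 small]] := mixing_bounded R N hk.
(* For [n < N] the lower bound holds because [t >= 1] and
   [crit R n <= n ^+ 2 <= N ^+ 2]. *)
pose c1 := Num.min c (1 / (N%:R ^+ 2 + 1)).
have N2p : 0 < N%:R ^+ 2 + 1 :> R by rewrite ltr_wpDl ?sqr_ge0.
exists c1, (C + M); split; first by rewrite lt_min c0 divr_gt0.
  by rewrite ltr_wpDr.
move=> n n0 t_mix; rewrite crit_powR.
have kn := hk n n0; have /andP[k1 kn'] := kn.
have kp : 0 < (k n)%:R :> R by rewrite ltr0n.
have ck0 : 0 <= crit R n / (k n)%:R by rewrite divr_ge0 ?crit_ge0.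
have ck1 : 1 <= crit R n / (k n)%:R.
  by rewrite ler_pdivlMr // mul1r; apply: le_trans (crit_ge R n0); rewrite ler_nat.
split.
  apply/ereal_infP => _ [t /= ht <-]; rewrite lee_fin.
  have [/big[_ _ nN2]|nN] := leqP N n.
    apply: le_trans (lower n (k n) t n0 kn nN2 ht).
    by rewrite ler_wpM2r // ge_min lexx.
  have t0 := mixing_pos n0 kn ht.
  apply: (@le_trans _ _ 1); last by rewrite ler1n.
  apply: (@le_trans _ _ (1 / (N%:R ^+ 2 + 1) * (N%:R ^+ 2 + 1)));
    last by rewrite divfK ?gt_eqF.
  apply: ler_pM => //.
  - by rewrite le_min (ltW c0) divr_ge0 // ltW.
  - by rewrite ge_min lexx orbT.
  apply: (@le_trans _ _ (crit R n)).
    by rewrite ler_pdivrMr // ler_peMr ?crit_ge0 // ler1n.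
  apply: le_trans (crit_le R n0) _; rewrite ler_wpDr // lerXn2r ?nnegrE //.
  by rewrite ler_nat ltnW.
have [t tC ht] : exists2 t, t%:R <= (C + M) * (crit R n / (k n)%:R) &
    mixing_dist (@randomized_systematic_scan R n 1 (k n)) (@gibbs R n 1) t <= 1 / 4.
  have [/big[n3 n1 _]|nN] := leqP N n.
    have [t tC ht] := upper n (k n) n0 kn n1 (kN3 n n3).
    by exists t => //; apply: le_trans tC _; rewrite ler_wpM2r // lerDl.
  have [t tM ht] := small n n0 nN; exists t => //.
  apply: le_trans tM _; apply: (@le_trans _ _ (C + M)); first by rewrite lerDr ltW.
  by rewrite ler_peMr // addr_ge0 // ltW.
apply: le_trans (_ : t%:R%:E <= _)%E; last by rewrite lee_fin.
by apply: ereal_inf_lbound; exists t.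
Qed.
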